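(* Let $k$ be a field of characteristic $\ell>0$, $q$ a prime power, $n\ge1$. Let $\kappa$ be the $\ell$-adic valuation of the number of full flags in $\mathbb F_q^n$. For each $i\ge0$, the $\mathbb F_q^n$-weight space of the $i$th successive quotient $(\Delta_{\{0\},k})^i/(\Delta_{\{0\},k})^{i+1}$ of the Jantzen filtration of the standard $S_k(PG(n-1,q))$-module $\Delta_{\{0\},k}$ is isomorphic as a $GL_n(\mathbb F_q)$-module to the successive quotient $M(\kappa-i)$ of Gow's Jantzen filtration of $\mathrm{St}^k(\mathbb F_q^n)$. In particular, the $\mathbb F_q^n$-weight space of the simple module $L_{\{0\},k}=(\Delta_{\{0\},k})^0/(\Delta_{\{0\},k})^1$ is isomorphic to the socle $\mathrm{soc}(\mathrm{St}^k(\mathbb F_q^n))$ of $\mathrm{St}^k(\mathbb F_q^n)$.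
   Context: Algebra. For subspaces of $\mathbb{F}_q^n$ write $V\lessdot W$ (or $W\gtrdot V$) if $V\subset W$ and $\dim W=\dim V+1$. A flag path is a finite nonempty sequence $(V_1,\dots,V_l)$ of subspaces such that for each $i<l$ either $V_i\lessdot V_{i+1}$ or $V_i\gtrdot V_{i+1}$. The free $\mathbb{Z}$-module on flag paths is an algebra under concatenation ($(K_1,\dots,K_l)\cdot(L_1,\dots,L_{l'})=(K_1,\dots,K_l=L_1,L_2,\dots,L_{l'})$ if $K_l=L_1$, else $0$). $S(PG(n-1,q))$ is its quotient by the two-sided ideal generated by: (FS) for $V\subset W$ with $\dim W=\dim V+2$: $\sum_X (V\lessdot X\lessdot W)=0=\sum_X (W\gtrdot X\gtrdot V)$, sums over $X$ with $V\lessdot X\lessdot W$; ($\bigwedge$) for $V\lessdot W\gtrdot V'$: $(V\lessdot W\gtrdot V')=q^{\dim V}(V)$ if $V=V'$, and $=-(V\gtrdot V\cap V'\lessdot V')$ if $V\ne V'$. $S_k=S\otimes_{\mathbb Z}k$; the $W$-weight space of a left module $X$ is $X^W=(W)X$. Standard module and Jantzen filtration. $\Delta_{\{0\}}\subset S(PG(n-1,q))$ is the left ideal spanned by flags $(V_m\gtrdot\dots\gtrdot V_1\gtrdot\{0\})$; it is the free $\mathbb Z$-module on such flags modulo the (FS) relations. The symmetric form $\langle\,,\rangle:\Delta_{\{0\}}\times\Delta_{\{0\}}\to\mathbb Z$ is defined on flags $V_\bullet=(V_l\gtrdot\dots\gtrdot V_1\gtrdot\{0\})$, $W_\bullet=(W_m\gtrdot\dots\gtrdot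 W_1\gtrdot\{0\})$ by $\langle V_\bullet,W_\bullet\rangle(\{0\})=(\{0\},W_1,\dots,W_m)\cdot(V_l,\dots,V_1,\{0\})$ (always an integer multiple of $(\{0\})$). Put $\Delta_{\{0\}}^i=\{x:\langle x,v\rangle\in\ell^i\mathbb Z\ \forall v\in\Delta_{\{0\}}\}$, $\Delta_{\{0\},k}=\Delta_{\{0\}}\otimes k$, and let $(\Delta_{\{0\},k})^i$ be the image of $\Delta^i_{\{0\}}\otimes k$ in $\Delta_{\{0\},k}$. $GL_n(\mathbb F_q)$ acts on the $\mathbb F_q^n$-weight spaces via its action on full flags. Gow's filtration. $G=GL_n(\mathbb F_q)$, $B$ upper triangular matrices, $U$ upper unitriangular matrices, $\mathfrak S_n\subset G$ permutation matrices, $\mathfrak e=(\sum_{\sigma\in\mathfrak S_n}\mathrm{sgn}(\sigma)\sigma)\sum_{b\in B}b$. For a commutative ring $R$, $\mathrm{St}^R(\mathbb F_q^n)=RG\,\mathfrak e$, with $R$-basis $\{u\mathfrak e\}_{u\in U}$. Let $f$ be the symmetric $\mathbb Z$-bilinear form on $\mathrm{St}^{\mathbb Z}(\mathbb F_q^n)$ with $f(u_1\mathfrak e,u_2\mathfrak e)=|\{w\in\mathfrak S_n:wu_1^{-1}u_2w^{-1}\in U\}|$. $I(i)\subseteq\mathrm{St}^k(\mathbb F_q^n)$ is the image of $\{x\in\mathrm{St}^{\mathbb Z}(\mathbb F_q^n):f(x,y)\in\ell^i\mathbb Z\ \forall y\}\otimes k$, and $M(i)=I(i)/I(i+1)$ (with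 $M(i)=0$ for $i<0$). *)

(* Defs.v *)
From HB Require Import structures.
From mathcomp Require Import all_boot all_order all_fingroup all_algebra.
From mathcomp Require Import generic_quotient boolp classical_sets.
From mathcomp.multinomials Require Import freeg.

Set Implicit Arguments.
Unset Strict Implicit.
Unset Printing Implicit Defensive.

Import GRing.Theory.

Local Open Scope classical_set_scope.
Local Open Scope ring_scope.
Local Open Scope quotient_scope.

Section Submodules.
Variables (R : nzRingType) (X : lmodType R).
Implicit Types P N : set X.

Definition submodule N :=
  N 0 /\ forall (a : R) (x y : X), N x -> N y -> N (a *: x + y).

Definition lin_span P : set X :=
  [set x | forall N, submodule N -> P `<=` N -> N x].

Lemma submodule_span P : submodule (lin_span P).
Proof.
split=> [N [N0 _] _ //|a x y Px Py N subN PN].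
by apply: subN.2; [apply: Px | apply: Py].
Qed.

Lemma sub_span P : P `<=` lin_span P.
Proof. by move=> x Px N _; apply. Qed.

Lemma span_id N : submodule N -> lin_span N = N.
Proof.
by move=> subN; apply/seteqP; split; [move=> x; apply | apply: sub_span].
Qed.

Definition spanb P : {pred X} := fun x => `[< lin_span P x >].

Fact spanb_submod_closed P : submod_closed (spanb P).
Proof.
have [P0 PD] := submodule_span P.
split=> [|a x y /asboolP Px /asboolP Py]; first exact/asboolP.
by apply/asboolP; apply: PD.
Qed.

HB.instance Definition _ P :=
  GRing.isSubmodClosed.Build R X (spanb P) (spanb_submod_closed P).

Record submod P := Submod { submod_val : X; _ : submod_val \in spanb P }.
HB.instance Definition _ P := [isSub for @submod_val P].
HB.instance Definition _ P := [Choice of submod P by <:].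
HB.instance Definition _ P :=
  [SubChoice_isSubLmodule of submod P by <:].

Definition quomod P := 
  Quotient.quot (GRing.ZmodClosed.clone X (spanb P) _).
HB.instance Definition _ P := GRing.Zmodule.on (quomod P).
HB.instance Definition _ P := Quotient.on (quomod P).

Definition quo P : X -> quomod P := \pi_(quomod P).

Lemma quoP P x y : quo P x = quo P y <-> lin_span P (x - y).
Proof.
split=> [/eqP|Pxy]; first by rewrite -Quotient.idealrBE => /asboolP.
by apply/eqP; rewrite -Quotient.idealrBE; apply/asboolP.
Qed.

Lemma quo_repr P (z : quomod P) : quo P (repr z) = z.
Proof. exact: reprK. Qed.

Fact quo_zmod P : zmod_morphism (quo P).
Proof. by move=> x y; rewrite /quo !piE. Qed.
HB.instance Definition _ P :=
  GRing.isZmodMorphism.Build X (quomod P) (quo P) (@quo_zmod P).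

Definition quo_scale P (a : R) (z : quomod P) := quo P (a *: repr z).

Lemma quo_scaleE P a x : quo_scale a (quo P x) = quo P (a *: x).
Proof.
apply/quoP; rewrite -scalerBr -[_ *: _]addr0.
have [P0 PD] := submodule_span P; apply: PD => //.
by apply/quoP; rewrite quo_repr.
Qed.

Fact quo_scaleA P a b (z : quomod P) :
  quo_scale a (quo_scale b z) = quo_scale (a * b) z.
Proof. by rewrite -[z]quo_repr !quo_scaleE scalerA. Qed.
Fact quo_scale1 P : left_id 1 (@quo_scale P).
Proof. by move=> z; rewrite -[z]quo_repr quo_scaleE scale1r. Qed.
Fact quo_scaleDr P : right_distributive (@quo_scale P) +%R.
Proof.
move=> a z t; rewrite -[z]quo_repr -[t]quo_repr -raddfD !quo_scaleE.
by rewrite scalerDr raddfD.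
Qed.
Fact quo_scaleDl P z :
  {morph (@quo_scale P)^~ z : a b / a + b >-> a + b}.
Proof. by move=> a b; rewrite -[z]quo_repr !quo_scaleE scalerDl raddfD. Qed.

HB.instance Definition _ P :=
  GRing.Zmodule_isLmodule.Build R (quomod P)
    (@quo_scaleA P) (@quo_scale1 P) (@quo_scaleDr P) (@quo_scaleDl P).

End Submodules.

Section ExtensionOfScalars.
Variables (k : nzRingType) (M : zmodType).

Definition tensor_rel : set {freeg M / k} :=
  [set r | exists x y : M, r = << x + y >> - << x >> - << y >>].

(* M ⊗ k (over the integers), as the free k-module on the set M modulo the
   relations making x |-> x ⊗ 1 additive *)
Definition extscal := quomod tensor_rel.
HB.instance Definition _ := GRing.Lmodule.on extscal.

(* x ⊗ 1 *)
Definition tens1 (x : M) : extscal := quo tensor_rel << x >>.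

(* x ⊗ a |-> a f(x), for f additive *)
Definition extscal_lift (N : lmodType k) (f : M -> N) (z : extscal) : N :=
  fglift f (repr z).

End ExtensionOfScalars.

Section ExtensionOfScalarsTheory.
Variable k : nzRingType.

Lemma freeg_ind1 (K : choiceType) (P : {freeg K / k} -> Prop) :
  submodule P -> (forall x, P << x >>) -> forall D, P D.
Proof.
move=> [P0 PD] P1; apply: freeg_ind_dom0 => // a x D _ _ PD'.
suff -> : << a *g x >> = a *: << x >> :> {freeg K / k} by apply: PD.
by apply/eqP/freeg_eqP => y; rewrite coeffZ !coeffU mul1r.
Qed.

Lemma fglift_linear (K : choiceType) (N : lmodType k) (f : K -> N) a D E :
  fglift f (a *: D + E) = a *: fglift f D + fglift f E.
Proof.
have addf := lift_is_additive f.
have f0 : fglift f 0 = 0 by rewrite -{1}(subrr 0) addf subrr.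
have fN x : fglift f (- x) = - fglift f x by rewrite -sub0r addf f0 sub0r.
have fD x y : fglift f (x + y) = fglift f x + fglift f y.
  by rewrite -{1}[y]opprK addf fN opprK.
rewrite fD; congr (_ + _).
have fZ b x : fglift f << b *g x >> = b *: f x by rewrite liftU.
have addZ (c b : k) (x : K) :
    c *: << b *g x >> = << (c * b) *g x >> :> {freeg K / k}.
  by apply/eqP/freeg_eqP => y; rewrite coeffZ !coeffU mulrA.
elim/(@freeg_ind_dom0 k K): D => [|b x D _ _ IH].
  by rewrite scaler0 f0 scaler0.
by rewrite scalerDr !fD addZ !fZ IH scalerDr scalerA.
Qed.

Lemma fglift1 (K : choiceType) (N : lmodType k) (f : K -> N) x :
  fglift f << x >> = f x.
Proof. by rewrite liftU scale1r. Qed.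

Variables (M : zmodType) (N : lmodType k) (f : M -> N).
Hypothesis addf : zmod_morphism f.

Lemma extscal_lift_quo (D : {freeg M / k}) :
  extscal_lift f (quo (@tensor_rel k M) D) = fglift f D.
Proof.
apply/eqP; rewrite -subr_eq0; apply/eqP.
have fB := lift_is_additive f; rewrite /extscal_lift -fB.
have : lin_span (@tensor_rel k M) (repr (quo (@tensor_rel k M) D) - D).
  by apply/quoP; rewrite quo_repr.
pose K := [set E : {freeg M / k} | fglift f E = 0].
apply: (_ : forall x, lin_span (@tensor_rel k M) x -> K x).
move=> E; apply; first split.
- by have := fB 0 0; rewrite !subrr.
- by move=> a x y; rewrite /K /= fglift_linear => -> ->; rewrite scaler0 addr0.
move=> _ [x [y ->]]; rewrite /K /= !fB !fglift1.
have f0 : f 0 = 0 by have := addf 0 0; rewrite !subrr.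
have fN z : f (- z) = - f z by rewrite -[- z]sub0r addf f0 sub0r.
by rewrite -{1}[y]opprK addf fN opprK -addrA -opprD subrr.
Qed.

Lemma extscal_lift_tens1 x : extscal_lift f (tens1 k x) = f x.
Proof. by rewrite extscal_lift_quo fglift1. Qed.

Lemma extscal_lift_linear a z t :
  extscal_lift f (a *: z + t) = a *: extscal_lift f z + extscal_lift f t.
Proof.
rewrite -[z]quo_repr -[t]quo_repr.
rewrite (_ : a *: _ = quo _ (a *: repr z)) ?quo_repr //.
rewrite -[t in LHS]quo_repr -raddfD.
by rewrite !extscal_lift_quo fglift_linear.
Qed.

End ExtensionOfScalarsTheory.

(* An R-module with a family of operators indexed by Op: a G-module when Op is
   a group G, a module over an algebra when Op is that algebra.  The laws of an
   action are not part of the record.  [subrep] and [quorep] carry the induced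
   operators: they are used for subsets whose span is stable under Op, where
   the default value of [insubd] is not reached and the class of op g (repr z)
   does not depend on the representative. *)
Record rep (R : nzRingType) (Op : Type) :=
  Rep { rep_mod :> lmodType R; op : Op -> rep_mod -> rep_mod }.

Section Representations.
Variables (R : nzRingType) (Op : Type).
Implicit Types X Y : rep R Op.

Definition subrep X (P : set X) : rep R Op :=
  Rep (fun g (x : submod P) => insubd (0 : submod P) (op g (val x))).

Definition quorep X (P : set X) : rep R Op :=
  Rep (fun g (z : quomod P) => quo P (op g (repr z))).

Definition subquorep X (A B : set X) : rep R Op :=
  quorep [set x : subrep A | B (val (x : submod A))].

Definition rep_iso X Y : Prop :=
  exists f : {linear X -> Y},
    bijective f /\ forall g x, f (op g x) = op g (f x).

Definition op_stable X (N : set X) : Prop :=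
  submodule N /\ forall g x, N x -> N (op g x).

Definition simple_rep X : Prop :=
  (exists x : X, x != 0) /\
  forall N : set X, op_stable N -> N = [set 0] \/ N = setT.

Definition socle_rep X : rep R Op :=
  @subrep X [set x | exists N, [/\ op_stable N, simple_rep (subrep N) & N x]].

End Representations.

Definition restrict_ops (R : nzRingType) (Op Op' : Type) (h : Op' -> Op)
  (X : rep R Op) : rep R Op' := Rep (fun g (x : X) => op (h g) x).

Section VspaceFinite.
Import VectorInternalTheory.
Variables (F : finFieldType) (vT : vectType F).
HB.instance Definition _ := [Countable of {vspace vT} by <:].
HB.instance Definition _ := [Finite of {vspace vT} by <:].
End VspaceFinite.

(* The vector space is F^(n+1), q is #|F|, and GL acts on column vectors. *)
Section FlagPaths.
Variables (F : finFieldType) (n : nat).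

Local Notation subspace := {vspace 'cV[F]_n.+1}.
Implicit Types (V W X : subspace) (s : seq subspace).

Definition covers V W : bool := (V <= W)%VS && (\dim W == (\dim V).+1).

Definition is_fpath s : bool :=
  (s != [::]) && sorted (fun V W => covers V W || covers W V) s.

Record fpath := Fpath { fpath_seq :> seq subspace; _ : is_fpath fpath_seq }.
HB.instance Definition _ := [isSub for fpath_seq].
HB.instance Definition _ := [Choice of fpath by <:].

Definition pathalg := {freeg fpath / int}.
HB.instance Definition _ := GRing.Lmodule.on pathalg.

(* The basis element of a flag path given as a sequence, 0 if s is not one *)
Definition walk s : pathalg :=
  if insub s is Some p then << p : fpath >> else 0.

Definition mul_fpath (p r : fpath) : pathalg :=
  if last 0%VS p == head 0%VS r then walk (p ++ behead r) else 0.

Definition pathalg_mul (x y : pathalg) : pathalg :=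
  fglift (fun p => fglift (mul_fpath p) y) x.

Definition pathalg_one : pathalg := \sum_(V : subspace) walk [:: V].

Lemma walk_fpath (p : fpath) : walk p = << p >>.
Proof. by rewrite /walk valK. Qed.

Lemma is_fpath_cat (s t : seq subspace) :
  is_fpath s -> is_fpath t -> last 0%VS s = head 0%VS t ->
  is_fpath (s ++ behead t) /\ last 0%VS (s ++ behead t) = last 0%VS t.
Proof.
case: s => [//|x s]; case: t => [//|y t] Hs Ht /= exy.
rewrite last_cat exy; split=> //.
by move: Hs Ht; rewrite /is_fpath /= cat_path exy => -> ->.
Qed.

Fact pathalg_mulDl : left_distributive pathalg_mul +%R.
Proof.
by move=> x y z; rewrite -[x]scale1r /pathalg_mul fglift_linear !scale1r.
Qed.

Lemma pathalg_mulP (a : int) x y z :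
  pathalg_mul x (a *: y + z) = a *: pathalg_mul x y + pathalg_mul x z.
Proof.
elim/(@freeg_ind1 int fpath): x => [|p].
  have f0 (f : fpath -> pathalg) : fglift f 0 = 0.
    by have := lift_is_additive f 0 0; rewrite !subrr.
  split=> [|b x t Hx Ht]; first by rewrite /pathalg_mul !f0 scaler0 addr0.
  move: Hx Ht; rewrite /pathalg_mul !fglift_linear => -> ->.
  by rewrite !scalerDr !scalerA mulrC addrACA.
by rewrite /pathalg_mul !fglift1 fglift_linear.
Qed.

Fact pathalg_mulDr : right_distributive pathalg_mul +%R.
Proof. by move=> x y z; have := pathalg_mulP 1 x y z; rewrite !scale1r. Qed.

Lemma pathalg_mulPl (a : int) x y z :
  pathalg_mul (a *: y + z) x = a *: pathalg_mul y x + pathalg_mul z x.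
Proof. by rewrite /pathalg_mul fglift_linear. Qed.

Lemma pathalg_mul0 x : pathalg_mul x 0 = 0.
Proof.
by have := pathalg_mulP (-1) x 0 0; rewrite scaler0 addr0 scaleN1r addNr. Qed.

Lemma pathalg_0mul x : pathalg_mul 0 x = 0.
Proof.
by have := pathalg_mulPl (-1) x 0 0; rewrite scaler0 addr0 scaleN1r addNr. Qed.

Lemma walkM (s t : seq subspace) : is_fpath s -> is_fpath t ->
  pathalg_mul (walk s) (walk t) =
  if last 0%VS s == head 0%VS t then walk (s ++ behead t) else 0.
Proof.
move=> Hs Ht; rewrite -[s]/(val (Fpath Hs)) -[t]/(val (Fpath Ht)).
by rewrite !walk_fpath /pathalg_mul !fglift1.
Qed.

Fact pathalg_mulA : associative pathalg_mul.
Proof.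
move=> x y z; elim/(@freeg_ind1 int fpath): x => [|p].
  split=> [|a x t Hx Ht]; first by rewrite !pathalg_0mul.
  by rewrite !pathalg_mulPl Hx Ht.
elim/(@freeg_ind1 int fpath): y => [|q].
  split=> [|a x t Hx Ht]; first by rewrite !(pathalg_mul0, pathalg_0mul).
  by rewrite !(pathalg_mulPl, pathalg_mulP) Hx Ht.
elim/(@freeg_ind1 int fpath): z => [|r].
  split=> [|a x t Hx Ht]; first by rewrite !pathalg_mul0.
  by rewrite !pathalg_mulP Hx Ht.
rewrite -!walk_fpath.
have Hp : is_fpath p := valP p; have Hq : is_fpath q := valP q.
have Hr : is_fpath r := valP r.
rewrite !walkM //.
have hqr : head 0%VS (q ++ behead r) = head 0%VS q by case: (fpath_seq q) Hq.
have [epq|npq] := @eqP _ (last 0%VS p) (head 0%VS q); last first.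
  rewrite pathalg_0mul; case: eqP => [eqr|_]; last by rewrite pathalg_mul0.
  have [Hqr _] := is_fpath_cat Hq Hr eqr.
  by rewrite walkM // hqr; case: eqP.
have [Hpq lpq] := is_fpath_cat Hp Hq epq.
rewrite [RHS]walkM // lpq; case: eqP => [eqr|_]; last by rewrite pathalg_mul0.
have [Hqr _] := is_fpath_cat Hq Hr eqr; rewrite walkM // hqr epq eqxx -catA.
by case: (fpath_seq q) Hq.
Qed.

Fact pathalg_mul1 : right_id pathalg_one pathalg_mul.
Proof.
move=> x; elim/(@freeg_ind1 int fpath): x => [|p].
  split=> [|a x y Hx Hy]; first by rewrite pathalg_0mul.
  by rewrite pathalg_mulPl Hx Hy.
rewrite /pathalg_one (big_morph _ (pathalg_mulDr << p >>) (pathalg_mul0 _)).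
rewrite (bigD1 (last 0%VS p)) //= -walk_fpath walkM ?(valP p) //= eqxx cats0.
rewrite big1 ?addr0 // => V nV.
by rewrite walkM ?(valP p) //= eq_sym (negbTE nV).
Qed.

Fact pathalg_1mul : left_id pathalg_one pathalg_mul.
Proof.
move=> x; elim/(@freeg_ind1 int fpath): x => [|p].
  split=> [|a x y Hx Hy]; first by rewrite pathalg_mul0.
  by rewrite pathalg_mulP Hx Hy.
rewrite /pathalg_one.
rewrite (big_morph (fun y => pathalg_mul y << p >>)
  (fun y z => pathalg_mulDl y z _) (pathalg_0mul _)).
rewrite (bigD1 (head 0%VS p)) //= -walk_fpath walkM ?(valP p) //= eqxx.
rewrite big1 ?addr0 => [|V nV].
  by case: (fpath_seq p) (valP p : is_fpath p).
by rewrite walkM ?(valP p) //= (negbTE nV).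
Qed.

HB.instance Definition _ := GRing.Zmodule_isPzRing.Build pathalg
  pathalg_mulA pathalg_1mul pathalg_mul1 pathalg_mulDl pathalg_mulDr.

Inductive pg_relation : pathalg -> Prop :=
| FS_up V W of (V <= W)%VS & \dim W = (\dim V + 2)%N :
    pg_relation (\sum_(X | covers V X && covers X W) walk [:: V; X; W])
| FS_down V W of (V <= W)%VS & \dim W = (\dim V + 2)%N :
    pg_relation (\sum_(X | covers V X && covers X W) walk [:: W; X; V])
| wedge_eq V W of covers V W :
    pg_relation (walk [:: V; W; V] - walk [:: V] *+ (#|F| ^ \dim V))
| wedge_neq V W V' of covers V W & covers V' W & V != V' :
    pg_relation (walk [:: V; W; V'] + walk [:: V; (V :&: V')%VS; V']).

Definition two_sided_ideal (J : set pathalg) : Prop :=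
  submodule J /\ forall a x, J x -> J (a * x) /\ J (x * a).

Definition pg_ideal : set pathalg :=
  [set x | forall J, two_sided_ideal J -> pg_relation `<=` J -> J x].

Lemma pg_ideal_two_sided : two_sided_ideal pg_ideal.
Proof.
split; first split=> [J [[]]//|a x y Hx Hy J JI JR].
  by apply: JI.1.2; [apply: Hx | apply: Hy].
by move=> a x Hx; split=> J JI JR; have [] := JI.2 a _ (Hx J JI JR).
Qed.

Definition PGalg := quomod pg_ideal.
HB.instance Definition _ := GRing.Lmodule.on PGalg.

Definition PGclass : pathalg -> PGalg := quo pg_ideal.

Definition PGalg_one : PGalg := PGclass 1.
Definition PGalg_mul (x y : PGalg) : PGalg := PGclass (repr x * repr y).

Lemma PGclassM (x y : pathalg) :
  PGalg_mul (PGclass x) (PGclass y) = PGclass (x * y).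
Proof.
have [subI mulI] := pg_ideal_two_sided.
have Irepr z : pg_ideal (repr (PGclass z) - z).
  have : lin_span pg_ideal (repr (PGclass z) - z).
    by apply/quoP; rewrite quo_repr.
  by rewrite {1}(span_id subI).
apply/quoP; apply: sub_span; set x' := repr _; set y' := repr _.
have -> : x' * y' - x * y = 1 *: ((x' - x) * y') + x * (y' - y).
  by rewrite scale1r mulrBl mulrBr addrA subrK.
apply: subI.2; first exact: (mulI _ _ (Irepr x)).2.
exact: (mulI _ _ (Irepr y)).1.
Qed.

Lemma PGclass_repr (x : PGalg) : PGclass (repr x) = x.
Proof. exact: quo_repr. Qed.

Lemma PGclassD (x y : pathalg) : PGclass (x + y) = PGclass x + PGclass y.
Proof. exact: raddfD. Qed.

Fact PGalg_mulA : associative PGalg_mul.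
Proof.
move=> x y z; rewrite -[x]PGclass_repr -[y]PGclass_repr -[z]PGclass_repr.
by rewrite !PGclassM mulrA.
Qed.
Fact PGalg_1mul : left_id PGalg_one PGalg_mul.
Proof. by move=> x; rewrite -[x]PGclass_repr PGclassM mul1r. Qed.
Fact PGalg_mul1 : right_id PGalg_one PGalg_mul.
Proof. by move=> x; rewrite -[x]PGclass_repr PGclassM mulr1. Qed.
Fact PGalg_mulDl : left_distributive PGalg_mul +%R.
Proof.
move=> x y z; rewrite -[x]PGclass_repr -[y]PGclass_repr -[z]PGclass_repr.
by rewrite -PGclassD !PGclassM mulrDl PGclassD.
Qed.
Fact PGalg_mulDr : right_distributive PGalg_mul +%R.
Proof.
move=> x y z; rewrite -[x]PGclass_repr -[y]PGclass_repr -[z]PGclass_repr.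
by rewrite -PGclassD !PGclassM mulrDr PGclassD.
Qed.

HB.instance Definition _ := GRing.Zmodule_isPzRing.Build PGalg
  PGalg_mulA PGalg_1mul PGalg_mul1 PGalg_mulDl PGalg_mulDr.

Local Notation G := {'GL_n.+1[F]}.

Definition GL_subspace (g : G) V : subspace :=
  (linfun (mulmx (GLval g) : 'cV[F]_n.+1 -> 'cV[F]_n.+1) @: V)%VS.

Definition GL_PGalg (g : G) (x : PGalg) : PGalg :=
  PGclass (fglift (fun p : fpath => walk (map (GL_subspace g) p)) (repr x)).

(* Operators: the algebra S acting by multiplication, and GL *)
Definition PGop : Type := (PGalg + G)%type.

Definition PGregular : rep int PGop :=
  Rep (fun (o : PGop) (x : PGalg) =>
         match o with inl s => s * x | inr g => GL_PGalg g x end).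

Definition left_ideal (J : set PGalg) : Prop :=
  submodule J /\ forall a x, J x -> J (a * x).

Definition down_flag s : bool :=
  [&& s != [::], sorted (fun V W => covers W V) s & last 0%VS s == 0%VS].

Definition Delta0_ideal : set PGalg :=
  [set x | forall J, left_ideal J ->
     (forall s, down_flag s -> J (PGclass (walk s))) -> J x].

Definition Delta0 : rep int PGop := @subrep _ _ PGregular Delta0_ideal.

(* <V,W> (0) = (0, W_1, ..., W_m) (V_l, ..., V_1, 0), extended bilinearly *)
Definition is_Delta0_form (b : Delta0 -> Delta0 -> int) : Prop :=
  [/\ forall x y, b x y = b y x,
      forall y, zmod_morphism (b^~ y) &
      forall (s t : seq subspace) (x y : submod Delta0_ideal),
        down_flag s -> down_flag t ->
        val x = PGclass (walk s) -> val y = PGclass (walk t) ->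
        PGclass (walk (rev t)) * PGclass (walk s)
        = PGclass (walk [:: 0%VS]) *~ b x y].

Definition Delta0_form : Delta0 -> Delta0 -> int :=
  xget (fun _ _ => 0) is_Delta0_form.

Definition Delta0_filtration (l i : nat) : set Delta0 :=
  [set x | forall v, (l%:Z ^+ i %| Delta0_form x v)%Z].

Section OverField.
Variable k : fieldType.

Definition PGalgk : lmodType k := extscal k PGalg.

Definition PGopk : Type := (PGalgk + G)%type.

(* (s ⊗ a) (x ⊗ b) = s x ⊗ a b and g (x ⊗ b) = g x ⊗ b *)
Definition Delta0k : rep k PGopk :=
  Rep (fun (o : PGopk) (x : extscal k Delta0) =>
    match o with
    | inl t => extscal_lift (fun s : PGalg =>
        extscal_lift (fun y : Delta0 => tens1 k (op (inl s : PGop) y)) x) t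
    | inr g => extscal_lift (fun y : Delta0 => tens1 k (op (inr g : PGop) y)) x
    end).

Definition Delta0k_filtration (l i : nat) : set Delta0k :=
  lin_span [set tens1 k x | x in Delta0_filtration l i].

Definition Delta0k_layer (l i : nat) : rep k PGopk :=
  subquorep (Delta0k_filtration l i) (Delta0k_filtration l i.+1).

Definition L0k (l : nat) : rep k PGopk := Delta0k_layer l 0.

Definition as_PGmod (X : rep k PGopk) : rep k PGalgk := restrict_ops inl X.
Definition as_GLmod (X : rep k PGopk) : rep k G := restrict_ops inr X.

(* X^W = (W)X *)
Definition weight_space (W : subspace) (X : rep k PGopk) : set X :=
  range (op (inl (tens1 k (PGclass (walk [:: W]))) : PGopk) : X -> X).

(* GL fixes the whole space, hence acts on the corresponding weight space. *)
Definition top_weight_space (X : rep k PGopk) : rep k G :=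
  @subrep _ _ (as_GLmod X) (@weight_space fullv X).

End OverField.

Definition full_flag (s : seq subspace) : bool :=
  [&& sorted covers s, head fullv s == 0%VS & last 0%VS s == fullv].

Definition nb_full_flags : nat :=
  #|[pred t : (n.+2).-tuple subspace | full_flag t]|.

Definition upper_tri (A : 'M[F]_n.+1) : bool :=
  [forall i : 'I_n.+1, forall j : 'I_n.+1, (j < i)%N ==> (A i j == 0)].

Definition upper_unitri (A : 'M[F]_n.+1) : bool :=
  upper_tri A && [forall i : 'I_n.+1, A i i == 1].

Section GroupAlgebra.
Variable R : nzRingType.
Local Notation RG := {ffun G -> R^o}.

Definition gmul (x y : RG) : RG :=
  [ffun g : G => \sum_(h : G) x h * y (h^-1 * g)%g].

Definition gtranslate (g : G) (x : RG) : RG := [ffun h : G => x (g^-1 * h)%g].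

Definition signed_perm_sum : RG :=
  [ffun g : G => \sum_(w : 'S_n.+1 | GLval g == perm_mx w) (-1) ^+ w].

Definition borel_sum : RG := [ffun g : G => (upper_tri (GLval g))%:R].

(* Gow's element e = (sum of sgn(w) w) (sum of B) *)
Definition steinberg_elt : RG := gmul signed_perm_sum borel_sum.

(* The left ideal RG e *)
Definition St : rep R G :=
  @subrep _ _ (Rep gtranslate) [set gmul a steinberg_elt | a in setT].

End GroupAlgebra.

Definition is_gow_form (f : St int -> St int -> int) : Prop :=
  [/\ forall x y, f x y = f y x,
      forall y, zmod_morphism (f^~ y) &
      forall (u1 u2 : G) (x y : St int),
        upper_unitri (GLval u1) -> upper_unitri (GLval u2) ->
        submod_val x = gtranslate u1 (steinberg_elt int) ->
        submod_val y = gtranslate u2 (steinberg_elt int) ->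
        f x y = #|[pred w : 'S_n.+1 | upper_unitri
          (perm_mx w *m GLval (u1^-1 * u2)%g *m invmx (perm_mx w))]|].

Definition gow_form : St int -> St int -> int :=
  xget (fun _ _ => 0) is_gow_form.

Section GowFiltration.
Variables (k : fieldType) (l : nat).

(* The k-span of the reductions of the x in St^Z with f(x, y) in l^i Z for all
   y: the reduction St^Z ⊗ k -> St^k acts on coefficients in the group ring. *)
Definition gow_filtration (i : nat) : set (St k) :=
  lin_span [set x : St k | exists2 y : St int,
    forall z, (l%:Z ^+ i %| gow_form y z)%Z &
    submod_val x = [ffun g => (submod_val y g)%:~R]].

(* M(i) = I(i)/I(i+1), and 0 for i < 0 *)
Definition gow_layer (i : int) : rep k G :=
  match i with
  | Posz j => subquorep (gow_filtration j) (gow_filtration j.+1)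
  | Negz _ => @subrep _ _ (St k) [set 0]
  end.

End GowFiltration.

End FlagPaths.

(* Main.v *)
(**
Let D be the weight space of Delta_{0} at the full space V, spanned by the full
flags, and call a function on flags Steinberg if it satisfies the (FS) relations.
The algebra acts on Steinberg functions by prepending a subspace when going down
and by the rule forced by the wedge relations when going up, so evaluation on
flags gives well-defined functionals on Delta_{0}. Every flag is an integral
combination of the flags opposite to the standard one, and these form an orbit of
the group U; it follows that D and the lattice St of Steinberg functions on full
flags, which is Gow's lattice, are in perfect duality.

The Jantzen form is a map toSt : D -> St, and summing over flags is a map
toD : St -> D which computes Gow's form in the same way. Both composites are
multiplication by the number of full flags, that is l^kappa * c with c prime to l.
Hence x is in the i-th layer of D, toSt x = l^i z, if and only if z is in the
layer kappa - i of St, toD z = l^(kappa - i) c x, and x <-> z induces the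
isomorphism of layers. To pass to a general field k one rewrites the coefficients
of a linear combination in a family independent over the prime field.

For the socle, let N be a nonzero G-stable subspace of St^k. Summing over U a
translate of a vector of N not vanishing at the standard flag gives a nonzero
multiple of the image of the standard flag, because the value of a Steinberg
function at a flag is, up to sign, the sum of its values at the opposite ones.
That image generates the layer kappa, which is therefore the unique simple
subspace.
*)

Require Import Defs.
From HB Require Import structures.
From mathcomp Require Import all_boot all_order all_fingroup all_algebra.
From mathcomp Require Import all_field generic_quotient boolp classical_sets zify ring.
From mathcomp.multinomials Require Import freeg.

Set Implicit Arguments.
Unset Strict Implicit.
Unset Printing Implicit Defensive.

Import GRing.Theory.
Local Open Scope ring_scope.

(** * Pencils of subspaces *)

(** The module is given inside a quotient by an ideal, and nothing in such a quotient can be shown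
    to be non-zero or torsion-free until the algebra acts on something concrete; hence functions on
    flags come before the module. The wedge relations leave no choice for the climbing steps, and
    the real content is that the resulting rule is compatible with (FS): a pencil has q + 1 members,
    and the q of them other than a distinguished one absorb exactly one power of q in the wedge
    coefficient. Reversal of paths is an anti-automorphism, which yields the pairing and the
    symmetry of the form together. The number of flags appears as a q-factorial, one q-integer for
    each dimension stripped off. All division takes place over the integers, where both lattices are
    torsion-free; over k only one fact is used about each lattice, that the vectors of a vanishing
    combination with independent coefficients are divisible by l. Above kappa both sides are zero,
    in accordance with the convention on negative indices. *)

Section Covers.
Variables (F : finFieldType) (n : nat).
Local Notation T := {vspace 'cV[F]_n.+1}.
Implicit Types C V W X Y Z : T.

(** [W] is not inside the hyperplane [Y] of [V], so [W + Y = V], and the dimension formula leaves a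
    drop of exactly one. *)
Lemma covers_cap Y V W :
  covers Y V -> (W <= V)%VS -> ~~ (W <= Y)%VS -> covers (W :&: Y)%VS W.
Proof.
case/andP=> YV /eqP dV WV nWY; rewrite /covers capvSl /=.
have := dimv_sum_cap W Y.
have sV : (W + Y <= V)%VS by rewrite subv_add WV YV.
have := dimvS sV; have := dimvS (addvSr W Y).
have : \dim Y != \dim (W + Y)%VS.
  rewrite (dimv_leqif_eq (addvSr W Y)); apply/negP => /eqP E.
  by move/negP: nWY; apply; rewrite E addvSl.
lia.
Qed.

Lemma covers_sub V W : covers V W -> (V <= W)%VS. Proof. by case/andP. Qed.

Lemma covers_dim V W : covers V W -> \dim W = (\dim V).+1.
Proof. by case/andP=> _ /eqP. Qed.

Lemma covers_inj V V' W : covers V W -> covers V' W -> (V <= V')%VS -> V = V'.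
Proof.
move=> /covers_dim d /covers_dim d' s; apply/eqP; rewrite eqEdim s /=; lia.
Qed.

Lemma covers_capC V V' W : covers V W -> covers V' W -> V != V' ->
  covers (V :&: V')%VS V /\ covers (V :&: V')%VS V'.
Proof.
move=> c c' ne.
have nV : ~~ (V <= V')%VS.
  by apply: contraNN ne => s; apply/eqP; apply: covers_inj c c' s.
have nV' : ~~ (V' <= V)%VS.
  by apply: contraNN ne => s; apply/eqP/esym; apply: covers_inj c' c s.
split; first exact: covers_cap (c') (covers_sub c) nV.
by rewrite capvC; apply: covers_cap c (covers_sub c') nV'.
Qed.

Definition rank2 C V := (C <= V)%VS && (\dim V == (\dim C + 2)%N).
Definition mid C V X := covers C X && covers X V.

Lemma mid_rank2 C V X : mid C V X -> rank2 C V.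
Proof.
case/andP=> c c'; rewrite /rank2 (subv_trans (covers_sub c) (covers_sub c')).
by rewrite (covers_dim c') (covers_dim c); apply/eqP; lia.
Qed.

Lemma covers_line V v : v \notin V -> covers V (V + <[v]>)%VS.
Proof.
move=> vV; rewrite /covers addvSl /=.
have := dimv_sum_cap V <[v]>; rewrite dim_vline.
have v0 : v != 0 by apply: contraNneq vV => ->; rewrite mem0v.
have : (V :&: <[v]>)%VS == 0%VS.
  apply/eqP/vspaceP=> x; rewrite memv0; apply/memv_capP/eqP => [[xV]|->]; last first.
    by rewrite !mem0v.
  case/vlineP=> a xa; have [a0|a0] := eqVneq a 0; first by rewrite xa a0 scale0r.
  by case/negP: vV; rewrite -[v](scalerK a0) -xa memvZ.
rewrite -dimv_eq0 v0; lia.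
Qed.

Lemma card_memv V : #|[pred v | v \in V]| = (#|F| ^ \dim V)%N.
Proof. by rewrite -card_vspace; apply: eq_card. Qed.

Lemma card_memvD C V : (C <= V)%VS ->
  #|[pred v | (v \in V) && (v \notin C)]| = (#|F| ^ \dim V - #|F| ^ \dim C)%N.
Proof.
move=> CV; rewrite -!card_memv -(cardID [pred v | v \in C] [pred v | v \in V]).
have -> : #|[predI [pred v | v \in V] & [pred v | v \in C]]|
        = #|[pred v | v \in C]|.
  by apply: eq_card => v; rewrite !inE andbC; case: (boolP (v \in C)) => //= /(subvP CV).
by rewrite addKn; apply: eq_card => v; rewrite !inE andbC.
Qed.

Lemma line_add_mid C V X v : mid C V X -> v \in X -> v \notin C ->
  (C + <[v]>)%VS = X.
Proof.
case/andP=> c _ vX vC; apply/eqP; rewrite eqEdim subv_add (covers_sub c) -memvE vX /=.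
by rewrite (covers_dim c) (covers_dim (covers_line vC)).
Qed.

(** Each vector of [V] outside [C] lies in exactly one member of the pencil, namely [C + <[v]>], and
    each member holds [q^(c+1) - q^c] such vectors, where [c = \dim C]. *)
Lemma card_mid C V : rank2 C V -> #|mid C V| = #|F|.+1.
Proof.
case/andP=> CV /eqP dV.
have q1 := finNzRing_gt1 F.
have E : (\sum_(v | (v \in V) && (v \notin C)) 1 =
          \sum_(X | mid C V X) (#|F| ^ (\dim C).+1 - #|F| ^ \dim C))%N.
  rewrite (partition_big (fun v => (C + <[v]>)%VS) (mid C V)) /=; last first.
    move=> v /andP[vV vC]; have c := covers_line vC; rewrite /mid c /= /covers.
    by rewrite subv_add CV -memvE vV /= (covers_dim c); apply/eqP; lia.
  apply: eq_bigr => X mX; have [c1 c2] := andP mX.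
  rewrite -(covers_dim c1) -(card_memvD (covers_sub c1)) sum1_card.
  apply: eq_card => v; rewrite [LHS]/in_mem /= !inE; have [vC|vC] := boolP (v \in C); first by rewrite !andbF.
  rewrite !andbT.
  have [vX|vX] := boolP (v \in X).
    by rewrite (line_add_mid mX vX vC) eqxx (subvP (covers_sub c2)).
  apply/negbTE; apply: contra vX => /andP[_ /eqP <-].
  by rewrite memvE addvSr.
move: E; rewrite sum1_card (card_memvD CV) sum_nat_const dV expnD => E.
have p : (0 < #|F| ^ \dim C)%N by rewrite expn_gt0 ltnW.
have {}E : (#|F| ^ \dim C * #|F| ^ 2 - #|F| ^ \dim C =
  #|mid C V| * (#|F| ^ (\dim C).+1 - #|F| ^ \dim C))%N by exact: E.
(* With [a = q^c] the count reads [a q^2 - a = m (q a - a)]; the positive common factor [a (q - 1)]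
   is cancelled. *)
move: q1 p E; rewrite !expnS expn0 muln1.
move: #|F| #|mid C V| (#|F| ^ \dim C)%N => q m a q1 p E.
have {}E : (q.+1 * (a * (q - 1)) = m * (a * (q - 1)))%N.
  have -> : (a * (q - 1) = q * a - a)%N by rewrite mulnBr muln1 mulnC.
  by rewrite -E mulSn !mulnBr addnBA ?leq_mul //; nia.
by move/eqP: E; rewrite eqn_pmul2r => [/eqP //|]; rewrite muln_gt0 p; lia.
Qed.

(* Intersecting with the hyperplane W projects the pencil between C and V
   bijectively onto the pencil between [C :&: W] and W. *)
Lemma mid_cap C V W X : covers W V -> ~~ (C <= W)%VS -> mid C V X ->
  mid (C :&: W) W (X :&: W).
Proof.
move=> WV nC mX; have [c1 c2] := andP mX.
have nX : ~~ (X <= W)%VS by apply: contra nC; apply: subv_trans (covers_sub c1).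
apply/andP; split; last first.
  rewrite capvC; apply: (covers_cap c2 (covers_sub WV)).
  apply: contra nX => s.
  by rewrite -(covers_inj WV c2 s).
have e : (C :&: W = C :&: (X :&: W))%VS.
  by rewrite capvA (capv_idPl (covers_sub c1)).
rewrite e capvC; apply: (covers_cap c1 (capvSl _ _)).
apply: contra nC => s.
have d1 := covers_dim (covers_cap WV (covers_sub c2) nX).
have d2 := covers_dim c1.
have <- : (X :&: W)%VS = C by apply/eqP; rewrite eqEdim s /=; lia.
exact: capvSr.
Qed.

Lemma mid_lift C V W Z : covers W V -> (C <= V)%VS -> ~~ (C <= W)%VS ->
  mid (C :&: W) W Z -> mid C V (Z + C) /\ ((Z + C) :&: W)%VS = Z.
Proof.
move=> WV CV nC /andP[c1 c2].
have dC := covers_dim (covers_cap WV CV nC).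
have dW := covers_dim WV.
have ZV := subv_trans (covers_sub c2) (covers_sub WV).
have capZ : (Z :&: C = C :&: W)%VS.
  apply/eqP; rewrite eq_sym eqEdim subv_cap (covers_sub c1) capvSl /=.
  apply: dimvS; rewrite capvC; exact: capvS (subvv _) (covers_sub c2).
have dZC := dimv_sum_cap Z C; rewrite capZ in dZC.
have dZ1 := covers_dim c1; have dZ2 := covers_dim c2.
have m : mid C V (Z + C).
  rewrite /mid /covers addvSr subv_add ZV CV /=; apply/andP; split; apply/eqP; lia.
split=> //; apply/eqP; rewrite eq_sym eqEdim subv_cap addvSl (covers_sub c2) /=.
have [_ /covers_dim dd] := andP (mid_cap WV nC m).
lia.
Qed.

(** The inverse substitution is [Z |-> Z + C]. This lowers a pencil by one dimension in the
    compatibility proofs, in the case where its bottom [C] is not in the hyperplane. *)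
Lemma sum_mid_cap (A : nmodType) C V W (f : T -> A) :
  covers W V -> (C <= V)%VS -> ~~ (C <= W)%VS ->
  \sum_(X | mid C V X) f (X :&: W)%VS = \sum_(Z | mid (C :&: W) W Z) f Z.
Proof.
move=> WV CV nC.
rewrite [RHS](reindex_onto (fun X => (X :&: W)%VS) (fun Z => (Z + C)%VS)) /=; last first.
  by move=> Z /(mid_lift WV CV nC)[].
apply: eq_bigl => X; apply/idP/andP => [mX|[mX /eqP <-]]; last first.
  by case: (mid_lift WV CV nC mX).
split; first exact: mid_cap WV nC mX.
have [c1 c2] := andP mX.
have nX : ~~ (X <= W)%VS by apply: contra nC; apply: subv_trans (covers_sub c1).
have [m _] := mid_lift WV CV nC (mid_cap WV nC mX).
have [_ c3] := andP m.
apply/eqP; apply: (covers_inj c3 c2).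
by rewrite subv_add capvSl (covers_sub c1).
Qed.

Lemma mid_neq_cap C V W X : mid C V W -> mid C V X -> X != W -> (X :&: W)%VS = C.
Proof.
case/andP=> c1 c2 /andP[c3 c4] ne.
have [c5 _] := covers_capC c4 c2 ne.
apply/eqP; rewrite eq_sym eqEdim subv_cap (covers_sub c1) (covers_sub c3) /=.
have := covers_dim c5; have := covers_dim c3; lia.
Qed.

(** The [q] equal terms supply the factor that turns [q^(\dim C)] into [q^(\dim W)]; this is where
    the wedge coefficient meets (FS). *)
Lemma sum_mid_const (A : zmodType) C V W (f : T -> A) c :
  mid C V W -> (forall X, mid C V X -> X != W -> f X = c) ->
  \sum_(X | mid C V X) f X = f W + c *+ #|F|.
Proof.
move=> mW h; rewrite (bigD1 W mW) /=; congr (_ + _).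
rewrite (eq_bigr (fun=> c)) => [|X /andP[mX ne]]; last exact: h.
rewrite sumr_const; congr (_ *+ _).
have E := card_mid (mid_rank2 mW).
have mW' : W \in mid C V by [].
move: E; rewrite (cardD1x mW') => -[<-].
by apply: eq_card => X; rewrite [LHS]/in_mem !inE.
Qed.

End Covers.

(** * Steinberg functions and the action of the path algebra *)

Section Model.
Variables (F : finFieldType) (n : nat).
Local Notation T := {vspace 'cV[F]_n.+1}.
Implicit Types (C V W X Y Z : T) (s t : seq T).
Implicit Types (phi psi : seq T -> int).

(** The relation is imposed at every place of every list, flag or not, so that prefixing a subspace
    preserves it; support on flags is the separate condition [flag_fun]. Values lie in any abelian
    group because integers, elements of [k] and elements of the algebra itself all occur. *)
Definition steinberg (A : zmodType) (phi : seq T -> A) :=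
  forall s t C V, rank2 C V ->
    \sum_(X | mid C V X) phi (s ++ [:: V, X, C & t]) = 0.

Lemma steinberg_restr (A : zmodType) (phi : seq T -> A) W :
  steinberg phi -> steinberg (fun s => phi (W :: s)).
Proof. by move=> st s t C V; apply: (st (W :: s)). Qed.

Definition flag_fun (A : zmodType) (phi : seq T -> A) :=
  forall t, ~~ down_flag t -> phi t = 0.

Lemma down_flag_cons V Y t :
  down_flag [:: V, Y & t] = covers Y V && down_flag (Y :: t).
Proof. by rewrite /down_flag /= andbA. Qed.

Lemma down_flag1 V : down_flag [:: V] = (V == 0%VS).
Proof. by []. Qed.

Lemma down_flag_head s t V : down_flag (s ++ V :: t) -> down_flag (V :: t).
Proof.
elim: s => // W [|Y s] IH; rewrite ?cat_cons //= down_flag_cons => /andP[_] //.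
Qed.

(* The value at the flag t of the image of phi, in the V-component, under the
   path climbing from V to the head of t: forced by the wedge relations. *)
Fixpoint up V phi t : int :=
  if t is W :: (Y :: _) as t' then
    if Y == V then phi t' *+ #|F| ^ \dim V
    else - up (Y :&: V)%VS (fun s => phi (V :: s)) t'
  else 0.

Lemma up_cons V phi W Y t : up V phi [:: W, Y & t] =
  if Y == V then phi (Y :: t) *+ #|F| ^ \dim V
  else - up (Y :&: V)%VS (fun s => phi (V :: s)) (Y :: t).
Proof. by []. Qed.

Arguments up V phi t : simpl never.

(** [up V phi] reads [phi] only on lists headed by [V], at every depth of the recursion. *)
Lemma eq_up V phi psi t :
  (forall s, phi (V :: s) = psi (V :: s)) -> up V phi t = up V psi t.
Proof.
elim: t V phi psi => [|W [|Y t] IH] V phi psi e //; rewrite !up_cons.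
by case: eqP => [->|_]; rewrite ?e //; congr (- _); apply: IH => s; apply: e.
Qed.

Lemma up_sum (I : Type) (r : seq I) (P : pred I) V (f : I -> seq T -> int) t :
  \sum_(i <- r | P i) up V (f i) t = up V (fun s => \sum_(i <- r | P i) f i s) t.
Proof.
elim: t V f => [|W [|Y t] IH] V f; [by rewrite big1 | by rewrite big1|].
rewrite up_cons.
case: ifP => e; first by rewrite -sumrMnl; apply: eq_bigr => i _; rewrite up_cons e.
rewrite -IH -sumrN; apply: eq_bigr => i _; rewrite up_cons e //.
Qed.

Lemma up_zero V t : up V (fun=> 0) t = 0.
Proof.
elim: t V => [|W [|Y t] IH] V //; rewrite up_cons mul0rn IH oppr0.
by case: ifP.
Qed.

Lemma up0 V phi t : (forall s, phi (V :: s) = 0) -> up V phi t = 0.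
Proof. by move=> h; rewrite (eq_up (psi := fun=> 0)) ?up_zero. Qed.

Lemma upMz V phi a t : up V (fun s => phi s * a) t = up V phi t * a.
Proof.
elim: t V phi => [|W [|Y t] IH] V phi; rewrite ?mul0r // !up_cons.
by case: ifP => _; rewrite ?IH ?mulNr ?mulrnAl.
Qed.

Lemma mid_ex C V : rank2 C V -> exists X, mid C V X.
Proof.
move=> /card_mid h; have /card_gt0P[X mX] : (0 < #|mid C V|)%N by rewrite h.
by exists X.
Qed.

Lemma down_flag_mid s t C V X X' : mid C V X -> mid C V X' ->
  down_flag (s ++ [:: V, X, C & t]) = down_flag (s ++ [:: V, X', C & t]).
Proof.
move=> /andP[a b] /andP[c d]; elim: s => [|W [|Y s] IH].
- by rewrite !down_flag_cons a b c d.
- by rewrite !down_flag_cons a b c d.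
by move: IH; rewrite !cat_cons !down_flag_cons => ->.
Qed.

Lemma rank2_cap C V W : covers V W -> rank2 C W -> ~~ (C <= V)%VS ->
  rank2 (C :&: V) V.
Proof.
move=> c /andP[CW /eqP d] nC; have := covers_dim (covers_cap c CW nC).
have := covers_dim c; rewrite /rank2 capvSr d /= => e e'; apply/eqP; lia.
Qed.

Lemma covers_mid C V W : covers V W -> rank2 C W -> (C <= V)%VS -> mid C W V.
Proof.
move=> c /andP[CW /eqP d] CV; rewrite /mid c andbT /covers CV.
by have := covers_dim c; rewrite d => e; apply/eqP; lia.
Qed.

(** Induction on the place [s] of the pencil. At the top there are two cases. If [C] is inside [V],
    then [V] belongs to the pencil and contributes [q^(\dim V)], while each of the [q] others has
    trace [C] on [V] and contributes [- q^(\dim C)]. Otherwise the pencil projects onto one below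
    [V], where (FS) holds for [phi]. Lower places reduce to the trace on the next member of the
    flag. *)
Lemma up_steinberg phi V W s t C D X0 : steinberg phi -> covers V W ->
  mid C D X0 -> down_flag (s ++ [:: D, X0, C & t]) -> head 0%VS (s ++ [:: D]) = W ->
  \sum_(X | mid C D X) up V phi (s ++ [:: D, X, C & t]) = 0.
Proof.
move=> st cV m0; have r0 := mid_rank2 m0.
elim: s phi V W st cV => [|W0 s IH] phi V W st cV.
  rewrite /= => _ eW; subst W; have [CV|nCV] := boolP (C <= V)%VS.
    have mV := covers_mid cV r0 CV.
    rewrite (sum_mid_const (c := - (phi [:: V, C & t] *+ #|F| ^ \dim C)) mV) /=.
      rewrite up_cons eqxx mulNrn -mulrnA -expnSr.
      by have [/covers_dim -> _] := andP mV; rewrite subrr.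
    move=> X mX ne; rewrite !up_cons (negbTE ne) (mid_neq_cap mV mX ne).
    by rewrite eqxx.
  (* Two turns of the recursion, hence two signs that cancel; the outcome depends on [X] only
     through [X :&: V]. *)
  pose f Z := up (C :&: V)%VS (fun s => phi [:: V, Z & s]) (C :: t).
  rewrite (eq_bigr (fun X => f (X :&: V)%VS)); last first.
    move=> X /andP[/covers_sub CX _]; rewrite up_cons ifF; last first.
      by apply: contraNF nCV => /eqP <-.
    rewrite up_cons ifF; last first.
      by apply: contraNF nCV => /eqP ->; rewrite capvSr.
    by rewrite opprK capvA (capv_idPl CX).
  have [CD _] := andP r0.
  rewrite sum_mid_cap // up_sum; apply: up0 => s'.
  exact: (st [::] s' _ _ (rank2_cap cV r0 nCV)).
rewrite cat_cons => df hW.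
have [Y [s' eY]] : exists Y s', s ++ [:: D] = Y :: s'.
  by case: s {IH df hW} => [|Y s]; [exists D, [::] | exists Y, (s ++ [:: D])].
have e X : s ++ [:: D, X, C & t] = Y :: (s' ++ [:: X, C & t]).
  by rewrite -cat_cons -eY -catA.
have {hW} eW : W0 = W by []; subst W0.
have [cY df'] : covers Y W /\ down_flag (s ++ [:: D, X0, C & t]).
  by move: df; rewrite !e down_flag_cons => /andP[].
under eq_bigr => X _ do rewrite cat_cons e up_cons.
have [<-|ne] := eqVneq Y V.
  by rewrite sumrMnl; under eq_bigr => X _ do rewrite -e; rewrite st ?mul0rn.
rewrite sumrN; under eq_bigr => X _ do rewrite -e.
have [c _] := covers_capC cY cV ne.
by rewrite (IH _ _ _ (steinberg_restr V st) c df') ?oppr0 // eY.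
Qed.

(** The same dichotomy as for [up_steinberg], now with the next member [Y] of the flag: either [Y]
    is in the pencil and the powers of [q] cancel, or intersecting with [Y] gives the same statement
    for a shorter flag. *)
Lemma up_up V D t phi : rank2 V D -> down_flag t -> head 0%VS t = D ->
  \sum_(X | mid V D X) up X (up V phi) t = 0.
Proof.
elim: t V D phi => [|D' [|Y t] IH] V D phi r df eD; [by rewrite big1 | by rewrite big1 |].
rewrite /= in eD; subst D'; move: df; rewrite down_flag_cons => /andP[cY df].
have [VY|nVY] := boolP (V <= Y)%VS.
  have mY := covers_mid cY r VY.
  rewrite (sum_mid_const (c := - (up V phi (Y :: t) *+ #|F| ^ \dim V)) mY) /=.
    rewrite up_cons eqxx mulNrn -mulrnA -expnSr.
    by have [/covers_dim -> _] := andP mY; rewrite subrr.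
  move=> X mX ne; rewrite up_cons eq_sym (negbTE ne); congr (- _).
  rewrite capvC (mid_neq_cap mY mX ne).
  rewrite -mulr_natr -upMz; apply: eq_up => s.
  by rewrite up_cons eqxx mulr_natr.
pose f Z := up Z (up (V :&: Y)%VS (fun s => phi (V :: s))) (Y :: t).
rewrite (eq_bigr (fun X => f (X :&: Y)%VS)); last first.
  move=> X /andP[/covers_sub VX _]; rewrite up_cons ifF; last first.
    by apply: contraNF nVY => /eqP ->.
  rewrite /f capvC -[RHS]opprK; congr (- _).
  rewrite -[in RHS]mulrN1 -upMz; apply: eq_up => s; rewrite up_cons ifF.
    by rewrite mulrN1 capvC (capvC X) capvA (capvC V) -capvA (capv_idPl VX) capvC.
  by apply: contraNF nVY => /eqP <-; rewrite capvSr.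
have [VD _] := andP r.
rewrite sum_mid_cap // (IH _ Y) //; exact: rank2_cap cY r nVY.
Qed.

End Model.
Arguments up : simpl never.

(** * The action of paths, and the vanishing of the defining ideal *)

Section Action.
Variables (F : finFieldType) (n : nat).
Local Notation T := {vspace 'cV[F]_n.+1}.
Local Notation pathalg := (pathalg F n).
Local Notation fpath := (Defs.fpath F n).
Implicit Types (C V W X Y Z : T) (s t p r : seq T).
Implicit Types (phi psi : seq T -> int).

Lemma eq_up_flag V phi psi t : covers V (head 0%VS t) -> down_flag t ->
  (forall s, down_flag (V :: s) -> phi (V :: s) = psi (V :: s)) ->
  up V phi t = up V psi t.
Proof.
elim: t V phi psi => [|W [|Y t] IH] V phi psi cV df e //; rewrite !up_cons.
move: df; rewrite down_flag_cons => /andP[cY df].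
have [EY|ne] := eqVneq Y V; first by rewrite -EY in e *; rewrite e.
have [c c'] := covers_capC cY cV ne.
by congr (- _); apply: IH => // s fs; apply: e; rewrite down_flag_cons c'.
Qed.

Lemma up_lin V phi psi a t :
  up V (fun s => a * phi s + psi s) t = a * up V phi t + up V psi t.
Proof.
elim: t V phi psi => [|W [|Y t] IH] V phi psi; rewrite ?mulr0 ?addr0 //.
rewrite !up_cons; case: ifP => _; first by rewrite mulrnDl mulrnAr.
by rewrite IH mulrN opprD.
Qed.

Lemma covers_asym V W : covers V W -> covers W V = false.
Proof.
by move=> /covers_dim d; apply/negP => /covers_dim d'; move: d; rewrite d'; lia.
Qed.

(** The edge [(V, W)] carries the [W]-component of [phi] to the [V]-component. The guard makes the
    result vanish off flags headed by [V], so that support on flags is preserved. *)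
Definition step V W phi t : int :=
  if down_flag t && (head 0%VS t == V) then
    if covers V W then phi (W :: t) else if covers W V then up W phi t else 0
  else 0.

Fixpoint pact p phi t : int :=
  if p is V :: p' then
    if p' is W :: _ then step V W (pact p' phi) t
    else if head 0%VS t == V then phi t else 0
  else 0.

Lemma act_cons V W p phi : pact [:: V, W & p] phi = step V W (pact (W :: p) phi).
Proof. by []. Qed.

Lemma act1 V phi t : pact [:: V] phi t = if head 0%VS t == V then phi t else 0.
Proof. by []. Qed.

Lemma act_head p phi t : head 0%VS t != head 0%VS p -> pact p phi t = 0.
Proof.
case: p => [|V [|W p]] //= h; first by rewrite (negbTE h).
by rewrite /step (negbTE h) andbF.
Qed.

Lemma act_flag_fun p phi : flag_fun phi -> flag_fun (pact p phi).
Proof.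
move=> f t nt; case: p => [|V [|W p]] //=; first by rewrite (f _ nt); case: ifP.
by rewrite /step (negbTE nt).
Qed.

Lemma head_mid s V X C t : head 0%VS (s ++ [:: V, X, C & t]) = head 0%VS (s ++ [:: V]).
Proof. by case: s. Qed.

Lemma act_steinberg p phi : steinberg phi -> steinberg (pact p phi).
Proof.
move=> st; elim: p => [|V p IH] s t C D r; first by rewrite big1.
case: p IH => [_|W p IH]; rewrite /=.
  under eq_bigr => X _ do rewrite head_mid.
  by case: eqP => _; [apply: st | rewrite big1].
have [X0 m0] := mid_ex r; rewrite /step.
rewrite (eq_bigr (fun X => let t' := s ++ [:: D, X, C & t] in
  if down_flag (s ++ [:: D, X0, C & t]) && (head 0%VS (s ++ [:: D]) == V)
  then if covers V W then pact (W :: p) phi (W :: t')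
       else if covers W V then up W (pact (W :: p) phi) t' else 0
  else 0)); last first.
  by move=> X mX; rewrite (down_flag_mid s t mX m0) head_mid.
case: andP => [[df /eqP hd]|_]; last by rewrite big1.
case: (covers V W); first exact: (IH (W :: s)).
case: (boolP (covers W V)) => c; last by rewrite big1.
exact: (up_steinberg IH c m0 df hd).
Qed.

Lemma step_lin V W phi psi a t :
  step V W (fun s => a * phi s + psi s) t = a * step V W phi t + step V W psi t.
Proof.
rewrite /step; do ?case: ifP => _; rewrite ?mulr0 ?addr0 //; exact: up_lin.
Qed.

Lemma act_lin p phi psi a :
  pact p (fun s => a * phi s + psi s) = fun t => a * pact p phi t + pact p psi t.
Proof.
elim: p => [|V [|W p] IH]; apply: funext => t; first by rewrite mulr0 addr0.
  by rewrite !act1; case: ifP => _ //; rewrite mulr0 addr0.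
by rewrite !act_cons IH step_lin.
Qed.

Lemma act_cat p r phi : p != [::] -> r != [::] -> last 0%VS p = head 0%VS r ->
  pact (p ++ behead r) phi = pact p (pact r phi).
Proof.
elim: p => [//|V [|W p] IH] _ r0 e.
  case: r r0 e {IH} => [//|W r] _ e.
  rewrite (_ : V = W) //; apply: funext => t; rewrite [RHS]act1.
  by have [_|ne] := eqVneq (head 0%VS t) W; last exact: act_head.
by rewrite !cat_cons !act_cons -cat_cons IH.
Qed.

Lemma act_cat0 p r phi : last 0%VS p != head 0%VS r -> pact p (pact r phi) = fun=> 0.
Proof.
elim: p => [//|V [|W p] IH] /= e.
  by apply: funext => t; case: eqP => // h; apply: act_head; rewrite h.
rewrite -/(pact (W :: p) (pact r phi)) IH //; apply: funext => t; rewrite /step.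
by do ?case: ifP => _ //; apply: up0.
Qed.

Definition actA (x : pathalg) phi t : int :=
  fglift (fun p : fpath => pact p phi t : int^o) x.

Lemma actA_linl (a : int) x y phi t : actA (a *: x + y) phi t = a * actA x phi t + actA y phi t.
Proof. by rewrite /actA fglift_linear. Qed.

Lemma actA_walk s phi t : is_fpath s -> actA (walk s) phi t = pact s phi t.
Proof. by move=> h; rewrite -[s]/(val (Fpath h)) walk_fpath /actA fglift1. Qed.

Lemma actA0 phi t : actA 0 phi t = 0.
Proof.
have := actA_linl (-1) 0 0 phi t; rewrite scaler0 addr0 => ->.
by rewrite mulN1r addNr.
Qed.

Lemma actAD x y phi t : actA (x + y) phi t = actA x phi t + actA y phi t.
Proof. by rewrite -[x]scale1r actA_linl mul1r scale1r. Qed.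

Lemma actAN x phi t : actA (- x) phi t = - actA x phi t.
Proof. by rewrite -scaleN1r -[_ *: _]addr0 actA_linl actA0 addr0 mulN1r. Qed.

Lemma actA_sum (I : Type) (r : seq I) (P : pred I) f phi t :
  actA (\sum_(i <- r | P i) f i) phi t = \sum_(i <- r | P i) actA (f i) phi t.
Proof. by apply: (big_morph (fun x => actA x phi t)) => [x y|]; rewrite ?actA0 ?actAD. Qed.

Lemma actA_walk_ind (P : pathalg -> Prop) : submodule P ->
  (forall s, is_fpath s -> P (walk s)) -> forall x, P x.
Proof. by move=> sub h; apply: freeg_ind1 => // p; rewrite -walk_fpath; apply/h/(valP p). Qed.

Lemma actA_linr x phi psi a :
  actA x (fun s => a * phi s + psi s) = fun t => a * actA x phi t + actA x psi t.
Proof.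
apply: funext => t; elim/actA_walk_ind: x => [|s h]; last by rewrite !actA_walk // act_lin.
split=> [|b x y hx hy]; first by rewrite !actA0 mulr0 addr0.
by rewrite !actA_linl hx hy; ring.
Qed.

Lemma actA_0r x : actA x (fun=> 0) = fun=> 0.
Proof.
have := actA_linr x (fun=> 0) (fun=> 0) (-1).
rewrite (_ : (fun=> _) = fun=> 0); last by apply: funext => t; rewrite mulr0 addr0.
by move=> ->; apply: funext => t; rewrite mulN1r addNr.
Qed.

Lemma fpath_neq0 p : is_fpath p -> p != [::]. Proof. by case/andP. Qed.

Lemma actA_mul x y phi : actA (x * y) phi = actA x (actA y phi).
Proof.
elim/actA_walk_ind: x => [|s hs].
  split=> [|a x z hx hz]; apply: funext => t; first by rewrite mul0r !actA0.
  rewrite (_ : _ * y = a *: (x * y) + z * y); last exact: pathalg_mulPl.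
  by rewrite !actA_linl hx hz.
elim/actA_walk_ind: y => [|r hr].
  split=> [|a x z hx hz].
    rewrite mulr0 (_ : actA 0 phi = fun=> 0) ?actA_0r //.
    by apply: funext => t; rewrite actA0.
  rewrite (_ : actA (a *: x + z) phi = fun t => a * actA x phi t + actA z phi t).
    rewrite actA_linr; apply: funext => t; rewrite -hx -hz -actA_linl.
    by congr (actA _ _ _); apply: pathalg_mulP.
  by apply: funext => t; rewrite actA_linl.
have -> : actA (walk r) phi = pact r phi by apply: funext => t; rewrite actA_walk.
rewrite (_ : walk s * walk r = pathalg_mul (walk s) (walk r)) // walkM //.
apply: funext => t; rewrite [RHS]actA_walk //; case: eqP => [e|/eqP e].
  by rewrite actA_walk ?act_cat ?fpath_neq0 //; case: (is_fpath_cat hs hr e).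
by rewrite actA0 act_cat0.
Qed.

Lemma actA_steinberg x phi : steinberg phi -> steinberg (actA x phi).
Proof.
move=> st s t C V r; elim/actA_walk_ind: x => [|p hp].
  split=> [|a x y hx hy]; first by rewrite big1 // => X _; rewrite actA0.
  under eq_bigr => X _ do rewrite actA_linl.
  by rewrite big_split -mulr_sumr /= hx hy mulr0 addr0.
under eq_bigr => X _ do rewrite actA_walk //.
exact: act_steinberg.
Qed.

Lemma actA_flag_fun x phi : flag_fun phi -> flag_fun (actA x phi).
Proof.
move=> f t nt; elim/actA_walk_ind: x => [|p hp].
  split=> [|a x y hx hy]; first by rewrite actA0.
  by rewrite actA_linl hx hy mulr0 addr0.
by rewrite actA_walk // act_flag_fun.
Qed.

Lemma down_flag_up V W t : covers V W -> down_flag (V :: t) -> down_flag [:: W, V & t].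
Proof. by rewrite down_flag_cons => -> ->. Qed.

Lemma is_fpath1 V : is_fpath [:: V]. Proof. by []. Qed.

(** The four families become, in order, the Steinberg condition, [up_up], and the two branches of
    the recursion defining [up]. *)
Lemma pg_relation_act (r : pathalg) phi : steinberg phi -> flag_fun phi ->
  pg_relation r -> actA r phi = fun=> 0.
Proof.
move=> st ff; have fl p := act_flag_fun p ff.
case=> [V W VW dW|V W VW dW|V W c|V W V' c c' ne]; apply: funext => t.
- have r2 : rank2 V W by rewrite /rank2 VW dW eqxx.
  rewrite actA_sum; case: (boolP (down_flag t && (head 0%VS t == V))) => h; last first.
    apply: big1 => X /andP[c1 c2]; rewrite actA_walk; last by rewrite /is_fpath /= c1 c2.
    by rewrite /= /step (negbTE h).
  case/andP: h => df; case: t df => [|V' t] // df /eqP /= e; subst V'.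
  rewrite -[RHS](st [::] t V W r2); apply: eq_bigr => X /andP[c1 c2].
  rewrite actA_walk; last by rewrite /is_fpath /= c1 c2.
  by rewrite /= /step c1 df (down_flag_up c1 df) c2 /= !eqxx.
- have r2 : rank2 V W by rewrite /rank2 VW dW eqxx.
  rewrite actA_sum; case: (boolP (down_flag t && (head 0%VS t == W))) => h; last first.
    apply: big1 => X /andP[c1 c2]; rewrite actA_walk; last by rewrite /is_fpath /= c1 c2 !orbT.
    by rewrite /= /step (negbTE h).
  have /andP[df /eqP e] := h.
  rewrite -[RHS](up_up phi r2 df e); apply: eq_bigr => X /andP[c1 c2].
  rewrite actA_walk; last by rewrite /is_fpath /= c1 c2 !orbT.
  rewrite act_cons {1}/step h (covers_asym c2) c2; apply: eq_up_flag; rewrite ?e //.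
  move=> s ds; rewrite act_cons /step ds /= eqxx (covers_asym c1) c1.
  by apply: eq_up => s'; rewrite /= eqxx.
- rewrite actAD actAN -scaler_nat -[_ *: _]addr0 actA_linl actA0 addr0 !actA_walk //; last first.
    by rewrite /is_fpath /= c orbT.
  rewrite !act_cons; have [h|h] := boolP (down_flag t && (head 0%VS t == V)); last first.
    rewrite /step (negbTE h) act1; move: h; case: eqP => _; last by rewrite mulr0 subrr.
    by rewrite andbT => /ff ->; rewrite mulr0 subrr.
  rewrite /step h c; case/andP: h => df; case: t df => [|V' t] // df /eqP /= e; subst V'.
  rewrite (down_flag_up c df) eqxx (covers_asym c) /= up_cons !eqxx /=.
  by rewrite mulr_natl subrr.
have [c1 c2] := covers_capC c c' ne.
rewrite actAD !actA_walk; try by rewrite /is_fpath /= ?c ?c' ?c1 ?c2 ?orbT.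
rewrite !act_cons; have [h|h] := boolP (down_flag t && (head 0%VS t == V)); last first.
  by rewrite /step (negbTE h) addr0.
rewrite {1}/step h c {1}/step.
case/andP: (h) => df; case: t df h => [|V1 t] // df h /eqP /= e; subst V1.
rewrite (down_flag_up c df) eqxx (covers_asym c') c' /= up_cons (negbTE ne).
rewrite /step h (covers_asym c1) c1 addrC; apply/eqP; rewrite subr_eq0; apply/eqP.
apply: eq_up_flag => // s ds.
by rewrite ds /= eqxx c2 /= eqxx.
Qed.

Lemma pg_ideal_act x phi : steinberg phi -> flag_fun phi ->
  pg_ideal x -> actA x phi = fun=> 0.
Proof.
move=> st ff I.
(* Quantifying over all such functions makes the annihilator stable under right multiplication too,
   since [actA a psi] is again one of them. *)
pose J : set pathalg := [set x | forall psi, steinberg psi -> flag_fun psi ->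
  actA x psi = fun=> 0]%classic.
apply: (I J) => //; last by move=> r hr psi s f; apply: pg_relation_act.
split; first split=> [psi _ _|a y z hy hz psi s f]; try apply: funext => t.
- exact: actA0.
- by rewrite actA_linl hy ?hz // mulr0 addr0.
move=> a y hy; split=> psi s f; rewrite actA_mul.
  by rewrite hy // actA_0r.
by apply: hy; [apply: actA_steinberg | apply: actA_flag_fun].
Qed.

End Action.

(** * Symmetries of the path algebra *)

Section GLSubspace.
Variables (F : finFieldType) (n : nat).
Local Notation T := {vspace 'cV[F]_n.+1}.
Local Notation G := {'GL_n.+1[F]}.
Implicit Types (V W X : T) (g h : G).

Lemma GL_linfunE g (v : 'cV[F]_n.+1) :
  linfun (mulmx (GLval g) : 'cV[F]_n.+1 -> 'cV[F]_n.+1) v = GLval g *m v.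
Proof. by rewrite lfunE. Qed.

Lemma GL_mulVmx g (v : 'cV[F]_n.+1) : GLval (g^-1)%g *m (GLval g *m v) = v.
Proof. by rewrite mulmxA -GL_MxE mulVg GL_1E mul1mx. Qed.

Lemma GL_mulmxV g (v : 'cV[F]_n.+1) : GLval g *m (GLval (g^-1)%g *m v) = v.
Proof. by rewrite mulmxA -GL_MxE mulgV GL_1E mul1mx. Qed.

Lemma mem_GL_subspace g V v : (v \in GL_subspace g V) = (GLval (g^-1)%g *m v \in V).
Proof.
apply/memv_imgP/idP => [[u uV ->]|h]; first by rewrite GL_linfunE GL_mulVmx.
by exists (GLval (g^-1)%g *m v); rewrite // GL_linfunE GL_mulmxV.
Qed.

Lemma GL_subspaceM g h V : GL_subspace (g * h)%g V = GL_subspace g (GL_subspace h V).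
Proof. by apply/vspaceP => v; rewrite !mem_GL_subspace invMg GL_MxE mulmxA. Qed.

Lemma GL_subspace1 V : GL_subspace 1%g V = V.
Proof. by apply/vspaceP => v; rewrite mem_GL_subspace invg1 GL_1E mul1mx. Qed.

Lemma GL_subspaceK g : cancel (GL_subspace (F := F) (n := n) g) (GL_subspace g^-1%g).
Proof. by move=> V; rewrite -GL_subspaceM mulVg GL_subspace1. Qed.

Lemma GL_subspaceVK g : cancel (GL_subspace (F := F) (n := n) g^-1%g) (GL_subspace g).
Proof. by move=> V; rewrite -GL_subspaceM mulgV GL_subspace1. Qed.

Lemma GL_subspace_inj g : injective (GL_subspace (F := F) (n := n) g).
Proof. exact: can_inj (GL_subspaceK g). Qed.

Lemma GL_subspaceS g V W : (GL_subspace g V <= GL_subspace g W)%VS = (V <= W)%VS.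
Proof.
apply/idP/idP => [/(limgS (linfun (mulmx (GLval g^-1%g)))) |]; last exact: limgS.
by rewrite -!/(GL_subspace _ _) !GL_subspaceK.
Qed.

Lemma GL_subspace_cap g V W :
  GL_subspace g (V :&: W)%VS = (GL_subspace g V :&: GL_subspace g W)%VS.
Proof. by apply/vspaceP => v; rewrite !(memv_cap, mem_GL_subspace). Qed.

Lemma GL_subspace0 g : GL_subspace g 0%VS = 0%VS :> T.
Proof. exact: limg0. Qed.

Lemma GL_subspacef g : GL_subspace g fullv = fullv :> T.
Proof. by apply/vspaceP => v; rewrite mem_GL_subspace !memvf. Qed.

Lemma GL_subspace_dim g V : \dim (GL_subspace g V) = \dim V.
Proof.
apply: limg_dim_eq; apply/eqP; rewrite -subv0; apply/subvP => v.
rewrite memv_cap memv_ker GL_linfunE memv0 => /andP[_ /eqP h].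
by rewrite -(GL_mulVmx g v) h mulmx0.
Qed.

Lemma GL_covers g V W : covers (GL_subspace g V) (GL_subspace g W) = covers V W.
Proof. by rewrite /covers GL_subspaceS !GL_subspace_dim. Qed.

Lemma GL_down_flag g (s : seq T) : down_flag (map (GL_subspace g) s) = down_flag s.
Proof.
rewrite /down_flag; case: s => //= V s; congr (_ && _).
  by rewrite path_map; apply: eq_path => X Y /=; rewrite GL_covers.
by rewrite (last_map (GL_subspace g)) -{1}(GL_subspace0 g) (inj_eq (@GL_subspace_inj g)).
Qed.

Lemma GL_is_fpath g (s : seq T) : is_fpath s -> is_fpath (map (GL_subspace g) s).
Proof.
rewrite /is_fpath; case: s => //= V s h.
by rewrite path_map; apply: sub_path h => X Y /=; rewrite !GL_covers.
Qed.

Lemma GL_mapM g h (s : seq T) :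
  map (GL_subspace (g * h)%g) s = map (GL_subspace g) (map (GL_subspace h) s).
Proof. by rewrite -map_comp; apply: eq_map => V; apply: GL_subspaceM. Qed.

Lemma GL_mapK g : cancel (map (GL_subspace (F := F) (n := n) g)) (map (GL_subspace g^-1%g)).
Proof. exact: mapK (GL_subspaceK g). Qed.

End GLSubspace.

Section Symmetries.
Variables (F : finFieldType) (n : nat).
Local Notation T := {vspace 'cV[F]_n.+1}.
Local Notation pathalg := (pathalg F n).
Local Notation fpath := (Defs.fpath F n).
Local Notation PGalg := (PGalg F n).
Local Notation G := {'GL_n.+1[F]}.
Implicit Types (C V W X Y Z : T) (s t p r : seq T).
Implicit Types (phi psi : seq T -> int).

Definition lift_walk (h : seq T -> seq T) (x : pathalg) : pathalg :=
  fglift (fun p : fpath => walk (h p)) x.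

Lemma lift_walk_lin h (a : int) x y :
  lift_walk h (a *: x + y) = a *: lift_walk h x + lift_walk h y.
Proof. exact: fglift_linear. Qed.

Lemma lift_walkE h s : is_fpath s -> lift_walk h (walk s) = walk (h s).
Proof. by move=> hs; rewrite -[s]/(val (Fpath hs)) walk_fpath /lift_walk fglift1. Qed.

Lemma lift_walk0 h : lift_walk h 0 = 0.
Proof. by have := lift_walk_lin h (-1) 0 0; rewrite scaler0 addr0 scaleN1r addNr. Qed.

Lemma lift_walkD h x y : lift_walk h (x + y) = lift_walk h x + lift_walk h y.
Proof. by rewrite -[x]scale1r lift_walk_lin !scale1r. Qed.

Lemma lift_walkZ h a x : lift_walk h (a *: x) = a *: lift_walk h x.
Proof. by rewrite -[_ *: x]addr0 lift_walk_lin lift_walk0 !addr0. Qed.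

Lemma lift_walk_sum h (I : Type) (r : seq I) (P : pred I) f :
  lift_walk h (\sum_(i <- r | P i) f i) = \sum_(i <- r | P i) lift_walk h (f i).
Proof. exact: (big_morph _ (lift_walkD h) (lift_walk0 h)). Qed.

Lemma is_fpath_rev s : is_fpath s -> is_fpath (rev s).
Proof.
rewrite /is_fpath -!size_eq0 size_rev rev_sorted => /andP[-> /=].
by apply: sub_sorted => X Y; rewrite orbC.
Qed.

(** Reversing a concatenation reverses both pieces and exchanges them. This anti-automorphism
    underlies [pairing] and the symmetry of the form. *)
Lemma lift_walk_anti x y :
  lift_walk rev (x * y) = lift_walk rev y * lift_walk rev x.
Proof.
elim/actA_walk_ind: x => [|s hs].
  split=> [|a x z hx hz]; first by rewrite mul0r !lift_walk0 mulr0.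
  rewrite (_ : _ * y = a *: (x * y) + z * y); last exact: pathalg_mulPl.
  rewrite !lift_walk_lin hx hz; symmetry; exact: pathalg_mulP.
elim/actA_walk_ind: y => [|r hr].
  split=> [|a x z hx hz]; first by rewrite mulr0 !lift_walk0 mul0r.
  rewrite (_ : _ * (_ + _) = a *: (walk s * x) + walk s * z); last exact: pathalg_mulP.
  rewrite !lift_walk_lin hx hz; symmetry; exact: pathalg_mulPl.
rewrite (_ : walk s * walk r = pathalg_mul (walk s) (walk r)) // walkM //.
rewrite !lift_walkE //.
rewrite (_ : _ * _ = pathalg_mul (walk (rev r)) (walk (rev s))) // walkM ?is_fpath_rev //.
case: r hr => // V r hr; case/lastP: s hs => // s W hs.
rewrite rev_cons last_rcons rev_rcons /= last_rcons eq_sym.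
case: eqP => [e|_]; last exact: lift_walk0.
have hc : is_fpath (rcons s W ++ r).
  by case: (is_fpath_cat hs hr) => //; rewrite last_rcons.
by rewrite lift_walkE // rev_cat rev_rcons e cat_rcons.
Qed.

Lemma lift_walk_GLM g x y : lift_walk (map (GL_subspace g)) (x * y) =
  lift_walk (map (GL_subspace g)) x * lift_walk (map (GL_subspace g)) y.
Proof.
elim/actA_walk_ind: x => [|s hs].
  split=> [|a x z hx hz]; first by rewrite mul0r !lift_walk0 mul0r.
  rewrite (_ : _ * y = a *: (x * y) + z * y); last exact: pathalg_mulPl.
  rewrite !lift_walk_lin hx hz; symmetry; exact: pathalg_mulPl.
elim/actA_walk_ind: y => [|r hr].
  split=> [|a x z hx hz]; first by rewrite mulr0 !lift_walk0 mulr0.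
  rewrite (_ : _ * (_ + _) = a *: (walk s * x) + walk s * z); last exact: pathalg_mulP.
  rewrite !lift_walk_lin hx hz; symmetry; exact: pathalg_mulP.
rewrite (_ : walk s * walk r = pathalg_mul (walk s) (walk r)) // walkM //.
rewrite !lift_walkE //.
rewrite (_ : _ * _ = pathalg_mul (walk (map (GL_subspace g) s)) (walk (map (GL_subspace g) r))) //.
rewrite walkM ?GL_is_fpath //.
case: r hr => // V r hr; case/lastP: s hs => // s W hs.
rewrite map_rcons !last_rcons /= (inj_eq (@GL_subspace_inj _ _ g)).
case: eqP => [e|_]; last exact: lift_walk0.
have hc : is_fpath (rcons s W ++ r).
  by case: (is_fpath_cat hs hr) => //; rewrite last_rcons.
by rewrite lift_walkE // map_cat map_rcons.
Qed.

Lemma is_fpath3 V W X : (covers V W || covers W V) -> (covers W X || covers X W) ->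
  is_fpath [:: V; W; X].
Proof. by rewrite /is_fpath /= => -> ->. Qed.

(** Reversal swaps the two (FS) families, fixes the first wedge relation and exchanges [V] and [V']
    in the second. *)
Lemma pg_relation_rev (x : pathalg) : pg_relation x -> pg_relation (lift_walk rev x).
Proof.
case=> [V W VW dW|V W VW dW|V W c|V W V' c c' ne].
- rewrite lift_walk_sum (eq_bigr (fun X => walk [:: W; X; V])); first exact: FS_down.
  by move=> X /andP[c1 c2]; rewrite lift_walkE // is_fpath3 ?c1 ?c2.
- rewrite lift_walk_sum (eq_bigr (fun X => walk [:: V; X; W])); first exact: FS_up.
  by move=> X /andP[c1 c2]; rewrite lift_walkE // is_fpath3 ?c1 ?c2 ?orbT.
- rewrite lift_walkD -scaleN1r -scaler_nat !lift_walkZ !lift_walkE ?is_fpath3 ?c ?orbT //.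
  by rewrite scaler_nat scaleN1r; apply: wedge_eq.
have [c1 c2] := covers_capC c c' ne.
rewrite lift_walkD !lift_walkE ?is_fpath3 ?c ?c' ?c1 ?c2 ?orbT //.
by rewrite capvC; apply: wedge_neq => //; rewrite eq_sym.
Qed.

Lemma pg_relation_GL g (x : pathalg) :
  pg_relation x -> pg_relation (lift_walk (map (GL_subspace g)) x).
Proof.
have re V W (f : T -> pathalg) : \sum_(X | covers V X && covers X W) f (GL_subspace g X)
    = \sum_(X | covers (GL_subspace g V) X && covers X (GL_subspace g W)) f X.
  rewrite [RHS](reindex_onto (GL_subspace g) (GL_subspace g^-1%g)) => [|X _]; last first.
    exact: GL_subspaceVK.
  by apply: eq_bigl => X; rewrite !GL_covers GL_subspaceK eqxx andbT.
case=> [V W VW dW|V W VW dW|V W c|V W V' c c' ne].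
- rewrite lift_walk_sum (eq_bigr (fun X => let Y := GL_subspace g X in
    walk [:: GL_subspace g V; Y; GL_subspace g W])); last first.
    by move=> X /andP[c1 c2]; rewrite lift_walkE // is_fpath3 ?c1 ?c2.
  rewrite (re V W (fun Y => walk [:: GL_subspace g V; Y; GL_subspace g W])).
  by apply: FS_up; rewrite ?GL_subspaceS ?GL_subspace_dim.
- rewrite lift_walk_sum (eq_bigr (fun X => let Y := GL_subspace g X in
    walk [:: GL_subspace g W; Y; GL_subspace g V])); last first.
    by move=> X /andP[c1 c2]; rewrite lift_walkE // is_fpath3 ?c1 ?c2 ?orbT.
  rewrite (re V W (fun Y => walk [:: GL_subspace g W; Y; GL_subspace g V])).
  by apply: FS_down; rewrite ?GL_subspaceS ?GL_subspace_dim.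
- rewrite lift_walkD -scaleN1r -scaler_nat !lift_walkZ !lift_walkE ?is_fpath3 ?c ?orbT //.
  rewrite scaler_nat scaleN1r /= -(GL_subspace_dim g V).
  by apply: wedge_eq; rewrite GL_covers.
have [c1 c2] := covers_capC c c' ne.
rewrite lift_walkD !lift_walkE ?is_fpath3 ?c ?c' ?c1 ?c2 ?orbT //= GL_subspace_cap.
by apply: wedge_neq; rewrite ?GL_covers // (inj_eq (@GL_subspace_inj _ _ g)).
Qed.

Lemma pg_ideal_rev (x : pathalg) : pg_ideal x -> pg_ideal (lift_walk rev x).
Proof.
move=> I; have [[I0 ID] IM] := pg_ideal_two_sided F n.
pose J : set pathalg := [set x | pg_ideal (lift_walk rev x)]%classic.
apply: (I J) => [|r hr]; last by move=> K KI KR; apply/KR/pg_relation_rev.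
split; first split=> [|a y z hy hz]; rewrite /J /=.
- by rewrite lift_walk0.
- by rewrite lift_walk_lin; apply: ID.
by move=> a y hy; split; rewrite /J /= lift_walk_anti; case: (IM (lift_walk rev a) _ hy).
Qed.

Lemma pg_ideal_GL g (x : pathalg) :
  pg_ideal x -> pg_ideal (lift_walk (map (GL_subspace g)) x).
Proof.
move=> I; have [[I0 ID] IM] := pg_ideal_two_sided F n.
set gA := lift_walk _.
pose J : set pathalg := [set x | pg_ideal (gA x)]%classic.
apply: (I J) => [|r hr]; last by move=> K KI KR; apply/KR/pg_relation_GL.
split; first split=> [|a y z hy hz]; rewrite /J /=.
- by rewrite /gA lift_walk0.
- by rewrite /gA lift_walk_lin; apply: ID.
by move=> a y hy; split; rewrite /J /= /gA lift_walk_GLM; case: (IM (gA a) _ hy).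
Qed.

Lemma PGclass_eq (x y : pathalg) : PGclass x = PGclass y <-> pg_ideal (x - y).
Proof.
have [subI _] := pg_ideal_two_sided F n.
by rewrite /PGclass quoP span_id.
Qed.

Lemma pg_ideal_repr (x : pathalg) : pg_ideal (repr (PGclass x) - x).
Proof. by apply/PGclass_eq; rewrite PGclass_repr. Qed.

(** Acts through a chosen representative; by [actS_class] the choice is immaterial on Steinberg
    functions supported on flags. *)
Definition actS (x : PGalg) phi := actA (repr x) phi.

Lemma actS_class x phi : steinberg phi -> flag_fun phi ->
  actS (PGclass x) phi = actA x phi.
Proof.
move=> st ff; apply: funext => t; apply/eqP; rewrite -subr_eq0 -actAN -actAD.
by rewrite (pg_ideal_act st ff (pg_ideal_repr x)).
Qed.

Lemma lift_walkB h x y : lift_walk h (x - y) = lift_walk h x - lift_walk h y.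
Proof. by rewrite lift_walkD -[- y]scaleN1r lift_walkZ scaleN1r. Qed.

Lemma GL_PGclass g x : GL_PGalg g (PGclass x) =
  PGclass (lift_walk (map (GL_subspace g)) x).
Proof.
apply/PGclass_eq; rewrite -/(lift_walk _ _) -lift_walkB.
exact: (pg_ideal_GL _ (pg_ideal_repr x)).
Qed.

Definition revS (x : PGalg) : PGalg := PGclass (lift_walk rev (repr x)).

Lemma revS_class x : revS (PGclass x) = PGclass (lift_walk rev x).
Proof.
apply/PGclass_eq; rewrite -lift_walkB.
exact: (pg_ideal_rev (pg_ideal_repr x)).
Qed.

End Symmetries.

Section ZmodMorph.
Variables (V : lmodType int) (f : V -> int).
Hypothesis fB : zmod_morphism f.

Lemma zmod_morph0 : f 0 = 0. Proof. by have := fB 0 0; rewrite !subrr. Qed.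
Lemma zmod_morphN x : f (- x) = - f x. Proof. by rewrite -sub0r fB zmod_morph0 sub0r. Qed.
Lemma zmod_morphD x y : f (x + y) = f x + f y.
Proof. by rewrite -{1}[y]opprK fB zmod_morphN opprK. Qed.
Lemma zmod_morphZ a x : f (a *: x) = a * f x.
Proof.
have fMn m : f (x *+ m) = f x *+ m.
  by elim: m => [|m IH]; rewrite ?mulr0n ?zmod_morph0 // !mulrS zmod_morphD IH.
rewrite -{1}[a]intz scaler_int; case: a => m.
  by rewrite -pmulrn fMn -mulr_natl natz.
by rewrite NegzE mulrNz zmod_morphN -pmulrn fMn mulNr -mulr_natl natz.
Qed.
Lemma zmod_morph_sum (I : Type) (r : seq I) (P : pred I) (a : I -> int) (x : I -> V) :
  f (\sum_(i <- r | P i) a i *: x i) = \sum_(i <- r | P i) a i * f (x i).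
Proof.
rewrite (big_morph f zmod_morphD zmod_morph0); apply: eq_bigr => i _; exact: zmod_morphZ.
Qed.
End ZmodMorph.

(** * The standard module and its form *)

Section Standard.
Variables (F : finFieldType) (n : nat).
Local Notation T := {vspace 'cV[F]_n.+1}.
Local Notation pathalg := (pathalg F n).
Local Notation PGalg := (PGalg F n).
Local Notation Delta0 := (Delta0 F n).
Local Notation G := {'GL_n.+1[F]}.
Implicit Types (C V W X Y Z : T) (s t p r : seq T).
Implicit Types (phi psi : seq T -> int) (x y z : PGalg).

Definition cls s : PGalg := PGclass (walk s).

Lemma clsM s t : is_fpath s -> is_fpath t ->
  cls s * cls t = if last 0%VS s == head 0%VS t then cls (s ++ behead t) else 0.
Proof.
move=> hs ht; rewrite [LHS]PGclassM.
rewrite (_ : walk s * walk t = pathalg_mul (walk s) (walk t)) // walkM //.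
by case: ifP => // _; apply: raddf0.
Qed.

Lemma PGclassZ a (x : pathalg) : PGclass (a *: x) = a *: PGclass x.
Proof. by rewrite /PGclass -quo_scaleE. Qed.

Lemma PGalg_mulZl a x y : (a *: x) * y = a *: (x * y).
Proof.
rewrite -[x]PGclass_repr -[y]PGclass_repr -PGclassZ [LHS]PGclassM [_ * _ in RHS]PGclassM.
rewrite -PGclassZ; congr PGclass.
by have := pathalg_mulPl a (repr y) (repr x) 0; rewrite pathalg_0mul !addr0.
Qed.

Lemma PGalg_mulZr a x y : x * (a *: y) = a *: (x * y).
Proof.
rewrite -[x]PGclass_repr -[y]PGclass_repr -PGclassZ [LHS]PGclassM [_ * _ in RHS]PGclassM.
rewrite -PGclassZ; congr PGclass.
by have := pathalg_mulP a (repr x) (repr y) 0; rewrite pathalg_mul0 !addr0.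
Qed.

Lemma PGalg_ind (P : PGalg -> Prop) : submodule P ->
  (forall s, is_fpath s -> P (cls s)) -> forall x, P x.
Proof.
move=> [P0 PD] h x; rewrite -[x]PGclass_repr; elim/actA_walk_ind: (repr x) => //.
split=> [|a y z hy hz]; first by rewrite [PGclass _]raddf0.
by rewrite PGclassD PGclassZ; apply: PD.
Qed.

(** The model of the generator [({0})] of the standard module. *)
Definition vac : seq T -> int := fun t => (t == [:: 0%VS])%:R.

Lemma vac_steinberg : steinberg vac.
Proof.
move=> s t C V _; apply: big1 => X _; rewrite /vac; case: eqP => // /(congr1 size).
by rewrite size_cat /= !addnS.
Qed.

Lemma vac_flag_fun : flag_fun vac.
Proof. by move=> t; rewrite /vac; case: eqP => // ->; rewrite down_flag1 eqxx. Qed.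

Lemma actS_cls s phi : steinberg phi -> flag_fun phi -> is_fpath s ->
  actS (cls s) phi = pact s phi.
Proof. by move=> st ff h; rewrite actS_class //; apply: funext => t; rewrite actA_walk. Qed.

Lemma actS_linl a x y phi t : steinberg phi -> flag_fun phi ->
  actS (a *: x + y) phi t = a * actS x phi t + actS y phi t.
Proof.
move=> st ff; rewrite -[x]PGclass_repr -[y]PGclass_repr -PGclassZ -PGclassD.
by rewrite !actS_class // actA_linl.
Qed.

Lemma actS_mul x y phi : steinberg phi -> flag_fun phi ->
  actS (x * y) phi = actS x (actS y phi).
Proof.
move=> st ff; rewrite -[x]PGclass_repr -[y]PGclass_repr [_ * _]PGclassM.
rewrite (actS_class (repr y)) // !actS_class // ?actA_mul //.
  exact: actA_steinberg.
exact: actA_flag_fun.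
Qed.

Lemma actS_steinberg x phi : steinberg phi -> steinberg (actS x phi).
Proof. exact: actA_steinberg. Qed.

Lemma actS_flag_fun x phi : flag_fun phi -> flag_fun (actS x phi).
Proof. exact: actA_flag_fun. Qed.

Lemma actS_linr a x phi psi :
  actS x (fun s => a * phi s + psi s) = fun t => a * actS x phi t + actS x psi t.
Proof. exact: actA_linr. Qed.

(** For [x] in the standard module, its value at [t] turns out to be the form of [x] with the flag
    [t] ([cls_rev_mul]). *)
Definition Phi x : seq T -> int := actS x vac.

Lemma Phi_steinberg x : steinberg (Phi x).
Proof. exact/actS_steinberg/vac_steinberg. Qed.

Lemma Phi_flag_fun x : flag_fun (Phi x).
Proof. exact/actS_flag_fun/vac_flag_fun. Qed.

Lemma Phi_lin a x y t : Phi (a *: x + y) t = a * Phi x t + Phi y t.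
Proof. exact: (actS_linl _ _ _ _ vac_steinberg vac_flag_fun). Qed.

Lemma Phi0 t : Phi 0 t = 0.
Proof. by have := Phi_lin (-1) 0 0 t; rewrite scaler0 addr0 mulN1r addNr. Qed.

Lemma PhiD x y t : Phi (x + y) t = Phi x t + Phi y t.
Proof. by rewrite -[x]scale1r Phi_lin mul1r scale1r. Qed.

Lemma PhiZ a x t : Phi (a *: x) t = a * Phi x t.
Proof. by rewrite -[_ *: x]addr0 Phi_lin Phi0 addr0. Qed.

Lemma Phi_mul x y : Phi (x * y) = actS x (Phi y).
Proof. exact: (actS_mul _ _ vac_steinberg vac_flag_fun). Qed.

Lemma down_flag_fpath s : down_flag s -> is_fpath s.
Proof.
rewrite /down_flag /is_fpath => /and3P[-> h _] /=.
by apply: sub_sorted h => X Y /= ->; rewrite orbT.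
Qed.

(** The path [rev t] ascends from 0, and ascending edges only prepend: read at the flag [[:: 0%VS]],
    it rebuilds [t]. *)
Lemma act_flag_rev t phi : down_flag t -> pact (rev t) phi [:: 0%VS] = phi t.
Proof.
elim: t phi => [//|V [|Y t] IH] phi.
  by rewrite down_flag1 => /eqP ->; rewrite /= eqxx.
rewrite down_flag_cons => /andP[c df].
have -> : rev [:: V, Y & t] = rev (Y :: t) ++ behead [:: Y; V].
  by rewrite rev_cons -cats1.
rewrite act_cat ?IH //; last 2 first.
- by rewrite rev_cons; case: (rev t).
- by rewrite rev_cons last_rcons.
by rewrite act_cons /step df /= eqxx c eqxx.
Qed.

Definition flag_span : set PGalg :=
  lin_span [set cls s | s in [set s | down_flag s]]%classic.

Lemma flag_span_sub : submodule flag_span. Proof. exact: submodule_span. Qed.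

Lemma flag_span_cls s : down_flag s -> flag_span (cls s).
Proof. by move=> h; apply: Defs.sub_span; exists s. Qed.

Lemma flag_span_ind (P : PGalg -> Prop) : submodule P ->
  (forall s, down_flag s -> P (cls s)) -> forall x, flag_span x -> P x.
Proof. by move=> sub h x hx; apply: (hx P) => // _ [s ds <-]; apply: h. Qed.

Lemma flag_span0 : flag_span 0. Proof. by case: flag_span_sub. Qed.

Lemma flag_spanZ a x : flag_span x -> flag_span (a *: x).
Proof. by move=> h; rewrite -[_ *: _]addr0; apply: flag_span_sub.2 h flag_span0. Qed.

Lemma PGclass_pg_relation (x : pathalg) : pg_relation x -> PGclass x = 0.
Proof.
move=> h; rewrite -[0](raddf0 (@PGclass F n)); apply/PGclass_eq; rewrite subr0.
by move=> J _; apply.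
Qed.

Lemma cls_wedge_eq V W : covers V W -> cls [:: V; W; V] = cls [:: V] *+ #|F| ^ \dim V.
Proof.
move=> c; apply/eqP; rewrite -subr_eq0 -[_ *+ _](raddfMn (@PGclass F n)).
by rewrite -[X in X == _](raddfB (@PGclass F n)); apply/eqP/PGclass_pg_relation/wedge_eq.
Qed.

Lemma cls_wedge_neq V V' W : covers V W -> covers V' W -> V != V' ->
  cls [:: V; W; V'] = - cls [:: V; (V :&: V')%VS; V'].
Proof.
move=> c c' ne; apply/eqP; rewrite -addr_eq0 -PGclassD.
exact/eqP/PGclass_pg_relation/wedge_neq.
Qed.

Lemma is_fpath2 V W : covers V W || covers W V -> is_fpath [:: V; W].
Proof. by rewrite /is_fpath /= => ->. Qed.

Lemma flag_span_down V W x : covers W V -> flag_span x -> flag_span (cls [:: V; W] * x).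
Proof.
move=> c; elim/flag_span_ind => [|s ds].
  split=> [|a y z hy hz]; first by rewrite mulr0; apply: flag_span0.
  by rewrite mulrDr PGalg_mulZr; apply: flag_span_sub.2.
have fs := down_flag_fpath ds.
rewrite clsM // ?is_fpath2 ?c ?orbT //; case: eqP => [e|_]; last exact: flag_span0.
case: s ds e {fs} => // X s ds /= e; apply: flag_span_cls.
by rewrite e down_flag_cons -e c e ds.
Qed.

(** The wedge relations push the ascending edge down the flag: either it is absorbed into a scalar,
    or it passes to [V :&: Y] under [Y] with a sign. It never reaches 0, which covers nothing. *)
Lemma flag_span_up V W s : covers V W -> down_flag (W :: s) ->
  flag_span (cls [:: V; W] * cls (W :: s)).
Proof.
elim: s V W => [|Y s IH] V W c.
  by rewrite down_flag1 => /eqP W0; move: (covers_dim c); rewrite W0 dimv0.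
rewrite down_flag_cons => /andP[cY df]; have fY := down_flag_fpath df.
have -> : cls [:: V; W] * cls [:: W, Y & s] = cls [:: V; W; Y] * cls (Y :: s).
  rewrite !clsM ?is_fpath2 ?is_fpath3 ?c ?cY ?orbT //= ?eqxx //.
  by apply: down_flag_fpath; rewrite down_flag_cons cY.
have [->|ne] := eqVneq V Y.
  rewrite cls_wedge_eq // mulrnAl -scaler_nat; apply: flag_spanZ.
  by rewrite clsM //= eqxx; apply: flag_span_cls.
have [c1 c2] := covers_capC c cY ne.
rewrite cls_wedge_neq // mulNr -scaleN1r; apply: flag_spanZ.
have -> : cls [:: V; (V :&: Y)%VS; Y] = cls [:: V; (V :&: Y)%VS] * cls [:: (V :&: Y)%VS; Y].
  by rewrite clsM ?is_fpath2 ?c1 ?c2 ?orbT //= eqxx.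
by rewrite -mulrA; apply: flag_span_down => //; apply: IH.
Qed.

Lemma flag_span_mul x y : flag_span y -> flag_span (x * y).
Proof.
elim/PGalg_ind: x y => [|p hp].
  split=> [y hy|a x z hx hz y hy]; first by rewrite mul0r; apply: flag_span0.
  by rewrite mulrDl PGalg_mulZl; apply: flag_span_sub.2; [apply: hx | apply: hz].
elim: p hp => [//|V [|W p] IH] hp y hy.
  elim/flag_span_ind: y / hy => [|s ds].
    split=> [|a y z hy hz]; first by rewrite mulr0; apply: flag_span0.
    by rewrite mulrDr PGalg_mulZr; apply: flag_span_sub.2.
  rewrite clsM // ?down_flag_fpath //=; case: eqP => [e|_]; last exact: flag_span0.
  by case: s ds e => // X s ds /= ->; apply: flag_span_cls.
have [/orP c hp'] : covers V W || covers W V /\ is_fpath (W :: p).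
  by move: hp; rewrite /is_fpath /= => /andP[].
have -> : cls [:: V, W & p] = cls [:: V; W] * cls (W :: p).
  by rewrite clsM ?is_fpath2 ?(introT orP c) //= eqxx.
rewrite -mulrA; move: (IH hp' y hy); move: (_ * y) => {hy} y hy.
case: c => c; last exact: flag_span_down.
elim/flag_span_ind: y / hy => [|s ds].
  split=> [|a y z hy hz]; first by rewrite mulr0; apply: flag_span0.
  by rewrite mulrDr PGalg_mulZr; apply: flag_span_sub.2.
have [e|ne] := eqVneq W (head 0%VS s); last first.
  rewrite clsM ?is_fpath2 ?c // ?down_flag_fpath //= (negbTE ne); exact: flag_span0.
by case: s ds e => // X s ds /= e; subst X; apply: flag_span_up.
Qed.

Lemma Delta0_idealP x : Delta0_ideal x <-> flag_span x.
Proof.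
split=> [h|hx J [Jsub JM] Jf].
  apply: h => [|s ds]; last exact: flag_span_cls.
  by split; [apply: flag_span_sub | move=> a y; apply: flag_span_mul].
by elim/flag_span_ind: x / hx.
Qed.

(** The only flag headed by 0 is [[:: 0%VS]]. This is the integrality implicit in the definition of
    the form. *)
Lemma flag_span_zero x : flag_span x -> exists m : int, cls [:: 0%VS] * x = m *: cls [:: 0%VS].
Proof.
elim/flag_span_ind => [|s ds].
  split=> [|a y z [m em] [m' em']]; first by exists 0; rewrite mulr0 scale0r.
  by exists (a * m + m'); rewrite mulrDr PGalg_mulZr em em' scalerDl scalerA.
rewrite clsM // ?down_flag_fpath //=; case: eqP => [e|_]; last by exists 0; rewrite scale0r.
case: s ds e => [//|X [|Y s]] ds /= e; first by exists 1; rewrite scale1r.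
move: ds; rewrite down_flag_cons -e => /andP[/covers_dim]; by rewrite dimv0.
Qed.

Lemma Phi_zero : Phi (cls [:: 0%VS]) [:: 0%VS] = 1.
Proof.
rewrite /Phi actS_cls //=; [|exact: vac_steinberg|exact: vac_flag_fun].
by rewrite eqxx /vac eqxx.
Qed.

(** The product is some integer multiple of [({0})] by [flag_span_zero]; the model takes [({0})] to
    a function with value 1, so evaluating there identifies the integer. *)
Lemma cls_rev_mul x t : down_flag t -> flag_span x ->
  cls (rev t) * x = Phi x t *: cls [:: 0%VS].
Proof.
move=> dt hx; have [m em] := flag_span_zero (flag_span_mul (cls (rev t)) hx).
have ft := is_fpath_rev (down_flag_fpath dt).
have e0 : cls [:: 0%VS] * cls (rev t) = cls (rev t).
  have h0 : head 0%VS (rev t) = 0%VS.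
    have -> : head 0%VS (rev t) = last 0%VS t.
      by case/lastP: (t) => // u W; rewrite rev_rcons last_rcons.
    by case/and3P: dt => _ _ /eqP.
  rewrite clsM //= h0 eqxx; move: ft h0; by case: (rev t) => //= V r _ ->.
move: em; rewrite mulrA e0 => em; rewrite em; congr (_ *: _).
have := congr1 (fun z => Phi z [:: 0%VS]) em; rewrite PhiZ Phi_zero mulr1 => <-.
rewrite Phi_mul actS_cls //; [|exact: Phi_steinberg|exact: Phi_flag_fun].
by rewrite act_flag_rev.
Qed.

Lemma revS_lin a x y : revS (a *: x + y) = a *: revS x + revS y.
Proof.
rewrite -[x]PGclass_repr -[y]PGclass_repr -PGclassZ -PGclassD !revS_class.
by rewrite lift_walk_lin PGclassD PGclassZ.
Qed.

Lemma revS_mul x y : revS (x * y) = revS y * revS x.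
Proof.
rewrite -[x]PGclass_repr -[y]PGclass_repr [_ * _]PGclassM !revS_class lift_walk_anti.
by rewrite -PGclassM.
Qed.

Lemma revS_cls s : is_fpath s -> revS (cls s) = cls (rev s).
Proof. by move=> h; rewrite revS_class lift_walkE. Qed.

(* Evaluation of phi, extended linearly from flags. *)
Definition pairing x phi : int := actS (revS x) phi [:: 0%VS].

Lemma pairing_linl a x y phi : steinberg phi -> flag_fun phi ->
  pairing (a *: x + y) phi = a * pairing x phi + pairing y phi.
Proof. by move=> st ff; rewrite /pairing revS_lin actS_linl. Qed.

Lemma pairing_linr a x phi psi :
  pairing x (fun s => a * phi s + psi s) = a * pairing x phi + pairing x psi.
Proof. by rewrite /pairing actS_linr. Qed.

Lemma pairing_cls t phi : steinberg phi -> flag_fun phi -> down_flag t ->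
  pairing (cls t) phi = phi t.
Proof.
move=> st ff dt; rewrite /pairing revS_cls ?down_flag_fpath //.
by rewrite actS_cls ?is_fpath_rev ?down_flag_fpath // act_flag_rev.
Qed.

Lemma pairing0 phi : steinberg phi -> flag_fun phi -> pairing 0 phi = 0.
Proof.
by move=> st ff; have := pairing_linl (-1) 0 0 st ff; rewrite scaler0 addr0 mulN1r addNr.
Qed.

(** Reversal fixes [({0})] and turns the product for [(t, s)] into the one for [(s, t)], so the two
    scalars agree. *)
Lemma Phi_sym_flag s t : down_flag s -> down_flag t -> Phi (cls s) t = Phi (cls t) s.
Proof.
move=> ds dt; have := cls_rev_mul dt (flag_span_cls ds).
move/(congr1 (@revS F n)); rewrite revS_mul -[_ *: _]addr0 revS_lin.
have r0 : revS 0 = 0 :> PGalg.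
  by have := revS_lin (-1) 0 0; rewrite scaler0 addr0 scaleN1r addNr.
rewrite r0 addr0 !revS_cls ?is_fpath_rev ?down_flag_fpath ?down_flag1 // seq.revK.
rewrite -[rev [:: _]]/[:: 0%VS].
rewrite cls_rev_mul //; last exact: flag_span_cls.
move/(congr1 (fun z => Phi z [:: 0%VS])).
by rewrite !PhiZ Phi_zero !mulr1.
Qed.

Lemma pairing_sym x y : flag_span x -> flag_span y -> pairing y (Phi x) = pairing x (Phi y).
Proof.
have st z := @Phi_steinberg z; have ff z := @Phi_flag_fun z.
have lr a (u v z : PGalg) : pairing z (Phi (a *: u + v)) = a * pairing z (Phi u) + pairing z (Phi v).
  by rewrite -pairing_linr; congr pairing; apply: funext => t; apply: Phi_lin.
have r0 (z : PGalg) : pairing z (Phi 0) = 0.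
  by have := lr (-1) 0 0 z; rewrite scaler0 addr0 mulN1r addNr.
elim/flag_span_ind => [|s ds].
  split=> [_|a u v hu hv hy]; first by rewrite r0 pairing0.
  by rewrite lr pairing_linl // hu // hv.
elim/flag_span_ind => [|t dt].
  split=> [|a u v hu hv]; first by rewrite r0 pairing0.
  by rewrite lr pairing_linl // hu hv.
by rewrite !pairing_cls // Phi_sym_flag.
Qed.

Definition dval (x : Delta0) : PGalg := val (x : submod (@Delta0_ideal F n)).

Lemma Delta0_ideal_sub : submodule (@Delta0_ideal F n).
Proof.
split=> [|a x y /Delta0_idealP hx /Delta0_idealP hy].
  by apply/Delta0_idealP; exact: flag_span0.
by apply/Delta0_idealP; exact: flag_span_sub.2.
Qed.

Lemma dvalP (x : Delta0) : flag_span (dval x).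
Proof.
apply/Delta0_idealP; rewrite -(span_id Delta0_ideal_sub).
exact/asboolP/(valP (x : submod _)).
Qed.

Lemma mkD_subproof x : flag_span x -> x \in spanb (@Delta0_ideal F n).
Proof. by move=> h; apply/asboolP; apply: Defs.sub_span; apply/Delta0_idealP. Qed.

Definition mkD x (h : flag_span x) : Delta0 := (Submod (mkD_subproof h) : submod _).

Lemma dval_mkD x (h : flag_span x) : dval (mkD h) = x. Proof. by []. Qed.

Lemma dval_inj : injective dval. Proof. exact: val_inj. Qed.

Lemma dval_lin (a : int) (x y : Delta0) : dval (a *: x + y) = a *: dval x + dval y.
Proof. by []. Qed.

Lemma dvalB (x y : Delta0) : dval (x - y) = dval x - dval y.
Proof. by []. Qed.

Lemma Delta0_form_exists : is_Delta0_form (fun x y : Delta0 => pairing (dval y) (Phi (dval x))).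
Proof.
split=> [x y|y x x'|s t x y ds dt ex ey].
- exact: pairing_sym (dvalP x) (dvalP y).
- rewrite dvalB -scaleN1r addrC (_ : Phi _ = fun t => (-1) * Phi (dval x') t + Phi (dval x) t).
    by rewrite pairing_linr mulN1r addrC.
  by apply: funext => t; apply: Phi_lin.
rewrite /dval ex ey -!/(cls _) pairing_cls //; [|exact: Phi_steinberg|exact: Phi_flag_fun].
by rewrite cls_rev_mul ?scaler_int //; [rewrite -scaler_int intz | apply: flag_span_cls].
Qed.

Lemma additive_flag_ext (f g : Delta0 -> int) : zmod_morphism f -> zmod_morphism g ->
  (forall s (x : Delta0), down_flag s -> dval x = cls s -> f x = g x) -> f =1 g.
Proof.
move=> fB gB h x.
suff : forall z, flag_span z -> forall w : Delta0, dval w = z -> f w = g w.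
  by move=> /(_ _ (dvalP x)); apply.
move=> z hz.
suff : exists2 w : Delta0, dval w = z & f w = g w.
  by case=> w <- e w' /dval_inj ->.
elim/flag_span_ind: z / hz => [|s ds].
  split=> [|a u v [w ew e] [w' ew' e']]; first by exists 0; rewrite ?(zmod_morph0 fB) ?(zmod_morph0 gB).
  exists (a *: w + w'); first by rewrite dval_lin ew ew'.
  by rewrite (zmod_morphD fB) (zmod_morphD gB) (zmod_morphZ fB) (zmod_morphZ gB) e e'.
by exists (mkD (flag_span_cls ds)) => //; exact: (h s).
Qed.

Lemma Delta0_form_unique (b b' : Delta0 -> Delta0 -> int) :
  is_Delta0_form b -> is_Delta0_form b' -> forall x y : Delta0, b x y = b' x y.
Proof.
move=> [bs ba bf] [bs' ba' bf'] x y.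
apply: (additive_flag_ext (ba y) (ba' y)) => s {}x ds ex.
rewrite bs bs'; apply: (additive_flag_ext (ba x) (ba' x)) => t {}y dt ey.
rewrite bs bs'; have := bf s t x y ds dt ex ey; rewrite (bf' s t x y ds dt ex ey).
move/(congr1 (fun z => Phi z [:: 0%VS])).
by rewrite -!scaler_int !PhiZ Phi_zero !mulr1 !intz.
Qed.

(** The form is chosen by [xget] from its specification, so existence and uniqueness are both needed
    to compute it. *)
Lemma Delta0_formE (x y : Delta0) : Delta0_form x y = pairing (dval y) (Phi (dval x)).
Proof.
apply: (Delta0_form_unique _ Delta0_form_exists).
exact: xgetPex (ex_intro _ _ Delta0_form_exists).
Qed.

End Standard.

(** * Full flags and opposite flags *)

Section Flags.
Variables (F : finFieldType) (n : nat).
Local Notation T := {vspace 'cV[F]_n.+1}.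
Implicit Types (C V W X Y Z L H : T) (s t D E : seq T).

(** The counter only makes the recursion structural: the list is empty unless [d] is the dimension
    of [V]. *)
Fixpoint flags d V : seq (seq T) :=
  if d is d'.+1 then
    flatten [seq map (cons V) (flags d' Y) | Y <- enum [pred Y | covers Y V]]
  else if V == 0%VS then [:: [:: V]] else [::].

Lemma down_flag_size t : down_flag t -> size t = (\dim (head 0%VS t)).+1.
Proof.
elim: t => [//|V [|Y t] IH].
  by rewrite down_flag1 => /eqP ->; rewrite /= dimv0.
by rewrite down_flag_cons => /andP[/covers_dim /= -> /IH /= ->].
Qed.

Lemma mem_flags d V t : (t \in flags d V) =
  [&& down_flag t, head 0%VS t == V & size t == d.+1].
Proof.
elim: d V t => [|d IH] V t.
  rewrite /=; case: (eqVneq V 0%VS) => [->|V0]; rewrite ?inE.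
    apply/eqP/and3P => [->|[+ /eqP + /eqP]]; first by rewrite down_flag1 !eqxx.
    by case: t => [|W [|]] //= _ ->.
  apply/esym/negP => /and3P[+ /eqP + /eqP]; case: t => [|W [|]] //=.
  by rewrite down_flag1 => /eqP -> e; rewrite -e eqxx in V0.
apply/flatten_mapP/and3P => [[Y]|[df hd sz]].
  rewrite mem_enum inE => c /mapP[u]; rewrite IH => /and3P[du /eqP hu su] ->.
  by case: u du hu su => // X u du /= hu su; rewrite down_flag_cons hu c -hu du eqxx.
case: t df hd sz => [//|W [//|Y u]]; rewrite down_flag_cons => /andP[c du] /eqP /= e su; subst W.
exists Y; first by rewrite mem_enum inE.
by apply/mapP; exists (Y :: u) => //; rewrite IH du eqxx.
Qed.

Lemma mem_flags_dim V t : (t \in flags (\dim V) V) = down_flag t && (head 0%VS t == V).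
Proof.
rewrite mem_flags; case: (boolP (down_flag t)) => //= /down_flag_size ->.
by case: eqP => //= ->; rewrite eqxx.
Qed.

Lemma sum_flagsS (A : nmodType) d V (f : seq T -> A) :
  \sum_(t <- flags d.+1 V) f t = \sum_(Y | covers Y V) \sum_(t <- flags d Y) f (V :: t).
Proof.
rewrite /= big_flatten big_map big_enum /=; apply: eq_bigr => Y _; exact: big_map.
Qed.

Lemma flags_uniq d V : uniq (flags d V).
Proof.
elim: d V => [|d IH] V /=; first by case: ifP.
have: uniq (enum [pred Y | covers Y V]) by apply: enum_uniq.
elim: (enum _) => //= Y r IHr /andP[nY ur]; rewrite cat_uniq IHr // andbT.
rewrite map_inj_uniq ?IH /=; last by move=> ? ? [].
apply/hasPn => t /flatten_mapP[X Xr /mapP[u]]; rewrite mem_flags => /and3P[_ /eqP hu _] ->.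
apply/negP => /mapP[u']; rewrite mem_flags => /and3P[_ /eqP hu' _] [e].
by move: nY; rewrite -hu' -e hu Xr.
Qed.

Definition qint (d : nat) : nat := \sum_(i < d) #|F| ^ i.
Definition qfact (d : nat) : nat := \prod_(i < d) qint i.+1.

Lemma qintS d : qint d.+1 = (qint d + #|F| ^ d)%N.
Proof. by rewrite /qint big_ord_recr. Qed.

Lemma qintS' d : qint d.+1 = (1 + #|F| * qint d)%N.
Proof.
rewrite /qint big_ord_recl expn0; congr (_ + _)%N; rewrite big_distrr /=.
by apply: eq_bigr => i _; rewrite -expnS.
Qed.

Lemma qfactS d : qfact d.+1 = (qint d.+1 * qfact d)%N.
Proof. by rewrite /qfact big_ord_recr mulnC. Qed.

Lemma covers_zero V : covers V 0%VS = false.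
Proof. by apply/negP => /covers_dim; rewrite dimv0. Qed.

(** The hyperplanes of [V] other than [H] are grouped by their trace [X] on [H]; those with trace
    [X] are the members other than [H] of the pencil between [X] and [V], to which (FS) applies. *)
Lemma sum_hyper_trace (A : nmodType) V H (P : pred T) (f : T -> T -> A) : covers H V ->
  \sum_(Y | covers Y V && (Y != H) && P (Y :&: H)%VS) f Y (Y :&: H)%VS =
  \sum_(X | covers X H && P X) \sum_(Y | mid X V Y && (Y != H)) f Y X.
Proof.
move=> cH.
rewrite (partition_big (fun Y => (Y :&: H)%VS) (fun X => covers X H && P X)) /=; last first.
  move=> Y /andP[/andP[cY ne] ->]; rewrite andbT; exact: (covers_capC cY cH ne).2.
apply: eq_bigr => X /andP[cX PX].
transitivity (\sum_(Y | mid X V Y && (Y != H)) f Y (Y :&: H)%VS); last first.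
  apply: eq_bigr => Y /andP[mY ne]; rewrite (mid_neq_cap _ mY ne) //.
  by rewrite /mid cX.
apply: eq_bigl => Y; apply/idP/idP => [/andP[/andP[/andP[cY ne] _] /eqP <-]|/andP[mY ne]].
  by rewrite /mid cY ne (covers_capC cY cH ne).1.
have mH : mid X V H by rewrite /mid cX.
have [_ ->] := andP mY.
by rewrite ne (mid_neq_cap mH mY ne) PX eqxx.
Qed.

Lemma sum_mid_neq (A : zmodType) (phi : seq T -> A) s t X V H : steinberg phi -> mid X V H ->
  \sum_(Y | mid X V Y && (Y != H)) phi (s ++ [:: V, Y, X & t]) = - phi (s ++ [:: V, H, X & t]).
Proof.
move=> st mH; have := st s t _ _ (mid_rank2 mH); rewrite (bigD1 H) //= => /eqP.
by rewrite addrC addr_eq0 => /eqP.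
Qed.

(** The next member [Z] of the flag contributes [q^(\dim Z)]. The other hyperplanes, grouped by
    their trace on [Z], collapse by (FS) to the same sum one dimension lower; its sign cancels the
    one in [up], and [[d+1] = [d] + q^d]. *)
Lemma sum_up_restr (phi : seq T -> int) t : steinberg phi -> down_flag t ->
  let V := head 0%VS t in
  \sum_(Y | covers Y V) up Y (fun s => phi (V :: s)) t = phi t *+ qint (\dim V).
Proof.
elim: t phi => [//|V [|Z t] IH] phi st df /=.
  move: df; rewrite down_flag1 => /eqP ->; rewrite big_pred0; last exact: covers_zero.
  by rewrite dimv0 /qint big_ord0.
move: df; rewrite down_flag_cons => /andP[cZ df].
rewrite (bigD1 Z) //= up_cons eqxx (covers_dim cZ) qintS mulrnDr addrC; congr (_ + _).
rewrite -(IH _ (steinberg_restr V st) df) /=.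
have -> : \sum_(Y | covers Y V && (Y != Z)) up Y (fun s => phi (V :: s)) [:: V, Z & t] =
  \sum_(Y | covers Y V && (Y != Z) && predT (Y :&: Z)%VS)
    - up (Y :&: Z)%VS (fun s => phi [:: V, Y & s]) (Z :: t).
  apply: eq_big => [Y|Y /andP[_ ne]]; first by rewrite andbT.
  by rewrite up_cons eq_sym (negbTE ne) capvC.
rewrite (sum_hyper_trace predT (fun Y X => - up X (fun s => phi [:: V, Y & s]) (Z :: t)) cZ).
apply: eq_big => [X|X /andP[cX _]]; first by rewrite andbT.
rewrite sumrN up_sum -[RHS]opprK; congr (- _).
rewrite -mulrN1 -upMz; apply: eq_up => s.
by rewrite mulrN1 (sum_mid_neq [::]) // /mid cX.
Qed.

Lemma up_linsum (I : Type) (r : seq I) V (a : I -> int) (f : I -> seq T -> int) t :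
  \sum_(i <- r) a i * up V (f i) t = up V (fun s => \sum_(i <- r) a i * f i s) t.
Proof.
rewrite -up_sum; apply: eq_bigr => i _; rewrite mulrC -upMz.
by apply: eq_up => s; rewrite mulrC.
Qed.

(** The source of the number of flags in [toSt (toD z)]. Since [up] is linear, induction below each
    hyperplane produces [[d]!], and [sum_up_restr] supplies the last factor [[d+1]]. *)
Lemma sum_flags_Phi (phi : seq T -> int) s : steinberg phi -> down_flag s ->
  let V := head 0%VS s in
  \sum_(t <- flags (\dim V) V) phi t * Phi (cls t) s = phi s *+ qfact (\dim V).
Proof.
have stv := @vac_steinberg F n; have ffv := @vac_flag_fun F n.
have key d : forall V, \dim V = d -> forall phi s, steinberg phi -> down_flag s ->
    head 0%VS s = V ->
    \sum_(t <- flags d V) phi t * pact t (@vac F n) s = phi s *+ qfact d.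
  elim: d => [|d IH] V dV {}phi {}s st ds hs.
    have V0 : V = 0%VS by apply/eqP; rewrite -dimv_eq0 dV.
    have e : s = [:: 0%VS].
      have := down_flag_size ds; rewrite hs dV; case: s ds hs => [|X [|]] //= _ -> _.
      by rewrite V0.
    by rewrite /= V0 eqxx big_seq1 e /= eqxx /vac eqxx mulr1 /qfact big_ord0.
  rewrite sum_flagsS qfactS mulrnA -dV -hs -sum_up_restr //= hs -sumrMnl.
  apply: eq_bigr => Y cY.
  have dY : \dim Y = d by have := covers_dim cY; rewrite dV => -[].
  rewrite big_seq (eq_bigr (fun t => phi (V :: t) * up Y (pact t (@vac F n)) s)); last first.
    move=> t; rewrite mem_flags => /and3P[dt /eqP ht _]; congr (_ * _).
    case: t dt ht => // X t dt /= ht; subst X.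
    by rewrite /step ds hs eqxx /= (covers_asym cY) cY.
  rewrite -big_seq up_linsum -mulr_natr -upMz.
  apply: eq_up_flag => [|//|u du]; first by rewrite hs.
  by rewrite (IH Y dY _ _ (steinberg_restr V st) du) // mulr_natr.
move=> st ds V; rewrite -(key _ V) // big_seq [RHS]big_seq; apply: eq_bigr => t.
rewrite mem_flags => /and3P[dt _ _].
by rewrite /Phi actS_cls // down_flag_fpath.
Qed.

Lemma ex_hyper V : V != 0%VS -> exists Z, covers Z V.
Proof.
move=> V0; exists (V :\: <[vpick V]>)%VS; rewrite /covers diffvSl /=.
have := dimv_cap_compl V <[vpick V]>.
have -> : (V :&: <[vpick V]>)%VS = <[vpick V]>%VS.
  by apply/capv_idPr; rewrite -memvE memv_pick.
by rewrite dim_vline vpick0 V0 add1n => <-.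
Qed.

(** Fix one hyperplane [H]; each hyperplane of [H] is the trace of exactly [q] others, whence [[d+1]
    = 1 + q [d]]. *)
Lemma card_hyper V : #|[pred Y | covers Y V]| = qint (\dim V).
Proof.
move E : (\dim V) => d; elim: d V E => [|d IH] V E.
  have -> : V = 0%VS by apply/eqP; rewrite -dimv_eq0 E.
  by rewrite /qint big_ord0; apply: eq_card0 => Y; rewrite !inE covers_zero.
have [|H cH] := @ex_hyper V; first by rewrite -dimv_eq0 E.
have dH : \dim H = d by have := covers_dim cH; rewrite E => -[].
rewrite -sum1_card (bigD1 H) //= qintS'; congr (_ + _)%N.
have -> : \sum_(Y | covers Y V && (Y != H)) 1%N =
  \sum_(Y | covers Y V && (Y != H) && predT (Y :&: H)%VS) 1%N.
  by apply: eq_bigl => Y; rewrite andbT.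
rewrite (sum_hyper_trace predT (fun _ _ => 1%N) cH).
rewrite -(IH H dH) mulnC -sum_nat_const; apply: eq_big => [X|X /andP[cX _]].
  by rewrite andbT.
have mH : mid X V H by rewrite /mid cX.
have := card_mid (mid_rank2 mH); rewrite -sum1_card (bigD1 H) //=.
by rewrite add1n => -[].
Qed.

Lemma size_flags V : size (flags (\dim V) V) = qfact (\dim V).
Proof.
move E : (\dim V) => d; elim: d V E => [|d IH] V E.
  have -> : V = 0%VS by apply/eqP; rewrite -dimv_eq0 E.
  by rewrite /= eqxx /qfact big_ord0.
rewrite -sum1_size sum_flagsS qfactS -E -card_hyper -sum_nat_const; apply: eq_bigr => Y cY.
by rewrite sum1_size IH //; have := covers_dim cY; rewrite E => -[].
Qed.

Lemma qfact_gt0 d : (0 < qfact d)%N.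
Proof. by rewrite /qfact prodn_gt0 // => i; rewrite qintS'. Qed.

Definition top_flags := flags n.+1 (fullv : T).

Lemma dim_fullv : \dim (fullv : T) = n.+1.
Proof. by rewrite dimvf /dim /= muln1. Qed.

Lemma mem_top_flags t : (t \in top_flags) = down_flag t && (head 0%VS t == fullv).
Proof. by rewrite /top_flags -mem_flags_dim dim_fullv. Qed.

Lemma head_rev (x : T) s : head x (rev s) = last x s.
Proof. by case/lastP: s => // s y; rewrite rev_rcons last_rcons. Qed.

Lemma full_flag_rev s : s != [::] -> full_flag s = down_flag (rev s) && (head 0%VS (rev s) == fullv).
Proof.
move=> s0; rewrite /full_flag /down_flag head_rev -size_eq0 size_rev size_eq0 s0 rev_sorted /=.
rewrite -andbA; congr (_ && _).
by rewrite -(head_rev _ (rev s)) revK; case: s s0.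
Qed.

Lemma nb_full_flagsE : nb_full_flags F n = qfact n.+1.
Proof.
rewrite -dim_fullv -size_flags dim_fullv -/top_flags /nb_full_flags cardE.
rewrite -(size_map (fun t : n.+2.-tuple T => rev t)); apply/perm_size/uniq_perm.
- by rewrite map_inj_uniq ?enum_uniq // => t u /(can_inj revK) /val_inj.
- exact: flags_uniq.
move=> t; rewrite mem_top_flags; apply/mapP/idP => [[u]|/andP[dt /eqP ht]].
  rewrite mem_enum inE => fu ->; rewrite -full_flag_rev //.
  by rewrite -size_eq0 size_tuple.
have st : size (rev t) == n.+2 by rewrite size_rev (down_flag_size dt) ht dim_fullv.
exists (Tuple st); rewrite /= ?revK // mem_enum inE /= full_flag_rev ?revK ?dt ?ht ?eqxx //.
by rewrite -size_eq0 size_rev (down_flag_size dt).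
Qed.

(** * Straightening into opposite flags *)

Section Opposite.
Variable A : zmodType.
Implicit Types phi : seq T -> A.

(** [N] stands for a subgroup of values. If [L] is inside the second member [Y], induction first
    makes the third member [Z] avoid [L]; (FS) then trades [Y] for the rest of its pencil, and none
    of these contains [L], as two members meet in [Z]. *)
Lemma steinberg_line_ind (N : A -> Prop) phi L t :
  N 0 -> (forall x y, N x -> N y -> N (x - y)) -> steinberg phi ->
  covers 0%VS L -> down_flag t -> (L <= head 0%VS t)%VS ->
  (forall V Y t', V = head 0%VS t -> down_flag [:: V, Y & t'] -> ~~ (L <= Y)%VS ->
     N (phi [:: V, Y & t'])) ->
  N (phi t).
Proof.
move=> N0 NB st cL; elim: t phi st => [//|V [|Y t] IH] phi st dt LV h.
  move: dt LV; rewrite down_flag1 => /eqP -> /=; rewrite subv0 => /eqP L0.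
  by move: cL; rewrite L0 covers_zero.
have [LY|nLY] := boolP (L <= Y)%VS; last exact: h.
move: (dt); rewrite down_flag_cons => /andP[cY dY].
apply: (IH (fun s => phi (V :: s))) => //; first exact: steinberg_restr.
move=> _ Z u /= -> dZ nLZ; move: (dZ); rewrite down_flag_cons => /andP[cZ du].
have mY : mid Z V Y by rewrite /mid cZ.
rewrite -[phi _]opprK -(sum_mid_neq [::] u st mY) -sub0r; apply: (NB) => //.
apply: (big_ind N) => // [x y Nx Ny|Y' /andP[mY' ne]].
  by rewrite -[y]opprK; apply: (NB) => //; rewrite -sub0r; apply: NB.
have [c1 c2] := andP mY'.
apply: h => //; first by rewrite !down_flag_cons c1 c2.
apply: contra nLZ => LY'; rewrite -(mid_neq_cap mY mY' ne) subv_cap LY' LY //.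
Qed.

(** Here [t] descends while [D] ascends, so for full flags of the whole space the entries in the
    same place have complementary dimensions. *)
Definition opposite D t := all2 (fun V W : T => (V :&: W)%VS == 0%VS) t D.

Definition relframe V D := [&& sorted (@covers F n) D, size D == (\dim V).+1,
  (V :&: head 0%VS D)%VS == 0%VS & (V <= last 0%VS D)%VS].

Lemma path_covers_last W D : path (@covers F n) W D ->
  (W <= last W D)%VS /\ \dim (last W D) = (\dim W + size D)%N.
Proof.
elim: D W => [|X D IH] W /=; first by rewrite subvv addn0.
move=> /andP[c /IH[s ->]]; rewrite (subv_trans (covers_sub c) s) (covers_dim c).
by split=> //; lia.
Qed.

Lemma relframe_line V W X D : relframe V [:: W, X & D] -> covers 0%VS (V :&: X)%VS.
Proof.
case/and4P=> /= /andP[c p] /eqP[sD] /eqP VW Vl.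
have [s d] := path_covers_last p.
rewrite /covers sub0v dimv0 /=.
have d1 := dimv_sum_cap V X; have d2 := covers_dim c.
have s1 : (V + X <= last X D)%VS by rewrite subv_add Vl s.
have l1 := dimvS s1.
have d3 := dimv_sum_cap (V :&: X) W.
have e0 : ((V :&: X) :&: W = 0)%VS.
  by apply/eqP; rewrite -subv0 -VW; apply: capvS (capvSl _ _) (subvv _).
have s2 : (V :&: X + W <= X)%VS by rewrite subv_add capvSr (covers_sub c).
have l2 := dimvS s2; rewrite e0 dimv0 in d3.
apply/eqP; lia.
Qed.

Lemma relframe_cons V W X D Y : relframe V [:: W, X & D] -> covers Y V ->
  (Y :&: X)%VS = 0%VS -> relframe Y (X :: D).
Proof.
case/and4P=> /= /andP[c p] /eqP[sD] /eqP VW Vl cY e.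
rewrite /relframe /= p e eqxx (subv_trans (covers_sub cY) Vl) sD (covers_dim cY).
by rewrite eqxx.
Qed.

Lemma line_cap L V : covers 0%VS L -> ~~ (L <= V)%VS -> (V :&: L)%VS = 0%VS.
Proof.
move=> cL nL; apply/eqP; rewrite -dimv_eq0.
have := covers_dim cL; rewrite dimv0 => dL.
have := dimv_leqif_eq (capvSr V L); have := dimvS (capvSr V L).
have : (V :&: L)%VS != L by apply: contra nL => /eqP <-; apply: capvSl.
rewrite dL; move=> ne l [_]; rewrite (negbTE ne) => /eqP; lia.
Qed.

(** The second entry [X] of the chain cuts [V] in a line. Once the next member [Y] of the flag
    avoids that line, it meets [X] trivially, and the shortened chain is a frame for [Y]. *)
Lemma opposite_ind (N : A -> Prop) phi V D t :
  N 0 -> (forall x y, N x -> N y -> N (x - y)) -> steinberg phi -> relframe V D ->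
  (forall u, down_flag u -> head 0%VS u = V -> opposite D u -> N (phi u)) ->
  down_flag t -> head 0%VS t = V -> N (phi t).
Proof.
move=> N0 NB; elim: D V phi t => [|W [|X D] IH] V phi t st rf h dt ht.
- by case/and4P: rf.
- case/and4P: rf => _ /= sD VW _.
  have dV : \dim V = 0 by lia.
  have V0 : V = 0%VS by apply/eqP; rewrite -dimv_eq0 dV.
  apply: h => //; have := down_flag_size dt; rewrite ht dV.
  case: t dt ht => [|Y [|]] //= _ -> _; by rewrite /opposite /= V0 cap0v eqxx.
have cL := relframe_line rf.
apply: (steinberg_line_ind N0 NB st cL dt); first by rewrite ht capvSl.
move=> V' Y u; rewrite ht => -> {V'} du nL.
move: (du); rewrite down_flag_cons => /andP[cY dY].
have YX : (Y :&: X)%VS = 0%VS.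
  have := line_cap cL nL; rewrite capvA; congr (_ = _).
  by rewrite (capv_idPl (covers_sub cY)).
apply: (IH Y (fun s => phi (V :: s))) => //; first exact: steinberg_restr.
  exact: relframe_cons rf cY YX.
move=> v dv hv ov; apply: h => //=.
  by case: v dv hv {ov} => // Z v dv /= hv; rewrite down_flag_cons hv cY -hv.
by case/and4P: rf => _ _ /= -> _.
Qed.

End Opposite.
End Flags.

(** * Signed sums over opposite flags *)

Section OppositeSum.
Variables (F : finFieldType) (n : nat).
Local Notation T := {vspace 'cV[F]_n.+1}.
Variable A : zmodType.
Implicit Types (C V W X Y Z L H : T) (s t D E : seq T).
Implicit Types phi : seq T -> A.

Lemma last_sub V E : down_flag (V :: rcons E 0%VS) -> (last V E <= V)%VS.
Proof.
elim: E V => [|W E IH] V /=; first by rewrite subvv.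
rewrite down_flag_cons => /andP[c /IH h]; exact: subv_trans h (covers_sub c).
Qed.

Lemma mem_sub V E W : down_flag (V :: E) -> W \in V :: E -> (W <= V)%VS.
Proof.
elim: E V => [|X E IH] V; first by rewrite inE => _ /eqP ->; apply: subvv.
rewrite down_flag_cons => /andP[c dX]; rewrite inE => /orP[/eqP ->|h]; first exact: subvv.
exact: subv_trans (IH _ dX h) (covers_sub c).
Qed.

(** [last V E] is the smallest non-zero member of the flag. Each level groups the hyperplanes by
    their trace on the next member [H], and (FS) replaces them by [H] itself with one sign, hence
    [size E] signs in all. *)
Lemma hyper_sum phi V E : steinberg phi -> down_flag (V :: rcons E 0%VS) ->
  \sum_(Y | covers Y V && ~~ (last V E <= Y)%VS) phi [:: V, Y & map (fun W => Y :&: W)%VS E]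
  = phi (V :: rcons E 0%VS) *~ (-1) ^+ size E.
Proof.
elim: E V phi => [|H E IH] V phi st /=.
  rewrite down_flag_cons => /andP[c _]; rewrite expr0 mulr1z.
  rewrite (big_pred1 0%VS) // => Y; apply/andP/eqP => [[cY _]|->]; last first.
    by rewrite c subv0 -dimv_eq0 (covers_dim c).
  have := covers_dim c; rewrite (covers_dim cY) dimv0 => -[] /eqP.
  by rewrite dimv_eq0 => /eqP.
rewrite down_flag_cons => /andP[cH dH].
set L := last H E; have LH : (L <= H)%VS by apply: last_sub.
(* As [L] lies in [H], avoiding [L] forces [Y != H] and can be tested on the trace [Y :&: H]. *)
have -> : \sum_(Y | covers Y V && ~~ (L <= Y)%VS)
    phi [:: V, Y, (Y :&: H)%VS & map (fun W => Y :&: W)%VS E] =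
  \sum_(Y | covers Y V && (Y != H) && ~~ (L <= Y :&: H)%VS)
    phi [:: V, Y, (Y :&: H)%VS & map (fun W => (Y :&: H) :&: W)%VS E].
  apply: eq_big => [Y|Y _].
    rewrite subv_cap LH andbT -andbA; congr (_ && _).
    by case: eqVneq => [->|//]; rewrite LH.
  congr (phi [:: _, _, _ & _]); apply/eq_in_map => W WE; rewrite -capvA; congr (_ :&: _)%VS.
  apply/esym/capv_idPr; apply: mem_sub dH _.
  by rewrite inE mem_rcons inE WE !orbT.
rewrite (sum_hyper_trace (fun X => ~~ (L <= X)%VS)
  (fun Y X => phi [:: V, Y, X & map (fun W => X :&: W)%VS E]) cH).
have := IH H _ (steinberg_restr V st) dH; rewrite -/L exprS mulN1r mulrNz => <-.
rewrite -sumrN; apply: eq_bigr => X /andP[cX _].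
by rewrite (sum_mid_neq [::]) // /mid cX.
Qed.

(** Each step of the chain raises the dimension of the trace by at most one; if the total rise is
    maximal, no step is lost. *)
Lemma path_cap V W D : path (@covers F n) W D ->
  (\dim (V :&: last W D) <= \dim (V :&: W) + size D)%N /\
  (\dim (V :&: last W D) = (\dim (V :&: W) + size D)%N ->
   path (@covers F n) (V :&: W)%VS (map (fun X => V :&: X)%VS D)).
Proof.
elim: D W => [|X D IH] W /=; first by rewrite addn0.
move=> /andP[c p]; have [le eq] := IH X p.
have h : covers (V :&: W) (V :&: X) \/ (V :&: X)%VS = (V :&: W)%VS.
  have [s|ns] := boolP (V :&: X <= W)%VS.
    right; apply/eqP; rewrite eqEsubv subv_cap capvSl s /=.
    exact: capvS (subvv _) (covers_sub c).
  left; have := covers_cap c (capvSr V X) ns.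
  by rewrite -capvA (capv_idPr (covers_sub c)).
case: h => [h|e]; last first.
  rewrite -e; split; first by apply: leq_trans le _; lia.
  move=> E; move: le; rewrite E; lia.
rewrite h /=; have dh := covers_dim h; split; first by rewrite dh in le; lia.
by move=> E; apply: eq; rewrite E dh; lia.
Qed.

Lemma relframe_flag V D : relframe V D -> down_flag (map (fun X => V :&: X)%VS (rev D)).
Proof.
case: D => [|W D] rf; first by case/and4P: rf.
have [/= p /eqP[sD] /eqP VW Vl] := and4P rf.
have [_ h] := path_cap V p.
rewrite map_rev /down_flag rev_sorted -size_eq0 size_rev -head_rev seq.revK /=.
by rewrite VW eqxx andbT -VW; apply: h; rewrite VW dimv0 (capv_idPl Vl) sD.
Qed.

Lemma mulrz_sum (I : Type) (r : seq I) (P : pred I) (f : I -> A) (m : int) :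
  (\sum_(i <- r | P i) f i) *~ m = \sum_(i <- r | P i) f i *~ m.
Proof. exact: (big_morph (fun x => x *~ m) (fun x y => mulrzDl m x y) (mul0rz _ m)). Qed.

(** Equal to [d (d - 1) / 2], the length of the longest permutation of [d] letters. *)
Definition tri d : nat := (\sum_(i < d) i)%N.

Lemma relframe_split V W X D : relframe V [:: W, X & D] ->
  exists E, [/\ map (fun Z => V :&: Z)%VS (rev [:: W, X & D]) = V :: rcons E 0%VS,
    last V E = (V :&: X)%VS, size E = size D &
    forall Y, covers Y V ->
      map (fun Z => Y :&: Z)%VS (rev (X :: D)) = Y :: map (fun Z => Y :&: Z)%VS E].
Proof.
move=> rf; have [_ _ /= /eqP VW Vl] := and4P rf.
have revE : rev (X :: D) = last X D :: behead (rev (X :: D)).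
  by have := head_rev X (X :: D); have := size_rev (X :: D); case: (rev _) => //= Z u _ ->.
exists (map (fun Z => V :&: Z)%VS (behead (rev (X :: D)))); split.
- by rewrite rev_cons revE map_rcons /= VW (capv_idPl Vl).
- case/lastP: D {rf revE} Vl => [|D Z] /= Vl; first by rewrite (capv_idPl Vl).
  by rewrite -rcons_cons rev_rcons /= rev_cons map_rcons last_rcons.
- by rewrite size_map size_behead size_rev.
move=> Y cY; rewrite revE /= (capv_idPl (subv_trans (covers_sub cY) Vl)) -map_comp.
congr (_ :: _); apply: eq_map => Z /=.
by rewrite capvA (capv_idPl (covers_sub cY)).
Qed.

Lemma line_trace V X Y : covers 0%VS (V :&: X)%VS -> covers Y V ->
  (V :&: X <= Y)%VS = ((Y :&: X)%VS != 0%VS).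
Proof.
move=> cL cY.
have YX : (Y :&: (V :&: X) = Y :&: X)%VS by rewrite capvA (capv_idPl (covers_sub cY)).
have [L|nL] := boolP (V :&: X <= Y)%VS; last by rewrite -YX line_cap ?eqxx.
rewrite -YX; have -> : (Y :&: (V :&: X))%VS = (V :&: X)%VS by apply/capv_idPr.
by rewrite -dimv_eq0 (covers_dim cL) dimv0.
Qed.

Lemma relframe1 V W : relframe V [:: W] -> V = 0%VS.
Proof. by case/and4P=> _ /= sD _ _; apply/eqP; rewrite -dimv_eq0; lia. Qed.

Lemma relframe_size V W X D : relframe V [:: W, X & D] -> \dim V = (size D).+1.
Proof. by case/and4P => _ /= /eqP[->]. Qed.

(** An opposite flag starts with [V] and a hyperplane [Y] avoiding the line [V :&: X], and continues
    by a flag opposite to the shortened chain. Induction evaluates the inner sum at the traces on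
    [Y], and [hyper_sum] evaluates the outer one. *)
Lemma opposite_sum phi V D : steinberg phi -> relframe V D ->
  \sum_(t <- flags (\dim V) V | opposite D t) phi t =
  phi (map (fun X => V :&: X)%VS (rev D)) *~ (-1) ^+ tri (\dim V).
Proof.
elim: D V phi => [|W [|X D] IH] V phi st rf.
- by case/and4P: rf.
- rewrite (relframe1 rf) dimv0 /= eqxx big_cons big_nil /opposite /= cap0v eqxx /= addr0.
  by rewrite /tri big_ord0 expr0 mulr1z.
have cL := relframe_line rf; have fl := relframe_flag rf; have dVD := relframe_size rf.
have [E [mapE lE sE capE]] := relframe_split rf; rewrite mapE in fl *.
have [_ _ /= VW _] := and4P rf.
rewrite dVD big_mkcond sum_flagsS.
transitivity (\sum_(Y | covers Y V && ~~ (last V E <= Y)%VS)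
   phi [:: V, Y & map (fun W => Y :&: W)%VS E] *~ (-1) ^+ tri (size D)); last first.
  rewrite -mulrz_sum hyper_sum // -mulrzA sE; congr (_ *~ _).
  by rewrite /tri big_ord_recr /= exprD mulrC.
rewrite [RHS]big_mkcond [LHS]big_mkcond; apply: eq_bigr => Y _.
case: (boolP (covers Y V)) => //= cY; rewrite lE line_trace // negbK.
have [YX|YX] := eqVneq (Y :&: X)%VS 0%VS; last first.
  rewrite big_seq big1 // => t; rewrite mem_flags => /and3P[_ /eqP ht _].
  by case: t ht => [_|Z t /= ->]; rewrite /opposite /= ?(negbTE YX) andbF.
have dY : \dim Y = size D by have := covers_dim cY; rewrite dVD => -[].
have := IH Y _ (steinberg_restr V st) (relframe_cons rf cY YX); rewrite dY capE //= => <-.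
rewrite [RHS]big_mkcond; apply: eq_bigr => t _.
by rewrite /opposite /= VW.
Qed.

End OppositeSum.

Section OppositePhi.
Variables (F : finFieldType) (n : nat).
Local Notation T := {vspace 'cV[F]_n.+1}.
Implicit Types (V W X Y Z L H : T) (s t D E : seq T).

(** The climb from [Z] to [V] is pushed through the flag by the second wedge relation, one sign per
    member of [E], leaving the traces on [Z]. That [Z] avoids the line of the flag keeps the first
    wedge relation away until the end. *)
Lemma cls_restrict V Z E : down_flag (V :: rcons E 0%VS) -> covers Z V ->
  ~~ (last V E <= Z)%VS ->
  down_flag (Z :: map (fun W => Z :&: W)%VS E) /\
  cls [:: Z; V] * cls (V :: rcons E 0%VS) =
  cls (Z :: map (fun W => Z :&: W)%VS E) *~ (-1) ^+ size E.
Proof.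
elim: E V Z => [|H E IH] V Z /=.
  rewrite down_flag_cons => /andP[c _] cZ _.
  have -> : Z = 0%VS.
    have := covers_dim c; rewrite (covers_dim cZ) dimv0 => -[] /eqP.
    by rewrite dimv_eq0 => /eqP.
  split; first by rewrite down_flag1 eqxx.
  (* Here [Z = 0], so the coefficient [q^(\dim Z)] is 1 and no power of [q] survives. *)
  rewrite clsM ?is_fpath2 ?c ?orbT //= eqxx cls_wedge_eq // dimv0 expn0 expr0.
  by rewrite mulr1n mulr1z.
rewrite down_flag_cons => /andP[cH dH] cZ nL.
have LH := last_sub dH.
have ne : Z != H by apply: contraNneq nL => ->.
have [c1 c2] := covers_capC cZ cH ne.
have fH := down_flag_fpath dH.
have [|dE eE] := IH H _ dH c2; first by rewrite subv_cap negb_and nL.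
have e : map (fun W => (Z :&: H) :&: W)%VS E = map (fun W => Z :&: W)%VS E.
  apply/eq_in_map => W WE; rewrite -capvA; congr (_ :&: _)%VS; apply/capv_idPr.
  by apply: (mem_sub dH); rewrite inE mem_rcons inE WE !orbT.
rewrite e in dE eE; split; first by rewrite down_flag_cons c1.
have -> : cls [:: Z; V] * cls [:: V, H & rcons E 0%VS] =
    cls [:: Z; V; H] * cls (H :: rcons E 0%VS).
  rewrite !clsM ?is_fpath2 ?is_fpath3 ?cZ ?cH ?orbT //= ?eqxx //.
  by apply: down_flag_fpath; rewrite down_flag_cons cH.
rewrite cls_wedge_neq // mulNr.
have -> : cls [:: Z; (Z :&: H)%VS; H] = cls [:: Z; (Z :&: H)%VS] * cls [:: (Z :&: H)%VS; H].
  by rewrite clsM ?is_fpath2 ?c1 ?c2 ?orbT //= eqxx.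
rewrite -mulrA eE mulrzAr exprS mulN1r mulrNz; congr (- (_ *~ _)).
by rewrite clsM ?is_fpath2 ?c1 ?orbT ?down_flag_fpath //= eqxx.
Qed.

(** Stripping the head of [t] multiplies the class by a climb, which [cls_restrict] turns into the
    trace flag of the hyperplane; the signs add up to [tri]. *)
Lemma opposite_Phi V D t : relframe V D -> down_flag t -> head 0%VS t = V ->
  opposite D t -> Phi (cls (map (fun X => V :&: X)%VS (rev D))) t = (-1) ^+ tri (\dim V).
Proof.
elim: D V t => [|W [|X D] IH] V t rf dt ht ot.
- by case/and4P: rf.
- have V0 := relframe1 rf; have := down_flag_size dt; rewrite ht V0 dimv0.
  case: t dt ht ot => [|Y [|]] //= _ -> _ _.
  by rewrite V0 cap0v Phi_zero /tri big_ord0.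
have cL := relframe_line rf; have fl := relframe_flag rf; have dVD := relframe_size rf.
have [E [mapE lE sE capE]] := relframe_split rf; rewrite mapE in fl *.
case: t dt ht ot => [//|V' [|Z t]] dt /= ht ot; subst V'.
  by move: dt; rewrite down_flag1 -dimv_eq0 dVD.
move: dt; rewrite down_flag_cons => /andP[cZ dt].
have [_ /andP[ZX ot']] := andP ot.
have nL : ~~ (last V E <= Z)%VS by rewrite lE line_trace // negbK.
have [_ e] := cls_restrict fl cZ nL.
have st := @Phi_steinberg F n (cls (V :: rcons E 0%VS)).
have ff := @Phi_flag_fun F n (cls (V :: rcons E 0%VS)).
have -> : Phi (cls (V :: rcons E 0%VS)) [:: V, Z & t] =
    Phi (cls [:: Z; V] * cls (V :: rcons E 0%VS)) (Z :: t).
  rewrite Phi_mul actS_cls ?is_fpath2 ?cZ // act_cons /step dt /= eqxx cZ eqxx //.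
rewrite e -scaler_int PhiZ intz -capE //; have dZ : \dim Z = size D.
  by have := covers_dim cZ; rewrite dVD => -[].
rewrite IH //=; last 2 first.
- exact: (relframe_cons rf cZ (eqP ZX)).
- by rewrite ZX.
by rewrite dVD dZ sE /tri big_ord_recr /= exprD mulrC.
Qed.

End OppositePhi.

(** * The standard flag and the unitriangular group *)

Section StandardFlag.
Variables (F : finFieldType) (n : nat).
Local Notation T := {vspace 'cV[F]_n.+1}.
Local Notation G := {'GL_n.+1[F]}.
Implicit Types (C V W X Y Z L H : T) (s t D E : seq T).
Implicit Types (g h u : G) (v : 'cV[F]_n.+1).

Definition coord_mx (i : nat) : 'M[F]_n.+1 := \matrix_(a, b) ((a == b) && (i <= a)%N)%:R.

(** The span of the first [i] basis vectors, taken as a kernel so that membership is the vanishing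
    of the coordinates from [i] on, for every natural [i]. *)
Definition stdsub (i : nat) : T := lker (linfun (mulmx (coord_mx i))).

Lemma mem_stdsub i v : reflect (forall j : 'I_n.+1, (i <= j)%N -> v j 0 = 0) (v \in stdsub i).
Proof.
rewrite memv_ker lfunE /=.
have E j : (coord_mx i *m v) j 0 = (i <= j)%:R * v j 0.
  rewrite mxE (bigD1 j) //= mxE eqxx big1 ?addr0 // => b nb.
  by rewrite mxE eq_sym (negbTE nb) mul0r.
apply: (iffP eqP) => [h j ij|h].
  by have := E j; rewrite h mxE ij mul1r.
apply/matrixP => j z; rewrite ord1 E mxE.
by case: leqP => ij; rewrite ?mul0r // h // mulr0.
Qed.

Lemma stdsub0 : stdsub 0 = 0%VS.
Proof.
apply/vspaceP => v; rewrite memv0; apply/mem_stdsub/eqP => [h|-> j _]; last by rewrite mxE.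
by apply/matrixP => j z; rewrite ord1 h // mxE.
Qed.

Lemma stdsub_full i : (n < i)%N -> stdsub i = fullv.
Proof.
move=> ni; apply/vspaceP => v; rewrite memvf; apply/mem_stdsub => j ij.
by have := ltn_ord j; lia.
Qed.

Definition basis_vec (j : 'I_n.+1) : 'cV[F]_n.+1 := delta_mx j 0.

Lemma basis_vecE j k : basis_vec j k 0 = (k == j)%:R.
Proof. by rewrite mxE andbT. Qed.

Lemma basis_vec_in j i : (basis_vec j \in stdsub i) = (j < i)%N.
Proof.
apply/mem_stdsub/idP => [h|ji k ik].
  rewrite ltnNge; apply/negP => /h; rewrite basis_vecE eqxx => /eqP.
  by rewrite oner_eq0.
rewrite basis_vecE; case: eqP => // kj; move: ik; rewrite kj; lia.
Qed.

Lemma stdsubS (i : 'I_n.+1) : stdsub i.+1 = (stdsub i + <[basis_vec i]>)%VS.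
Proof.
apply/eqP; rewrite eqEsubv subv_add -memvE basis_vec_in ltnSn andbT; apply/andP; split.
  apply/subvP => v /mem_stdsub h.
  rewrite -[v](subrK (v i 0 *: basis_vec i)); apply: memv_add; last exact: memvZ (memv_line _).
  apply/mem_stdsub => j ij; rewrite !mxE andbT.
  case: eqP => [->|/eqP ne]; first by rewrite mulr1 subrr.
  rewrite mulr0 subr0; apply: h; rewrite ltn_neqAle ij andbT eq_sym.
  by apply: contra ne => /eqP e; apply/eqP/val_inj.
by apply/subvP => v /mem_stdsub h; apply/mem_stdsub => j ij; apply: h; apply: ltnW.
Qed.

Lemma stdsub_covers i : (i <= n)%N -> covers (stdsub i) (stdsub i.+1).
Proof.
rewrite -ltnS => ni; rewrite (stdsubS (Ordinal ni)).
by apply: covers_line; rewrite (basis_vec_in (Ordinal ni)) ltnn.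
Qed.

Lemma stdsub_dim i : (i <= n.+1)%N -> \dim (stdsub i) = i.
Proof.
elim: i => [|i IH] ni; first by rewrite stdsub0 dimv0.
by rewrite (covers_dim (stdsub_covers ni)) IH // ltnW.
Qed.

Definition std_up : seq T := map stdsub (iota 0 n.+2).
Definition std : seq T := rev std_up.

Lemma std_up_sorted : sorted (@covers F n) std_up.
Proof.
rewrite /std_up; suff h m i : (i + m <= n.+1)%N ->
    path (@covers F n) (stdsub i) (map stdsub (iota i.+1 m)) by apply: (h n.+1 0).
elim: m i => [//|m IH] i im /=; rewrite stdsub_covers /=; last by lia.
by apply: IH; lia.
Qed.

Lemma std_up_last : last 0%VS std_up = fullv.
Proof.
have e : iota 0 n.+2 = iota 0 n.+1 ++ [:: n.+1] by rewrite -[n.+2]addn1 iotaD.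
by rewrite /std_up e map_cat last_cat /= stdsub_full.
Qed.

Lemma std_head : head 0%VS std = fullv.
Proof. by rewrite head_rev std_up_last. Qed.

Lemma std_flag : down_flag std.
Proof.
rewrite /down_flag /std rev_sorted std_up_sorted -head_rev seq.revK /= stdsub0 eqxx andbT.
by rewrite -size_eq0 size_rev.
Qed.

Lemma std_size : size std = n.+2. Proof. by rewrite size_rev size_map size_iota. Qed.

Lemma std_nth i : (i <= n.+1)%N -> nth 0%VS std i = stdsub (n.+1 - i).
Proof.
move=> ni; rewrite /std nth_rev size_map size_iota // (nth_map 0%N) ?size_iota; last by lia.
by rewrite nth_iota ?add0n ?subSS //; lia.
Qed.

Definition moved g : seq T := map (GL_subspace g) std.

Lemma movedM g h : moved (g * h)%g = map (GL_subspace g) (moved h).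
Proof. exact: GL_mapM. Qed.

Lemma moved1 : moved 1%g = std.
Proof. by rewrite /moved -[RHS]map_id; apply: eq_map => V; apply: GL_subspace1. Qed.

Lemma moved_flag g : down_flag (moved g).
Proof. by rewrite GL_down_flag std_flag. Qed.

Lemma moved_head g : head 0%VS (moved g) = fullv.
Proof.
by rewrite /moved -nth0 (nth_map 0%VS) ?std_size // nth0 std_head GL_subspacef.
Qed.

Lemma moved_top g : moved g \in top_flags F n.
Proof. by rewrite mem_top_flags moved_flag moved_head eqxx. Qed.

Lemma moved_nth g i : (i <= n.+1)%N -> nth 0%VS (moved g) i = GL_subspace g (stdsub (n.+1 - i)).
Proof. by move=> ni; rewrite (nth_map 0%VS) ?std_size // std_nth. Qed.

Lemma moved_std_upper g : moved g = std <-> upper_tri (GLval g).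
Proof.
split=> [e|/forallP h].
  apply/forallP => i; apply/forallP => j; apply/implyP => ji.
  have := ltn_ord j; have lj : (n - j <= n.+1)%N by lia.
  have := moved_nth g lj; rewrite e (std_nth lj).
  rewrite (_ : (n.+1 - (n - j) = j.+1)%N) => [e' _|]; last by have := ltn_ord j; lia.
  have : GLval g *m basis_vec j \in stdsub j.+1.
    rewrite e' mem_GL_subspace GL_mulVmx basis_vec_in //.
  move/mem_stdsub => /(_ i ji); rewrite /basis_vec -colE mxE => ->; exact: eqxx.
apply: (@eq_from_nth _ 0%VS) => [|i]; rewrite size_map std_size // ltnS => ni.
rewrite moved_nth // std_nth //; move: (n.+1 - i)%N => k.
apply/eqP; rewrite eqEdim GL_subspace_dim leqnn andbT.
apply/subvP => v; rewrite mem_GL_subspace => hv.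
rewrite -(GL_mulmxV g v); move: (_ *m v) hv => w /mem_stdsub hw.
apply/mem_stdsub => a ka; rewrite mxE big1 // => b _.
case: (leqP k b) => kb; first by rewrite hw // mulr0.
have /forallP/(_ b)/implyP/(_ (leq_trans kb ka))/eqP -> := h a; exact: mul0r.
Qed.

(** The stabiliser of the standard flag is the Borel subgroup [B]: the flags [moved g] are the
    cosets [gB]. *)
Lemma moved_eq g h : moved g = moved h <-> upper_tri (GLval (h^-1 * g)%g).
Proof.
rewrite -moved_std_upper movedM; split=> [->|e]; first by rewrite GL_mapK.
by rewrite -[LHS](GL_mapK h^-1%g) e invgK.
Qed.

Lemma adapted_basis (A : nat -> T) (v : 'I_n.+1 -> 'cV[F]_n.+1) :
  A 0%N = 0%VS -> (forall i : 'I_n.+1, covers (A i) (A i.+1)) -> A n.+1 = fullv ->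
  (forall i : 'I_n.+1, v i \in A i.+1) -> (forall i : 'I_n.+1, v i \notin A i) ->
  exists g, GLval g = \matrix_(a, b) v b a 0 /\
    forall i, (i <= n.+1)%N -> GL_subspace g (stdsub i) = A i.
Proof.
move=> A0 Ac Af vin vout; set M := \matrix_(a, b) v b a 0.
have Me (j : 'I_n.+1) : M *m basis_vec j = v j.
  by apply/matrixP => a z; rewrite /basis_vec -colE ord1 !mxE.
have im i : (i <= n.+1)%N -> (linfun (mulmx M : 'cV[F]_n.+1 -> 'cV[F]_n.+1) @: stdsub i)%VS = A i.
  elim: i => [|i IH] ni; first by rewrite stdsub0 limg0 A0.
  rewrite (stdsubS (Ordinal ni)) limgD limg_line lfunE /= Me IH; last exact: ltnW.
  have ci := Ac (Ordinal ni); have li := covers_line (vout (Ordinal ni)).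
  apply/eqP; rewrite eqEdim subv_add (covers_sub ci) -memvE vin /=.
  by rewrite (covers_dim ci) (covers_dim li).
have /boolp.choice[w hw] (j : 'I_n.+1) : exists w : 'cV[F]_n.+1, M *m w = basis_vec j.
  have : basis_vec j \in (linfun (mulmx M : 'cV[F]_n.+1 -> 'cV[F]_n.+1) @: stdsub n.+1)%VS.
    by rewrite im // Af memvf.
  by move=> /memv_imgP[w _ e]; exists w; rewrite e lfunE.
have uM : M \in unitmx.
  have : M *m (\matrix_(a, b) w b a 0) = 1%:M.
    apply/matrixP => a b; have := hw b => /matrixP/(_ a 0); rewrite basis_vecE !mxE => <-.
    by apply: eq_bigr => c _; rewrite !mxE.
  by case/mulmx1_unit.
by exists (Sub M uM : G); split=> // i ni; apply: im.
Qed.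

End StandardFlag.

(** * Cosets of the Borel subgroup and the big cell *)

Section Apartments.
Variables (F : finFieldType) (n : nat).
Local Notation T := {vspace 'cV[F]_n.+1}.
Local Notation G := {'GL_n.+1[F]}.
Local Notation moved := (@moved F n).
Local Notation stdsub := (@stdsub F n).
Implicit Types (C V W X Y Z L H : T) (s t D E : seq T).
Implicit Types (g h u : G) (w : 'S_n.+1).

Lemma flag_nth_covers t i : down_flag t -> (i.+1 < size t)%N ->
  covers (nth 0%VS t i.+1) (nth 0%VS t i).
Proof.
elim: t i => [//|V [|Y t] IH] i; first by rewrite ltnS ltn0.
rewrite down_flag_cons => /andP[c d]; case: i => [|i] //= h.
exact: (IH i d).
Qed.

Section TopFlag.
Variables (t : seq T) (tt : t \in top_flags F n).

Let dt : down_flag t. Proof. by move: tt; rewrite mem_top_flags => /andP[]. Qed.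
Let ht : head 0%VS t = fullv. Proof. by move: tt; rewrite mem_top_flags => /andP[_ /eqP]. Qed.

Lemma top_flag_size : size t = n.+2.
Proof. by rewrite (down_flag_size dt) ht dim_fullv. Qed.

(** Renumbers a descending full flag by dimension ([flag_step_dim]). *)
Definition flag_step i := nth 0%VS t (n.+1 - i).

Lemma flag_step0 : flag_step 0 = 0%VS.
Proof.
rewrite /flag_step subn0; have := nth_last 0%VS t; rewrite top_flag_size /= => ->.
by case/and3P: dt => _ _ /eqP.
Qed.

Lemma flag_step_full : flag_step n.+1 = fullv.
Proof. by rewrite /flag_step subnn nth0. Qed.

Lemma flag_step_covers (i : 'I_n.+1) : covers (flag_step i) (flag_step i.+1).
Proof.
have := @flag_nth_covers t (n - i) dt; rewrite top_flag_size /flag_step subSS.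
by rewrite -subSn; [apply; have := ltn_ord i; lia | have := ltn_ord i; lia].
Qed.

Lemma flag_step_dim i : (i <= n.+1)%N -> \dim (flag_step i) = i.
Proof.
elim: i => [|i IH] ni; first by rewrite flag_step0 dimv0.
by rewrite (covers_dim (flag_step_covers (Ordinal ni))) IH // ltnW.
Qed.

Lemma moved_flag_step g :
  (forall i, (i <= n.+1)%N -> GL_subspace g (stdsub i) = flag_step i) -> moved g = t.
Proof.
move=> h; apply: (@eq_from_nth _ 0%VS) => [|i].
  by rewrite size_map std_size top_flag_size.
rewrite size_map std_size ltnS => ni; rewrite moved_nth // h; last by lia.
by rewrite /flag_step; congr nth; lia.
Qed.

Lemma moved_transitive : exists g, moved g = t.
Proof.
have /boolp.choice[v hv] (i : 'I_n.+1) : exists v, v \in flag_step i.+1 /\ v \notin flag_step i.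
  have : ~~ (flag_step i.+1 <= flag_step i)%VS.
    apply/negP => /dimvS; rewrite (covers_dim (flag_step_covers i)); lia.
  by case/subvPn => v v1 v2; exists v.
have [g [_ hg]] := adapted_basis flag_step0 flag_step_covers flag_step_full
  (fun i => (hv i).1) (fun i => (hv i).2).
by exists g; apply: moved_flag_step.
Qed.

Lemma opposite_nth : opposite (std_up F n) t ->
  forall i, (i <= n.+1)%N -> (flag_step i :&: stdsub (n.+1 - i))%VS = 0%VS.
Proof.
rewrite /opposite all2E => /andP[_ /all_nthP h] i ni.
have := h (0%VS, 0%VS) (n.+1 - i)%N; rewrite size_zip top_flag_size size_map size_iota minnn.
have l : (n.+1 - i < n.+2)%N by lia.
rewrite nth_zip; last by rewrite top_flag_size size_map size_iota.
move=> /(_ l) /=; rewrite (nth_map 0%N) ?size_iota // nth_iota // add0n => /eqP.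
by [].
Qed.

End TopFlag.

Definition pgl w : G := insubd (1%g : G) (perm_mx w).

Lemma pglE w : GLval (pgl w) = perm_mx w.
Proof. by rewrite /pgl insubdK // -topredE /= unitmx_perm. Qed.

Lemma pglM w w' : pgl (w * w')%g = (pgl w * pgl w')%g.
Proof. by apply: val_inj; rewrite /= pglE perm_mxM -!pglE. Qed.

Lemma pgl1 : pgl 1%g = 1%g.
Proof. by apply: val_inj; rewrite /= pglE perm_mx1. Qed.

Lemma pglV w : pgl w^-1%g = (pgl w)^-1%g.
Proof. by apply: (mulgI (pgl w)); rewrite -pglM !mulgV pgl1. Qed.

Lemma pgl_conj w w' (g : G) i j :
  GLval ((pgl w)^-1 * g * pgl w')%g (w i) (w' j) = GLval g i j.
Proof.
rewrite -pglV !GL_MxE !pglE -(invgK w') -col_permE -row_permE !mxE.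
by rewrite permK invgK permK.
Qed.

Lemma perm_leq_eq w w' : (forall i, (w i <= w' i)%N) -> w = w'.
Proof.
move=> h; have E : (\sum_i w i = \sum_i w' i)%N.
  rewrite -(reindex_inj (@perm_inj _ w) (P := predT) (F := fun i : 'I_n.+1 => i : nat)).
  by rewrite -(reindex_inj (@perm_inj _ w') (P := predT) (F := fun i : 'I_n.+1 => i : nat)).
apply/permP => i; apply/val_inj/eqP; move: i; apply/forallP.
have := leqif_sum (fun i _ => leqif_eq (h i)).
move=> /(_ predT) [_]; rewrite E eqxx => /esym/forallP h'.
by apply/forallP => i; have := h' i.
Qed.

Lemma unitri_diag u i : upper_unitri (GLval u) -> GLval u i i = 1.
Proof. by case/andP => _ /forallP/(_ i)/eqP. Qed.

Lemma upper_triP (A : 'M[F]_n.+1) : reflect (forall i j : 'I_n.+1, (j < i)%N -> A i j = 0) (upper_tri A).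
Proof.
apply: (iffP forallP) => [h i j ji|h i].
  by have /forallP/(_ j)/implyP/(_ ji)/eqP := h i.
by apply/forallP => j; apply/implyP => ji; apply/eqP/h.
Qed.

(** The entry of the product at [(w i, w' i)] is the diagonal entry 1 of [u], so triangularity gives
    [w i <= w' i] for all [i], and permutations so ordered are equal. This is the disjointness of
    the cells [U w B]. *)
Lemma unitri_perm u w w' : upper_unitri (GLval u) ->
  upper_tri (GLval ((pgl w)^-1 * u * pgl w')%g) -> w = w'.
Proof.
move=> uu /upper_triP h; apply: perm_leq_eq => i; rewrite leqNgt; apply/negP => /h.
by rewrite pgl_conj unitri_diag // => /eqP; rewrite oner_eq0.
Qed.

Lemma unitri_moved u w w' : upper_unitri (GLval u) ->
  moved (u * pgl w)%g = moved (pgl w') -> w = w'.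
Proof.
move=> uu /moved_eq h; apply/esym/(unitri_perm uu).
by rewrite -mulgA.
Qed.

Definition w0 : 'S_n.+1 := perm (@rev_ord_inj n.+1).

Lemma w0E i : w0 i = rev_ord i. Proof. by rewrite permE. Qed.

(** Conjugation by the longest permutation reverses the indices, so [u] is upper and lower
    triangular with unit diagonal. *)
Lemma unitri_moved_w0 u : upper_unitri (GLval u) ->
  moved (u * pgl w0)%g = moved (pgl w0) -> u = 1%g.
Proof.
move=> uu /moved_eq; rewrite mulgA => /upper_triP h.
suff E (i j : 'I_n.+1) : GLval u i j = (i == j)%:R.
  by apply: val_inj; apply/matrixP => i j; rewrite /= !mxE E.
have [ij|ij] := leqP j i.
  move: ij; rewrite leq_eqVlt => /orP[/eqP/val_inj <-|ij]; first by rewrite eqxx unitri_diag.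
  case/andP: uu => /upper_triP -> //; case: eqP => // e; move: ij; rewrite e ltnn //.
rewrite -(pgl_conj w0 w0) h; last by rewrite !w0E /=; have := ltn_ord j; lia.
by case: eqP => // e; move: ij; rewrite e ltnn.
Qed.

Lemma unitriV_mul u u' : upper_unitri (GLval u) -> upper_unitri (GLval u') ->
  upper_unitri (GLval (u^-1 * u')%g).
Proof.
have fx (v : G) : upper_unitri (GLval v) -> upper_tri (GLval v) by case/andP.
move=> hu hu'.
have tri' : upper_tri (GLval (u^-1 * u')%g).
  by apply/moved_eq; rewrite !(moved_std_upper _).2 // fx.
rewrite /upper_unitri tri' /=; apply/forallP => i; apply/eqP.
have := congr1 (fun v : G => GLval v i i) (mulKVg u u'); rewrite GL_MxE mxE.
rewrite (unitri_diag _ hu') (bigD1 i) //= (unitri_diag _ hu) mul1r big1 ?addr0 // => j ne.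
case: (ltngtP i j) => [ij|ji|/val_inj e].
- by move/upper_triP: tri' => -> //; rewrite mulr0.
- by move/upper_triP: (fx _ hu) => -> //; rewrite mul0r.
- by rewrite e eqxx in ne.
Qed.

Lemma unitri_w0_inj u u' : upper_unitri (GLval u) -> upper_unitri (GLval u') ->
  moved (u * pgl w0)%g = moved (u' * pgl w0)%g -> u = u'.
Proof.
move=> hu hu' e; apply/eqP; rewrite eq_sym -(inj_eq (mulgI u^-1%g)) mulVg; apply/eqP.
apply: unitri_moved_w0; first exact: unitriV_mul.
by rewrite -mulgA movedM -e -movedM mulKg.
Qed.

(** For dimension reasons the step of dimension [i+1] meets [stdsub (n+1-i)] in a non-zero vector.
    These vectors, normalised and taken in reverse order, are the columns of the unitriangular
    matrix. *)
Lemma opposite_unitri t : t \in top_flags F n -> opposite (std_up F n) t ->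
  exists2 u, upper_unitri (GLval u) & moved (u * pgl w0)%g = t.
Proof.
move=> tt ot; have on := opposite_nth tt ot.
have /boolp.choice[v hv] (i : 'I_n.+1) : exists v : 'cV[F]_n.+1,
    [/\ v \in flag_step t i.+1, v \notin flag_step t i,
        v \in stdsub (n.+1 - i) & v (rev_ord i) 0 = 1].
  have ci := covers_dim (flag_step_covers tt i).
  have di := flag_step_dim tt (ltnW (ltn_ord i)).
  have dd := @stdsub_dim F n _ (leq_subr i n.+1).
  have d1 := dimv_sum_cap (flag_step t i.+1) (stdsub (n.+1 - i)).
  have d2 := dimvS (subvf (flag_step t i.+1 + stdsub (n.+1 - i))); rewrite dim_fullv in d2.
  have : (flag_step t i.+1 :&: stdsub (n.+1 - i))%VS != 0%VS.
    by rewrite -dimv_eq0; have := ltn_ord i; lia.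
  rewrite -vpick0; set v := vpick _ => v0.
  have /memv_capP[v1 v2] : v \in (flag_step t i.+1 :&: stdsub (n.+1 - i))%VS by apply: memv_pick.
  (* Otherwise [v] would lie in [stdsub (n-i)], which meets the step of dimension [i+1]
     trivially. *)
  have c0 : v (rev_ord i) 0 != 0.
    apply: contra v0 => /eqP c0.
    rewrite -memv0 -(on i.+1) ?ltn_ord // memv_cap v1; apply/mem_stdsub => j lj.
    have [/val_inj ->//|lj'] := eqVneq (j : nat) (rev_ord i).
    by move/mem_stdsub: v2 => -> //; move: lj' => /=; have := ltn_ord i; lia.
  exists ((v (rev_ord i) 0)^-1 *: v); split; try exact: memvZ.
    apply: contra v0 => vi; rewrite -memv0 -(on i) ?(ltnW (ltn_ord i)) // memv_cap v2 andbT.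
    by have := memvZ (v (rev_ord i) 0) vi; rewrite scalerA mulfV // scale1r.
  by rewrite mxE mulVf.
have [g [gE hg]] := adapted_basis (flag_step0 tt) (flag_step_covers tt) (flag_step_full tt)
  (fun i => let: And4 a _ _ _ := hv i in a) (fun i => let: And4 _ b _ _ := hv i in b).
exists (g * (pgl w0)^-1)%g; last by rewrite mulgKV; apply: moved_flag_step hg.
have E i j : GLval (g * (pgl w0)^-1)%g i j = v (rev_ord j) i 0.
  have := pgl_conj 1%g w0 (g * (pgl w0)^-1)%g i j.
  by rewrite pgl1 invg1 mul1g mulgKV perm1 gE mxE w0E => ->.
rewrite /upper_unitri; apply/andP; split.
  apply/upper_triP => i j ji; rewrite E.
  have [_ _ /mem_stdsub h _] := hv (rev_ord j); apply: h => /=; have := ltn_ord j; lia.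
apply/forallP => i; rewrite E; have [_ _ _] := hv (rev_ord i).
by rewrite rev_ordK => ->.
Qed.

End Apartments.

(** * The alternating function of the standard apartment *)

Section Apartment.
Variables (F : finFieldType) (n : nat).
Local Notation T := {vspace 'cV[F]_n.+1}.
Local Notation G := {'GL_n.+1[F]}.
Local Notation moved := (@moved F n).
Local Notation stdsub := (@stdsub F n).
Local Notation pgl := (@pgl F n).
Local Notation std_up := (@std_up F n).
Local Notation w0 := (@w0 n).
Implicit Types (C V W X Y Z L H : T) (s t D E : seq T).
Implicit Types (g h u : G) (w : 'S_n.+1).

Lemma std_up_frame : relframe (fullv : T) std_up.
Proof.
apply/and4P; split; first exact: std_up_sorted.
- by rewrite size_map size_iota dim_fullv.
- by rewrite /= stdsub0 capv0.
by rewrite std_up_last.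
Qed.

Lemma mem_GL_perm w V v : (v \in GL_subspace (pgl w) V) = (perm_mx w^-1 *m v \in V).
Proof. by rewrite mem_GL_subspace -pglV pglE. Qed.

Lemma perm_mulE w (v : 'cV[F]_n.+1) j : (perm_mx w *m v) j 0 = v (w j) 0.
Proof. by rewrite -row_permE mxE. Qed.

Lemma unitri_subspace u i : upper_unitri (GLval u) -> (i <= n.+1)%N ->
  GL_subspace u (stdsub i) = stdsub i.
Proof.
case/andP => /moved_std_upper e _ ni; have l : (n.+1 - i <= n.+1)%N by lia.
by have := moved_nth u l; rewrite e std_nth // (_ : n.+1 - (n.+1 - i) = i)%N //; lia.
Qed.

Lemma unitri_opposite u : upper_unitri (GLval u) -> opposite std_up (moved (u * pgl w0)%g).
Proof.
move=> uu; rewrite /opposite all2E !size_map std_size size_iota eqxx andTb.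
apply/(all_nthP (0%VS, 0%VS)) => i; rewrite size_zip !size_map std_size size_iota minnn => ni.
rewrite nth_zip; last by rewrite !size_map std_size size_iota.
rewrite moved_nth; last by lia.
rewrite (nth_map 0%N) ?size_iota // nth_iota // add0n.
rewrite GL_subspaceM -(unitri_subspace uu (i := i)); last by lia.
rewrite /= -GL_subspace_cap -[X in _ == X](GL_subspace0 u) (inj_eq (@GL_subspace_inj _ _ u)).
apply/eqP/vspaceP => v; rewrite memv0 memv_cap; apply/andP/eqP => [[]|->]; last by rewrite !mem0v.
rewrite mem_GL_perm => /mem_stdsub h1 /mem_stdsub h2.
apply/matrixP => j z; rewrite ord1 mxE; have [ij|ji] := leqP i j; first exact: h2.
have := h1 (w0 j); rewrite perm_mulE permK; apply.
by rewrite w0E /=; have := ltn_ord j; lia.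
Qed.

Lemma sum_unitri (A : zmodType) (phi : seq T -> A) : steinberg phi ->
  \sum_(u : G | upper_unitri (GLval u)) phi (moved (u * pgl w0)%g) =
  phi (std F n) *~ (-1) ^+ tri n.+1.
Proof.
move=> st; have := opposite_sum st std_up_frame; rewrite dim_fullv.
rewrite (_ : map _ (rev std_up) = std F n); last first.
  by rewrite -[RHS]map_id; apply: eq_map => V; apply: capfv.
move=> <-; rewrite -big_filter -[in RHS]big_filter.
rewrite -[LHS](big_map (fun u : G => moved (u * pgl w0)%g) predT).
apply/perm_big/uniq_perm.
- rewrite map_inj_in_uniq ?filter_uniq ?index_enum_uniq // => u u'.
  by rewrite !mem_filter => /andP[hu _] /andP[hu' _]; apply: unitri_w0_inj.
- by rewrite filter_uniq // flags_uniq.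
move=> t; rewrite mem_filter; apply/mapP/andP => [[u]|[ot tt]].
  rewrite mem_filter => /andP[hu _] ->; split; first exact: unitri_opposite.
  exact: moved_top.
have [u hu e] := opposite_unitri tt ot.
by exists u => //; rewrite mem_filter hu mem_index_enum.
Qed.

(** The difference satisfies (FS) and vanishes on the opposite flags, whose values generate all
    others. *)
Lemma steinberg_unitri_ext (A : zmodType) (phi psi : seq T -> A) :
  steinberg phi -> steinberg psi ->
  (forall u : G, upper_unitri (GLval u) ->
     phi (moved (u * pgl w0)%g) = psi (moved (u * pgl w0)%g)) ->
  forall t, t \in top_flags F n -> phi t = psi t.
Proof.
move=> st st' h t tt; apply/eqP; rewrite -subr_eq0; apply/eqP.
have st2 : steinberg (fun t => phi t - psi t).
  by move=> s u C V r; rewrite sumrB st // st' // subrr.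
have /andP[dt /eqP ht] : down_flag t && (head 0%VS t == fullv) by rewrite -mem_top_flags.
apply: (opposite_ind (N := fun a => a = 0) _ _ st2 std_up_frame _ dt ht) => //.
  by move=> x y -> ->; rewrite subrr.
move=> v dv hv ov.
have [|u hu <-] := opposite_unitri (t := v) _ ov; last by rewrite h // subrr.
by rewrite mem_top_flags dv hv eqxx.
Qed.

Lemma list_hole s t V C X (L L' : seq T) : size L = size L' -> L = s ++ [:: V, X, C & t] ->
  (forall j, (j < size L)%N -> j != (size s).+1 -> nth 0%VS L' j = nth 0%VS L j) ->
  exists X', L' = s ++ [:: V, X', C & t].
Proof.
move=> sz eL h; exists (nth 0%VS L' (size s).+1); apply: (@eq_from_nth _ 0%VS).
  by rewrite -sz eL !size_cat.
move=> j; rewrite -sz => lj; have [e|ne] := eqVneq j (size s).+1.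
  by rewrite e nth_cat ltnNge leqnSn /= subSnn.
rewrite h // eL !nth_cat; case: ltnP => // sj.
have [m e] : exists m, j = (m + size s)%N by exists (j - size s)%N; lia.
move: ne; rewrite e addnK; case: m e => [|[|m]] //=.
by rewrite add1n eqxx.
Qed.

Lemma moved_tperm (a b : 'I_n.+1) j : b = a.+1 :> nat -> (j <= n.+1)%N ->
  (n.+1 - j)%N != b -> nth 0%VS (moved (pgl (tperm a b))) j = nth 0%VS (std F n) j.
Proof.
move=> ba lj nb; rewrite moved_nth // std_nth //.
move: nb; move: (n.+1 - j)%N => k nb; apply/esym/eqP.
rewrite eqEdim GL_subspace_dim leqnn andbT; apply/subvP => v /mem_stdsub h.
rewrite mem_GL_perm; apply/mem_stdsub => i ki; rewrite perm_mulE tpermV; apply: h.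
case: tpermP => [e|e|//]; first by rewrite ba; rewrite e in ki; lia.
by rewrite e in ki; lia.
Qed.

Section Ring.
Variable R : comNzRingType.

(** Gow's element seen on flags ([steinberg_eltE]): the signed indicator of the apartment of
    coordinate flags. *)
Definition ebar t : R := \sum_(w : 'S_n.+1) (-1) ^+ w * (t == moved (pgl w))%:R.

(** The apartment flags that agree with given data outside one place come in pairs exchanged by an
    adjacent transposition, and their signs are opposite. *)
Lemma ebar_steinberg : steinberg ebar.
Proof.
move=> s t C V r; rewrite /ebar exchange_big /=.
pose f w := [exists X, mid C V X && (s ++ [:: V, X, C & t] == moved (pgl w))].
rewrite (eq_bigr (fun w => (-1) ^+ w * (f w)%:R)); last first.
  move=> w _; rewrite -big_distrr /=; congr (_ * _).
  rewrite /f; case: existsP => [[X /andP[mX /eqP e]]|h].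
    rewrite (bigD1 X) //= e eqxx big1 ?addr0 // => Y /andP[_ ne].
    rewrite -e; case: eqP => // /eqP; rewrite eqseq_cat // eqxx /= !eqseq_cons eqxx /=.
    by rewrite (negbTE ne).
  rewrite big1 // => X mX; case: eqP => // e; case: h.
  by exists X; rewrite mX e eqxx.
have [sz|sz] := eqVneq (size s + (size t + 3))%N n.+2; last first.
  rewrite big1 // => w _; rewrite (_ : f w = false) ?mulr0 //.
  apply/existsP => -[X /andP[_ /eqP /(congr1 size)]].
  rewrite size_cat /= size_map std_size => e; move: sz; rewrite -e => /eqP; lia.
have la : (n - (size s).+1 < n.+1)%N by lia.
have lb : (n - size s < n.+1)%N by lia.
(* The free place, number [size s + 1] from the top, holds a subspace of dimension [b = n - size s];
   exchanging coordinates [b - 1] and [b] alters only the coordinate subspace of that dimension. *)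
pose a := Ordinal la; pose b := Ordinal lb.
have ab : b = a.+1 :> nat by rewrite /=; lia.
have nab : a != b by apply/eqP => /(congr1 val) /=; lia.
have f1 w : f w -> f (w * tperm a b)%g.
  case/existsP => X /andP[mX /eqP e].
  have [||X' eX'] := list_hole (L' := moved (pgl (w * tperm a b)%g)) _ (esym e).
  - by rewrite !size_map.
  - move=> j; rewrite size_map std_size ltnS => lj nj.
    rewrite pglM movedM (nth_map 0%VS) ?size_map ?std_size //.
    rewrite moved_tperm //; last by rewrite /=; move: nj => /eqP nj; apply/eqP; lia.
    by rewrite -(nth_map _ 0%VS) ?std_size.
  apply/existsP; exists X'; rewrite eX' eqxx andbT.
  have := moved_flag (pgl (w * tperm a b)%g); rewrite eX' => /down_flag_head.
  by rewrite !down_flag_cons => /and3P[c1 c2 _]; rewrite /mid c1 c2.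
have f2 w : f (w * tperm a b)%g = f w.
  apply/idP/idP => [/f1|]; last exact: f1.
  by rewrite -mulgA tperm2 mulg1.
have odd_mul w : odd_perm (w * tperm a b)%g = ~~ odd_perm w.
  by rewrite odd_permM odd_tperm nab addbT.
rewrite (bigID (fun w : 'S_n.+1 => odd_perm w)) /=.
have -> : \sum_(w : 'S_n.+1 | odd_perm w) (-1) ^+ w * (f w)%:R =
    \sum_(w : 'S_n.+1 | ~~ odd_perm w) - ((-1) ^+ w * (f w)%:R) :> R.
  rewrite (reindex_inj (mulIg (tperm a b))) /=.
  apply: eq_big => w; first exact: odd_mul.
  by rewrite odd_mul f2 => /negbTE ->; rewrite expr1 expr0 mulN1r mul1r.
by rewrite sumrN addNr.
Qed.

Lemma ebar_w0 u : upper_unitri (GLval u) ->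
  ebar (moved (u * pgl w0)%g) = (-1) ^+ w0 * (u == 1%g)%:R.
Proof.
move=> uu; rewrite /ebar (bigD1 w0) //= big1 ?addr0 => [|w ne].
  congr (_ * _%:R); congr nat_of_bool; apply/eqP/eqP => [|->]; last by rewrite mul1g.
  exact: unitri_moved_w0.
case: eqP => [e|_]; last by rewrite mulr0.
by have := unitri_moved uu e; move/eqP; rewrite eq_sym (negbTE ne).
Qed.

(** Up to one global sign, the [U]-translates of [ebar] and evaluation at the opposite flags are
    dual bases. *)
Lemma ebar_unitri u h : upper_unitri (GLval u) -> upper_unitri (GLval h) ->
  ebar (map (GL_subspace h^-1%g) (moved (u * pgl w0)%g)) = (-1) ^+ w0 * (u == h)%:R.
Proof.
move=> hu hh; rewrite -movedM mulgA ebar_w0; last exact: unitriV_mul.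
congr (_ * _%:R); congr nat_of_bool; apply/eqP/eqP => [e|->]; last by rewrite mulVg.
by rewrite -[u]mul1g -(mulgV h) -mulgA e mulg1.
Qed.

(** The coefficient at [g] is the signed count of the [w] with [w^-1 g] in [B], that is
    [gB = wB]. *)
Lemma steinberg_eltE g : steinberg_elt F n R g = ebar (moved g).
Proof.
rewrite /steinberg_elt /gmul ffunE /ebar.
rewrite (eq_bigr (fun h => \sum_(w : 'S_n.+1) (GLval h == perm_mx w)%:R * ((-1) ^+ w *
   (upper_tri (GLval (h^-1 * g)%g))%:R))); last first.
  move=> h _; rewrite !ffunE big_mkcond big_distrl /=; apply: eq_bigr => w _.
  by case: ifP => _; rewrite ?mul0r // mul1r.
rewrite exchange_big /=; apply: eq_bigr => w _; rewrite (bigD1 (pgl w)) //= big1 ?addr0.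
  rewrite pglE eqxx mul1r; congr (_ * _%:R); congr nat_of_bool.
  by apply/idP/eqP => [/moved_eq|/moved_eq].
move=> h ne; case: eqP => [e|_]; last by rewrite mul0r.
by case/eqP: ne; apply: val_inj; rewrite /= e pglE.
Qed.

Local Notation RG := {ffun G -> R^o}.

Lemma gmulE (a : RG) g :
  gmul a (steinberg_elt F n R) g = \sum_h a h * ebar (map (GL_subspace h^-1%g) (moved g)).
Proof. by rewrite ffunE; apply: eq_bigr => h _; rewrite steinberg_eltE movedM. Qed.

Lemma steinberg_GL (A : zmodType) (phi : seq T -> A) g : steinberg phi ->
  steinberg (fun t => phi (map (GL_subspace g) t)).
Proof.
move=> st s t C V r.
have r' : rank2 (GL_subspace g C) (GL_subspace g V) by rewrite /rank2 GL_subspaceS !GL_subspace_dim.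
rewrite -[RHS](st (map (GL_subspace g) s) (map (GL_subspace g) t) _ _ r').
rewrite [RHS](reindex_onto (GL_subspace g) (GL_subspace g^-1%g)) => [|X _]; last first.
  exact: GL_subspaceVK.
apply: eq_big => [X|X _]; first by rewrite /mid !GL_covers GL_subspaceK eqxx andbT.
by rewrite map_cat.
Qed.

(** Identifies Gow's module with the Steinberg functions on full flags: every multiple of [ebar] is
    Steinberg, and conversely a Steinberg function is recovered from its values on the opposite
    flags. *)
Lemma StP (x : RG) : lin_span [set gmul a (steinberg_elt F n R) | a in setT]%classic x <->
  exists2 phi : seq T -> R, steinberg phi & forall g, x g = phi (moved g).
Proof.
split=> [h|[phi st e]].
  pose N := [set x : RG | exists2 phi : seq T -> R, steinberg phi & forall g, x g = phi (moved g)]%classic.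
  apply: (h N); first split.
  - by exists (fun=> 0) => [s t C V r|g]; rewrite ?big1 // ffunE.
  - move=> a y z [p sp ep] [p' sp' ep']; exists (fun t => a * p t + p' t).
      by move=> s t C V r; rewrite big_split -big_distrr /= sp // sp' // mulr0 addr0.
    by move=> g; rewrite !ffunE ep ep'.
  move=> _ [a _ <-]; exists (fun t => \sum_h a h * ebar (map (GL_subspace h^-1%g) t)).
    move=> s t C V r; rewrite exchange_big big1 //= => h' _.
    by rewrite -big_distrr /= (steinberg_GL _ ebar_steinberg) // mulr0.
  by move=> g; rewrite gmulE.
(* The coefficients are dictated by the duality [ebar_unitri]; the sign of the longest permutation
   squares to 1. *)
pose a : RG := [ffun h : G => if upper_unitri (GLval h) then
  (-1) ^+ w0 * phi (moved (h * pgl w0)%g) else 0].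
apply: Defs.sub_span; exists a => //; apply/ffunP => g; rewrite gmulE e.
have st' : steinberg (fun t => \sum_h a h * ebar (map (GL_subspace h^-1%g) t)).
  move=> s t C V r; rewrite exchange_big big1 //= => h _.
  by rewrite -big_distrr /= (steinberg_GL _ ebar_steinberg) // mulr0.
apply: (steinberg_unitri_ext st' st _ (moved_top g)) => u uu.
rewrite (bigD1 u) //= [X in _ + X]big1 => [|h /negbTE ne].
  by rewrite ebar_unitri // ffunE uu addr0 eqxx mulr1 mulrAC -signr_addb addbb mul1r.
rewrite ffunE; case: ifP => uh; last by rewrite mul0r.
by rewrite ebar_unitri // eq_sym ne !mulr0.
Qed.

End Ring.
End Apartment.

(** * Gow's lattice *)

Section SteinbergModule.
Variables (F : finFieldType) (n : nat).
Local Notation T := {vspace 'cV[F]_n.+1}.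
Local Notation G := {'GL_n.+1[F]}.
Local Notation moved := (@moved F n).
Local Notation pgl := (@pgl F n).
Local Notation w0 := (@w0 n).
Local Notation top_flags := (@top_flags F n).
Implicit Types (C V W X Y Z L H : T) (s t D E : seq T).
Implicit Types (g h u : G) (w : 'S_n.+1).

Definition mover t : G := odflt 1%g [pick g | moved g == t].

Lemma moverK t : t \in top_flags -> moved (mover t) = t.
Proof.
move=> tt; rewrite /mover; case: pickP => [g /eqP //|h].
by have [g /eqP e] := moved_transitive tt; move: (h g); rewrite e.
Qed.

Lemma top_flags_mid s t C V X X' : mid C V X -> mid C V X' ->
  (s ++ [:: V, X, C & t] \in top_flags) = (s ++ [:: V, X', C & t] \in top_flags).
Proof.
by move=> m m'; rewrite !mem_top_flags !head_mid (down_flag_mid _ _ m m').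
Qed.

Section Ring.
Variable R : comNzRingType.
Local Notation RG := {ffun G -> R^o}.
Local Notation St := (St F n R).
Implicit Types (x y z : St) (phi : seq T -> R).

Definition stval x : RG := submod_val x.

(** An element of the module is constant on cosets [gB]; it is read as a function on flags and
    extended by zero, so that [pairing] applies to it. *)
Definition stf x t : R := if t \in top_flags then stval x (mover t) else 0.

Lemma stvalP x : exists2 phi : seq T -> R, steinberg phi & forall g, stval x g = phi (moved g).
Proof.
apply/StP; rewrite -[X in X _](span_id (submodule_span _)).
by apply: Defs.sub_span; apply/asboolP; case: x => a.
Qed.

Lemma stf_top phi x t : (forall g, stval x g = phi (moved g)) -> t \in top_flags ->
  stf x t = phi t.
Proof. by move=> h tt; rewrite /stf tt h moverK. Qed.

Lemma stf_moved x g : stf x (moved g) = stval x g.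
Proof. by have [phi st h] := stvalP x; rewrite (stf_top h) ?moved_top. Qed.

Lemma stf_steinberg x : steinberg (stf x).
Proof.
move=> s t C V r; have [phi st h] := stvalP x; have [X0 m0] := mid_ex r.
have [tt|nt] := boolP (s ++ [:: V, X0, C & t] \in top_flags); last first.
  by rewrite big1 // => X mX; rewrite /stf (top_flags_mid s t mX m0) (negbTE nt).
rewrite -[RHS](st s t _ _ r); apply: eq_bigr => X mX.
by rewrite (stf_top h) // (top_flags_mid s t mX m0).
Qed.

Lemma stf_flag_fun x : flag_fun (stf x).
Proof. by move=> t nt; rewrite /stf mem_top_flags (negbTE nt). Qed.

Lemma stval_inj : injective stval. Proof. exact: val_inj. Qed.

Lemma stval_lin a x y g : stval (a *: x + y) g = a * stval x g + stval y g.
Proof. by rewrite /stval /= !ffunE. Qed.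

Lemma stf_lin a x y t : stf (a *: x + y) t = a * stf x t + stf y t.
Proof. by rewrite /stf; case: ifP => _; rewrite ?stval_lin // mulr0 addr0. Qed.

Lemma stf0 t : stf 0 t = 0.
Proof. by have := stf_lin (-1) 0 0 t; rewrite scaler0 addr0 mulN1r addNr. Qed.

Lemma stf_ext x y : (forall t, t \in top_flags -> stf x t = stf y t) -> x = y.
Proof.
move=> h; apply/stval_inj/ffunP => g; rewrite -!stf_moved; exact: h (moved_top g).
Qed.

Lemma mkSt_subproof phi : steinberg phi -> ([ffun g => phi (moved g)] : RG) \in
  spanb [set gmul a (steinberg_elt F n R) | a in setT]%classic.
Proof.
move=> st; apply/asboolP/StP; exists phi => // g; exact: ffunE.
Qed.

Definition mkSt phi (st : steinberg phi) : St := Submod (mkSt_subproof st).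

Lemma stval_mkSt phi (st : steinberg phi) g : stval (mkSt st) g = phi (moved g).
Proof. exact: ffunE. Qed.

Lemma stf_mkSt phi (st : steinberg phi) t : t \in top_flags -> stf (mkSt st) t = phi t.
Proof. exact/stf_top/stval_mkSt. Qed.

Definition unip u : St := mkSt (steinberg_GL u^-1%g (@ebar_steinberg F n R)).

Lemma stval_unip u : stval (unip u) = gtranslate u (steinberg_elt F n R).
Proof.
apply/ffunP => g; by rewrite stval_mkSt ffunE steinberg_eltE movedM.
Qed.

Lemma unip_decomp x : x = \sum_(u : G | upper_unitri (GLval u))
  ((-1) ^+ w0 * stf x (moved (u * pgl w0)%g)) *: unip u.
Proof.
apply: stf_ext => t tt; symmetry.
have sumE t' : stf (\sum_(u : G | upper_unitri (GLval u))
  ((-1) ^+ w0 * stf x (moved (u * pgl w0)%g)) *: unip u) t' =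
  \sum_(u : G | upper_unitri (GLval u)) (-1) ^+ w0 * stf x (moved (u * pgl w0)%g) * stf (unip u) t'.
  have D y z : stf (y + z) t' = stf y t' + stf z t' by rewrite -[y]scale1r stf_lin mul1r scale1r.
  rewrite (big_morph (fun z => stf z t') D (stf0 t')); apply: eq_bigr => u _.
  by rewrite -[_ *: _]addr0 stf_lin stf0 addr0.
apply: steinberg_unitri_ext tt => [||u uu]; try exact: stf_steinberg.
rewrite sumE (bigD1 u) //= big1 ?addr0 => [|h /andP[uh /negbTE ne]].
  rewrite stf_mkSt ?moved_top // ebar_unitri // eqxx mulr1 mulrAC -signr_addb addbb.
  exact: mul1r.
by rewrite stf_mkSt ?moved_top // ebar_unitri // eq_sym ne !mulr0.
Qed.

Lemma ebar_GL u t : @ebar F n R (map (GL_subspace u^-1%g) t) =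
  \sum_(w : 'S_n.+1) (-1) ^+ w * (t == moved (u * pgl w)%g)%:R.
Proof.
apply: eq_bigr => w _; congr (_ * _%:R); congr nat_of_bool.
apply/eqP/eqP => [e|->]; last by rewrite movedM GL_mapK.
by have := GL_mapK u^-1%g t; rewrite invgK e movedM.
Qed.

End Ring.

Local Notation St := (St F n int).

Definition gform (x y : St) : int := \sum_(t <- top_flags) stf x t * stf y t.

(** Fixing that flag means that the conjugate is upper triangular; its diagonal is a permutation of
    that of [u], so it is even unitriangular. *)
Lemma unitri_conj_perm w u : upper_unitri (GLval u) ->
  (moved (u * pgl w^-1)%g == moved (pgl w^-1)) =
  upper_unitri (perm_mx w *m GLval u *m invmx (perm_mx w)).
Proof.
move=> uu; have -> : perm_mx w *m GLval u *m invmx (perm_mx w) =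
    GLval ((pgl w^-1)^-1 * u * pgl w^-1)%g.
  by rewrite pglV invgK !GL_MxE GL_VxE pglE.
apply/eqP/idP => [/moved_eq|/andP[h _]]; last by apply/moved_eq; rewrite mulgA.
rewrite mulgA /upper_unitri => -> /=; apply/forallP => i.
by have := pgl_conj w^-1%g w^-1%g u (w i) (w i); rewrite permK => ->; rewrite unitri_diag.
Qed.

(** A flag common to two translated apartments is [u1 w B = u2 w' B], which forces [w = w']. The
    signs cancel in pairs, and the scalar product counts the [w] for which [u1^-1 u2] fixes [wB]. *)
Lemma gow_form_exists : is_gow_form gform.
Proof.
split=> [x y|z x y|u1 u2 x y h1 h2 ex ey].
- by apply: eq_bigr => t _; apply: mulrC.
- rewrite -sumrB; apply: eq_bigr => t _.
  by rewrite -[x - y]addrC -scaleN1r stf_lin mulN1r -mulrBl addrC.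
have -> : x = unip _ u1 by apply: stval_inj; rewrite stval_unip.
have -> : y = unip _ u2 by apply: stval_inj; rewrite stval_unip.
set u := (u1^-1 * u2)%g; have uu : upper_unitri (GLval u) by apply: unitriV_mul.
have eqm w w' : moved (u1 * pgl w)%g = moved (u2 * pgl w')%g ->
    w = w' /\ moved (u * pgl w)%g = moved (pgl w).
  move=> e; have e' : moved (u * pgl w')%g = moved (pgl w).
    by rewrite /u -mulgA movedM -e -movedM mulKg.
  by have e2 := unitri_moved uu e'; rewrite -e2 in e' *.
transitivity (\sum_(w : 'S_n.+1) ((moved (u * pgl w)%g == moved (pgl w)) : nat)%:Z).
  rewrite /gform big_seq.
  rewrite (eq_bigr (fun t => \sum_(w : 'S_n.+1) (t == moved (u1 * pgl w)%g)%:R *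
    ((moved (u * pgl w)%g == moved (pgl w)) : nat)%:Z)); last first.
    move=> t tt; rewrite !stf_mkSt // !ebar_GL big_distrl /=; apply: eq_bigr => w _.
    case: (eqVneq t (moved (u1 * pgl w)%g)) => [->|_]; last by rewrite mulr0 !mul0r.
    rewrite mulr1 mul1r (bigD1 w) //= [X in _ + X]big1 ?addr0 => [|w' ne].
      rewrite mulrA -signr_addb addbb mul1r natz; congr Posz; congr nat_of_bool.
      apply/eqP/eqP => [/eqm[] //|e].
      by rewrite -[u2](mulKVg u1) -mulgA movedM [RHS]movedM e.
    case: eqP => [/eqm[e _]|_]; last by rewrite mulr0.
    by rewrite e eqxx in ne.
  rewrite -big_seq exchange_big /=; apply: eq_bigr => w _.
  rewrite -big_distrl /= (bigD1_seq (moved (u1 * pgl w)%g)) ?moved_top ?flags_uniq //= eqxx.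
  by rewrite big1 ?addr0 ?mul1r // => t /negbTE ->.
(* The flags produce conjugation by [w^-1] where Gow's formula has [w]; inverting the index
   reconciles them. *)
rewrite -natz -sum1_card natr_sum (reindex_inj invg_inj) /= [RHS]big_mkcond /=.
apply: eq_bigr => w _; rewrite -[Posz _]natz.
by rewrite (unitri_conj_perm w uu) [w \in _]/in_mem /=; case: upper_unitri.
Qed.

Lemma gow_form_unique (b b' : St -> St -> int) :
  is_gow_form b -> is_gow_form b' -> forall x y, b x y = b' x y.
Proof.
move=> [bs ba bf] [bs' ba' bf'] x y.
rewrite (unip_decomp x) (zmod_morph_sum (ba y)) (zmod_morph_sum (ba' y)).
apply: eq_bigr => u hu; congr (_ * _); rewrite bs bs'.
rewrite (unip_decomp y) (zmod_morph_sum (ba (unip _ u))) (zmod_morph_sum (ba' (unip _ u))).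
apply: eq_bigr => v hv; congr (_ * _).
by rewrite (bf v u _ _ hv hu (stval_unip _ v) (stval_unip _ u))
           (bf' v u _ _ hv hu (stval_unip _ v) (stval_unip _ u)).
Qed.

Lemma gow_formE (x y : St) : gow_form x y = gform x y.
Proof.
apply: (gow_form_unique _ gow_form_exists).
exact: xgetPex (ex_intro _ _ gow_form_exists).
Qed.

End SteinbergModule.

(** * Lattices and extension of scalars *)

Section PrimeField.
Variables (k : fieldType) (l : nat).
Hypothesis char_k : l \in [pchar k].

Lemma intr_eq0_char (a : int) : (a%:~R == 0 :> k) = (l%:Z %| a)%Z.
Proof.
rewrite dvdzE /=; case: a => m; rewrite ?NegzE ?mulrNz ?oppr_eq0 ?abszN /= -pmulrn.
  by rewrite (dvdn_pcharf char_k).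
by rewrite (dvdn_pcharf char_k).
Qed.

(* Linear independence over the prime field of k. *)
Definition indep m (c : 'I_m -> k) :=
  forall b : 'I_m -> int, \sum_s (b s)%:~R * c s = 0 -> forall s, (l%:Z %| b s)%Z.

(** A basis of the span of [K] over the prime field, with coordinates lifted to integers. It is
    built greedily: a scalar outside the current span is adjoined. *)
Lemma indep_coords (K : seq k) : exists m (c : 'I_m -> k) (b : k -> 'I_m -> int),
  indep c /\ forall a, a \in K -> a = \sum_s (b a s)%:~R * c s.
Proof.
suff [m [c [ic h]]] : exists m (c : 'I_m -> k), indep c /\
    forall a, a \in K -> exists b : 'I_m -> int, a = \sum_s (b s)%:~R * c s.
  have /boolp.choice[b hb] (a : k) : exists b : 'I_m -> int,
      a \in K -> a = \sum_s (b s)%:~R * c s.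
    have [/h[b e]|_] := boolP (a \in K); first by exists b.
    by exists (fun=> 0).
  by exists m, c, b.
elim: K => [|a K [m [c [ic h]]]].
  by exists 0%N, (fun=> 0); split=> [b _ []|a].
have [[b eb]|na] := pselect (exists b : 'I_m -> int, a = \sum_s (b s)%:~R * c s).
  exists m, c; split=> // a'; rewrite inE => /orP[/eqP ->|/h //]; by exists b.
pose c' (s : 'I_m.+1) := if unlift ord0 s is Some s' then c s' else a.
have E (b : 'I_m.+1 -> int) : \sum_s (b s)%:~R * c' s =
    (b ord0)%:~R * a + \sum_s (b (fintype.lift ord0 s))%:~R * c s.
  rewrite big_ord_recl /c' unlift_none; congr (_ + _); apply: eq_bigr => s _.
  by rewrite liftK.
exists m.+1, c'; split.
  move=> b; rewrite E => e.
  (* Otherwise a Bezout inverse of this coefficient modulo [l] would express [a] through the [c s],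
     against [na]. *)
  have d0 : (l%:Z %| b ord0)%Z.
    rewrite -intr_eq0_char; apply: contra_notT na => nz.
    have co : coprimez (b ord0) l.
      rewrite coprimez_sym /coprimez -[gcdz _ _]/(Posz (gcdn l `|b ord0|)).
      have lp : prime l by case/andP: char_k.
      have : coprime l `|b ord0| by rewrite prime_coprime //; move: nz; rewrite intr_eq0_char dvdzE.
      by rewrite /coprime => /eqP ->.
    have [[x y] /= exy] := coprimezP _ _ co.
    exists (fun s => - x * b (fintype.lift ord0 s)).
    have xb : x%:~R * (b ord0)%:~R = 1 :> k.
      have := congr1 (fun z : int => z%:~R : k) exy; rewrite rmorphD !rmorphM /=.
      by rewrite -[l%:~R]pmulrn (pcharf0 char_k) mulr0 addr0.
    rewrite (_ : a = x%:~R * ((b ord0)%:~R * a)); last by rewrite mulrA xb mul1r.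
    rewrite (_ : _ * a = - \sum_s (b (fintype.lift ord0 s))%:~R * c s).
      by rewrite mulrN -mulNr big_distrr /=; apply: eq_bigr => s _; rewrite intrM mulrNz mulrA.
    by apply/eqP; rewrite -addr_eq0 e.
  move: e; have /eqP -> : (b ord0)%:~R == 0 :> k by rewrite intr_eq0_char.
  rewrite mul0r add0r => /(ic (fun s => b (fintype.lift ord0 s))) d s.
  by case: (unliftP ord0 s) => [s'|] ->.
move=> a'; rewrite inE => /orP[/eqP ->|/h[b ->]].
  exists (fun s => (s == ord0)%:R); rewrite E eqxx mul1r big1 ?addr0 // => s _.
  by rewrite (_ : fintype.lift ord0 s == ord0 = false) ?mul0r //; apply/negbTE/neq_lift.
exists (fun s => if unlift ord0 s is Some s' then b s' else 0).
rewrite E unlift_none mul0r add0r; apply: eq_bigr => s _; by rewrite liftK.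
Qed.

End PrimeField.

Lemma lin_span_seq (k : nzRingType) (V : lmodType k) (I : eqType) (P : I -> Prop)
    (f : I -> V) v :
  lin_span [set f i | i in [set i | P i]]%classic v <->
  exists2 L : seq (k * I), forall p, p \in L -> P p.2 & v = \sum_(p <- L) p.1 *: f p.2.
Proof.
set S := (X in lin_span X); have [S0 SD] := submodule_span S; split=> [h|[L h ->]].
  apply: (h [set v | exists2 L : seq (k * I), forall p, p \in L -> P p.2 &
     v = \sum_(p <- L) p.1 *: f p.2]%classic).
    split; first by exists [::]; rewrite ?big_nil.
    move=> a x y [L h1 ->] [L' h2 ->].
    exists ([seq (a * p.1, p.2) | p <- L] ++ L').
      by move=> p; rewrite mem_cat => /orP[/mapP[p' /h1 ? ->]|/h2].
    rewrite big_cat big_map scaler_sumr; congr (_ + _).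
    by apply: eq_bigr => p _; rewrite scalerA.
  move=> _ [i Pi <-]; exists [:: (1, i)]; rewrite ?big_seq1 ?scale1r // => p.
  by rewrite inE => /eqP ->.
elim: L h => [|p L IH] h; first by rewrite big_nil.
rewrite big_cons; apply: SD.
  by apply: Defs.sub_span; exists p.2 => //; apply: h; rewrite inE eqxx.
by apply: IH => p' hp'; apply: h; rewrite inE hp' orbT.
Qed.

(** The lattices are predicates because the weight space [topD] is only a subgroup of its type. With
    [toSt] or [toD] for [f] this becomes the filtration of either form ([layDE], [laySE]). *)
Definition layer (l : nat) (D E : zmodType) (PD : D -> Prop) (PE : E -> Prop)
    (f : D -> E) (i : nat) (x : D) := PD x /\ exists2 y, PE y & f x = y *+ l ^ i.

(** * One direction of the comparison of layers, for two abstract lattices *)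

Section Half.
Variables (k : fieldType) (l : nat).
Hypothesis char_k : l \in [pchar k].
Variables (D E : zmodType) (Dk Ek : lmodType k) (rD : D -> Dk) (rE : E -> Ek).
Variables (PD : D -> Prop) (PE : E -> Prop) (f : D -> E) (g : E -> D).
Hypotheses (rDB : zmod_morphism rD) (rEB : zmod_morphism rE).
Hypotheses (fB : zmod_morphism f) (gB : zmod_morphism g).
Hypotheses (PD0 : PD 0) (PDB : forall x y, PD x -> PD y -> PD (x - y)).
Hypothesis gP : forall y, PE y -> PD (g y).
Hypotheses (PE0 : PE 0) (PEB : forall x y, PE x -> PE y -> PE (x - y)).
Variables (kappa c : nat).
Hypothesis fg : forall x, PD x -> g (f x) = x *+ (l ^ kappa * c).
Hypothesis torsD : forall x m, PD x -> (0 < m)%N -> x *+ m = 0 -> x = 0.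
Hypothesis flatD : forall m (a : 'I_m -> k) (z : 'I_m -> D), indep l a ->
  (forall s, PD (z s)) -> \sum_s a s *: rD (z s) = 0 ->
  forall s, exists2 z', PD z' & z s = z' *+ l.

Lemma morph_sumz (A B : zmodType) (h : A -> B) (I : Type) (r : seq I) (x : I -> A) (m : I -> int) :
  zmod_morphism h -> h (\sum_(i <- r) x i *~ m i) = \sum_(i <- r) h (x i) *~ m i.
Proof.
move=> hB; have h0 : h 0 = 0 by have := hB 0 0; rewrite !subrr.
have hN x' : h (- x') = - h x' by rewrite -sub0r hB h0 sub0r.
have hD x' y' : h (x' + y') = h x' + h y' by rewrite -{1}[y']opprK hB hN opprK.
have hM x' m' : h (x' *+ m') = h x' *+ m'.
  by elim: m' => [|m' IH]; rewrite ?mulr0n // !mulrS hD IH.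
rewrite (big_morph h hD h0); apply: eq_bigr => i _.
by case: (m i) => m'; rewrite ?NegzE ?mulrNz ?hN -!pmulrn hM.
Qed.

Lemma sum_mulz_mulrn (A : zmodType) (I : Type) (r : seq I) (x : I -> A) (m : I -> int) (c' : nat) :
  \sum_(i <- r) x i *+ c' *~ m i = (\sum_(i <- r) x i *~ m i) *+ c'.
Proof.
by rewrite -sumrMnl; apply: eq_bigr => i _; rewrite !pmulrn -!mulrzA mulrC.
Qed.

(** All scalars are expanded in one independent family, so flatness applies to each regrouped
    difference: [X s - X' s = l z]. Then [f (l z) = l^i W s] with [W s = Y s - l Y' s], and [g]
    gives [g (W s) = l^(kappa-i+1) c z]. Over [k] the vectors [W s] and [Y s] have the same
    image. *)
Lemma layer_half i (L : seq (k * (D * E))) : (i <= kappa)%N ->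
  (forall p, p \in L -> [/\ PD p.2.1, PE p.2.2 & f p.2.1 = p.2.2 *+ l ^ i]) ->
  lin_span [set rD x | x in [set x | layer l PD PE f i.+1 x]]%classic (\sum_(p <- L) p.1 *: rD p.2.1) ->
  lin_span [set rE y | y in [set y | layer l PE PD g (kappa - i).+1 y]]%classic
    (\sum_(p <- L) p.1 *: rE p.2.2).
Proof.
move=> ik hL /lin_span_seq[L' hL' eL].
have lp : prime l by case/andP: char_k.
have l0 := prime_gt0 lp.
have [m [a [b [ia hb]]]] := indep_coords char_k (map fst L ++ map fst L').
have hb1 p : p \in L -> p.1 = \sum_s (b p.1 s)%:~R * a s.
  by move=> pL; apply: hb; rewrite mem_cat map_f.
have hb2 p : p \in L' -> p.1 = \sum_s (b p.1 s)%:~R * a s.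
  by move=> pL; apply: hb; rewrite mem_cat [X in _ || X]map_f ?orbT.
have regroup (A : eqType) (B : zmodType) (V : lmodType k) (r : B -> V) (M : seq (k * A)) (pr : A -> B) :
    zmod_morphism r -> (forall p, p \in M -> p.1 = \sum_s (b p.1 s)%:~R * a s) ->
    \sum_(p <- M) p.1 *: r (pr p.2) =
    \sum_s a s *: r (\sum_(p <- M) pr p.2 *~ b p.1 s).
  move=> rB h.
  rewrite big_seq (eq_bigr (fun p => \sum_s a s *: (r (pr p.2) *~ b p.1 s))); last first.
    move=> p /h {1}->; rewrite scaler_suml; apply: eq_bigr => s _.
    by rewrite mulrC -scalerA scaler_int.
  rewrite -big_seq exchange_big; apply: eq_bigr => s _.
  by rewrite -scaler_sumr (morph_sumz _ _ _ rB).
pose X s := \sum_(p <- L) p.2.1 *~ b p.1 s.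
pose Y s := \sum_(p <- L) p.2.2 *~ b p.1 s.
pose X' s := \sum_(p <- L') p.2 *~ b p.1 s.
have clo (A : zmodType) (P : A -> Prop) (I : eqType) (r : seq I) (x : I -> A) (e : I -> int) :
    P 0 -> (forall x y, P x -> P y -> P (x - y)) -> (forall i, i \in r -> P (x i)) ->
    P (\sum_(i <- r) x i *~ e i).
  move=> P0 PB hP; have PN x' : P x' -> P (- x') by rewrite -sub0r; apply: PB.
  have PA x' y' : P x' -> P y' -> P (x' + y') by move=> hx hy; rewrite -[y']opprK; apply/PB/PN.
  have PM x' m' : P x' -> P (x' *+ m').
    by move=> hx; elim: m' => [|m' IH]; rewrite ?mulr0n // mulrS; apply: PA.
  rewrite big_seq; elim/big_ind: _ => // i' /hP hi; case: (e i') => m'.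
    by rewrite -pmulrn; apply: PM.
  by rewrite NegzE mulrNz -pmulrn; apply/PN/PM.
have PX s : PD (X s) by apply: clo => // p /hL[].
have PY s : PE (Y s) by apply: clo => // p /hL[].
have PX' s : PD (X' s) by apply: clo => // p /hL'[].
have fX s : f (X s) = Y s *+ l ^ i.
  rewrite (morph_sumz _ _ _ fB) -sum_mulz_mulrn big_seq [RHS]big_seq.
  by apply: eq_bigr => p /hL[_ _ ->].
have [Y' hY'] : exists Y' : 'I_m -> E, forall s, PE (Y' s) /\ f (X' s) = Y' s *+ l ^ i.+1.
  have /boolp.choice[y hy] (p : k * D) : exists y, p \in L' -> PE y /\ f p.2 = y *+ l ^ i.+1.
    have [/hL'[_ [y py e]]|_] := boolP (p \in L'); last by exists 0.
    by exists y.
  exists (fun s => \sum_(p <- L') y p *~ b p.1 s) => s; split.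
    by apply: clo => // p /hy[].
  rewrite (morph_sumz _ _ _ fB) -sum_mulz_mulrn big_seq [RHS]big_seq.
  by apply: eq_bigr => p /hy[_ ->].
have ez s : exists2 z, PD z & X s - X' s = z *+ l.
  apply: (flatD ia (z := fun s' => X s' - X' s')) => [s'|]; first exact: PDB.
  under eq_bigr => s' _ do rewrite rDB scalerBr.
  rewrite sumrB -(regroup _ _ _ rD L (fun p => p.1)) // -(regroup _ _ _ rD L' id) //.
  by rewrite eL subrr.
have rl y : rE (y *+ l) = 0.
  have := @morph_sumz _ _ rE _ [:: tt] (fun=> y) (fun=> l%:Z) rEB.
  by rewrite !big_seq1 -!pmulrn => ->; rewrite -scaler_nat pcharf0 ?scale0r.
pose W s := Y s - Y' s *+ l.
have PEM y m' : PE y -> PE (y *+ m').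
  move=> py; have := clo E PE _ [:: tt] (fun=> y) (fun=> m'%:Z) PE0 PEB (fun _ _ => py).
  by rewrite big_seq1 -pmulrn.
have PDM x m' : PD x -> PD (x *+ m').
  move=> px; have := clo D PD _ [:: tt] (fun=> x) (fun=> m'%:Z) PD0 PDB (fun _ _ => px).
  by rewrite big_seq1 -pmulrn.
have gM y m' : g (y *+ m') = g y *+ m'.
  by have := @morph_sumz _ _ g _ [:: tt] (fun=> y) (fun=> m'%:Z) gB; rewrite !big_seq1 -!pmulrn.
have cW s : layer l PE PD g (kappa - i).+1 (W s).
  have [pY' eY'] := hY' s; have [z pz e] := ez s; split.
    by apply: PEB => //; apply: PEM.
  exists (z *+ c); first exact: PDM.
  have e1 : f (z *+ l) = W s *+ l ^ i.
    by rewrite -e fB fX eY' /W mulrnBl -mulrnA expnS.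
  (* [g (W s)] is accessible only after multiplication by [l^i], where it is [g (f (l z))]; absence
     of torsion removes the factor. *)
  have e2 : (g (W s) - z *+ c *+ l ^ (kappa - i).+1) *+ l ^ i = 0.
    rewrite mulrnBl -gM -e1 fg; last exact: PDM.
    apply/eqP; rewrite subr_eq0 -!mulrnA; apply/eqP; congr (_ *+ _).
    rewrite -expnD [RHS]mulnC mulnA -expnS; congr (l ^ _ * c)%N; lia.
  apply/eqP; rewrite -subr_eq0; apply/eqP; apply: torsD e2.
    by apply: PDB; [apply: gP; apply: PEB => //; apply: PEM | apply/PDM/PDM].
  by rewrite expn_gt0 l0.
rewrite (regroup _ _ _ rE L (fun p => p.2)) // -/Y.
have [S0 SD] := submodule_span [set rE y | y in [set y | layer l PE PD g (kappa - i).+1 y]]%classic.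
elim/big_ind: _ => // [u v hu hv|s _].
  by rewrite -[u]scale1r; apply: SD.
rewrite -[_ *: _]addr0; apply: SD => //.
have -> : rE (\sum_(p <- L) p.2.2 *~ b p.1 s) = rE (W s) by rewrite /W rEB rl subr0.
by apply: Defs.sub_span; exists (W s); first exact: (cW s).
Qed.

End Half.

(** * Isomorphisms given by relations, and subquotients *)

Section RepMachinery.
Local Open Scope classical_set_scope.
Variables (R : nzRingType) (Op : Type).
Implicit Types X Y : rep R Op.

(** A vector of a layer has many expressions through lattice vectors, so the isomorphism is given as
    a linear relation; the two kernel conditions make it a well-defined injective map. *)
Lemma rep_iso_rel X Y (r : X -> Y -> Prop) :
  (forall (a : R) x y x' y', r x y -> r x' y' -> r (a *: x + x') (a *: y + y')) ->
  (forall x, exists y, r x y) -> (forall y, exists x, r x y) ->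
  (forall x, r x 0 -> x = 0) -> (forall y, r 0 y -> y = 0) ->
  (forall g x y, r x y -> r (op g x) (op g y)) -> rep_iso X Y.
Proof.
move=> rl rtot rsurj rinj rfun rop.
have rB x y x' y' : r x y -> r x' y' -> r (x - x') (y - y').
  by move=> h h'; rewrite addrC -scaleN1r [y - y']addrC -[- y']scaleN1r; apply: rl.
have /boolp.choice[f hf] := rtot; have /boolp.choice[g hg] := rsurj.
have fE x y : r x y -> f x = y.
  by move=> h; apply/eqP; rewrite -subr_eq0; apply/eqP/rfun; rewrite -(subrr x); apply: rB.
have gE x y : r x y -> g y = x.
  by move=> h; apply/eqP; rewrite -subr_eq0; apply/eqP/rinj; rewrite -(subrr y); apply: rB.
have flin : linear f by move=> a x x'; apply: fE; apply: rl.
pose lf := GRing.isLinear.Build R X Y *:%R f flin.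
pose f' : {linear X -> Y} := HB.pack f lf.
exists f'; split; first by exists g => [x|y]; [apply: gE | apply: fE].
by move=> a x; apply: fE; apply: rop.
Qed.

Lemma rep_iso_trans X Y Z : rep_iso X Y -> rep_iso Y Z -> rep_iso X Z.
Proof.
move=> [f [bf fo]] [g [bg go]]; apply: (rep_iso_rel (r := fun x z => z = g (f x))).
- by move=> a x y x' y' -> ->; rewrite !linearP.
- by move=> x; exists (g (f x)).
- by case: bf bg => f' fK f'K [g' gK g'K] z; exists (f' (g' z)); rewrite f'K g'K.
- move=> x; rewrite -(linear0 g) => /(bij_inj bg); rewrite -(linear0 f).
  by move=> /(bij_inj bf).
- by move=> z ->; rewrite !linear0.
by move=> a x z ->; rewrite fo go.
Qed.

Lemma quo_eq0 (M : lmodType R) (P : set M) (x : M) : quo P x = 0 <-> lin_span P x.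
Proof.
have := quoP P x 0; rewrite subr0 => <-.
by rewrite (_ : quo P 0 = 0) //; apply: raddf0.
Qed.

Lemma submodP (M : lmodType R) (A : set M) (x : M) : submodule A ->
  A x <-> x \in spanb A.
Proof.
move=> sA; split=> [h|/asboolP]; last by rewrite span_id.
by apply/asboolP; apply: Defs.sub_span.
Qed.

Lemma submod_valP (M : lmodType R) (A : set M) (x : submod A) : submodule A -> A (val x).
Proof. by move=> sA; apply/(submodP _ sA)/valP. Qed.

Lemma val_insubd_submod (M : lmodType R) (A : set M) (x : M) : submodule A -> A x ->
  val (insubd (0 : submod A) x) = x.
Proof. by move=> sA /(submodP _ sA) h; rewrite insubdK. Qed.

Lemma subrep_opE X (A : set X) g (x : subrep A) : op_stable A ->
  val (op g x : submod A) = op g (val (x : submod A)).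
Proof. by move=> [sA oA]; exact: val_insubd_submod sA (oA _ _ (submod_valP _ sA)). Qed.

Section SubQuo.
Variables (X : rep R Op) (A B : set X).
Hypotheses (sA : op_stable A) (sB : op_stable B) (opB : forall g, zmod_morphism (op g : X -> X)).

(** The class of a vector of the ambient module; outside [A] it takes the default value, so the
    lemmas that compute with it assume [A x]. *)
Definition sqclass (x : X) : subquorep A B := quo _ (insubd (0 : submod A) x).

Let B' : set (subrep A) := [set x : subrep A | B (val (x : submod A))].

Lemma sq_submodule : submodule B'.
Proof.
have [[B0 BD] _] := sB; split; first exact: B0.
by move=> a x y hx hy; apply: BD.
Qed.

Lemma sqclass_surj (z : subquorep A B) : exists2 x, A x & z = sqclass x.
Proof.
exists (val (repr (z : quomod B') : submod A)); first exact: submod_valP sA.1.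
by rewrite /sqclass valKd -[LHS]quo_repr.
Qed.

Lemma insubd_lin a x y : A x -> A y ->
  insubd (0 : submod A) (a *: x + y) = a *: insubd (0 : submod A) x + insubd (0 : submod A) y.
Proof.
move=> hx hy; apply: val_inj.
rewrite (val_insubd_submod sA.1 (sA.1.2 _ _ _ hx hy)) /=.
by rewrite (val_insubd_submod sA.1 hx) (val_insubd_submod sA.1 hy).
Qed.

Lemma sqclass_lin a x y : A x -> A y -> sqclass (a *: x + y) = a *: sqclass x + sqclass y.
Proof.
move=> hx hy; rewrite /sqclass insubd_lin // raddfD; congr (_ + _).
exact/esym/quo_scaleE.
Qed.

Lemma sqclass_eq0 x : A x -> sqclass x = 0 <-> B x.
Proof.
move=> hx; apply: (iff_trans (quo_eq0 B' _)); rewrite (span_id sq_submodule) /B' /=.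
by rewrite (val_insubd_submod sA.1 hx).
Qed.

Lemma sqclass_op g x : A x -> op g (sqclass x) = sqclass (op g x).
Proof.
move=> hx; rewrite [LHS]/= /sqclass; apply/quoP; rewrite (span_id sq_submodule).
set u := repr _.
have hB : B (val (u : submod A) - x).
  have : lin_span B' ((u : submod A) - insubd (0 : submod A) x) by apply/quoP; rewrite quo_repr.
  rewrite (span_id sq_submodule) /B' /=.
  by rewrite (val_insubd_submod sA.1 hx).
rewrite /B' /= (val_insubd_submod sA.1 (sA.2 g _ hx)).
rewrite (val_insubd_submod sA.1 (sA.2 g _ (submod_valP u sA.1))).
by rewrite -opB; apply: sB.2.
Qed.

End SubQuo.
End RepMachinery.

(** * Generators and coefficients in an extension of scalars *)

Section ExtScalars.
Variables (k : fieldType) (M : zmodType).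

Lemma tens1B : zmod_morphism (@tens1 k M).
Proof.
have addt (x y : M) : tens1 k (x + y) = tens1 k x + tens1 k y.
  apply/eqP; rewrite -subr_eq0 opprD addrA; apply/eqP.
  rewrite /tens1 -!raddfB; apply/quo_eq0.
  by apply: Defs.sub_span; exists x, y.
by move=> x y; apply/eqP; rewrite eq_sym subr_eq -addt subrK.
Qed.

Lemma extscal_gen (z : extscal k M) :
  exists L : seq (k * M), z = \sum_(p <- L) p.1 *: tens1 k p.2.
Proof.
rewrite -[z]quo_repr; elim/(@freeg_ind1 k M): (repr _).
  split; first by exists [::]; rewrite big_nil raddf0.
  move=> a x y [L eL] [L' eL']; exists ([seq (a * p.1, p.2) | p <- L] ++ L').
  rewrite raddfD [X in X + _](esym (quo_scaleE _ a x)) [X in _ + X]eL' eL.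
  rewrite big_cat big_map; congr (_ + _).
  transitivity (a *: \sum_(p <- L) p.1 *: tens1 k p.2); first by [].
  by rewrite scaler_sumr; apply: eq_bigr => p _; rewrite scalerA.
by move=> x; exists [:: (1, x)]; rewrite big_seq1 scale1r.
Qed.

Section Lift.
Variables (N : lmodType k) (f : M -> N).
Hypothesis fB : zmod_morphism f.

Lemma extscal_lift0 : extscal_lift f 0 = 0.
Proof.
by have := extscal_lift_linear fB (-1) 0 0; rewrite scaler0 addr0 scaleN1r addNr.
Qed.

Lemma extscal_lift_sum (I : Type) (r : seq I) (a : I -> k) (x : I -> M) :
  extscal_lift f (\sum_(i <- r) a i *: tens1 k (x i)) = \sum_(i <- r) a i *: f (x i).
Proof.
elim: r => [|i r IH]; first by rewrite !big_nil extscal_lift0.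
by rewrite !big_cons (extscal_lift_linear fB) IH (extscal_lift_tens1 fB).
Qed.
End Lift.

Variable l : nat.
Hypothesis char_k : l \in [pchar k].

Lemma extscal_indep (z : extscal k M) : exists m (a : 'I_m -> k) (x : 'I_m -> M),
  indep l a /\ z = \sum_s a s *: tens1 k (x s).
Proof.
have [L ->] := extscal_gen z.
have [m [a [b [ia hb]]]] := indep_coords char_k (map fst L).
exists m, a, (fun s => \sum_(p <- L) p.2 *~ b p.1 s); split=> //.
rewrite big_seq (eq_bigr (fun p => \sum_s a s *: (tens1 k p.2 *~ b p.1 s))); last first.
  move=> p /(map_f fst) /hb {1}->; rewrite scaler_suml; apply: eq_bigr => s _.
  by rewrite mulrC -scalerA scaler_int.
rewrite -big_seq exchange_big; apply: eq_bigr => s _.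
by rewrite -scaler_sumr (morph_sumz _ _ _ tens1B).
Qed.

End ExtScalars.

(** * Duality of the two lattices *)

Section Lattices.
Variables (F : finFieldType) (n : nat).
Local Notation T := {vspace 'cV[F]_n.+1}.
Local Notation G := {'GL_n.+1[F]}.
Local Notation PGalg := (PGalg F n).
Local Notation PGop := (PGop F n).
Local Notation Delta0 := (Delta0 F n).
Local Notation St := (St F n int).
Local Notation moved := (@moved F n).
Local Notation pgl := (@pgl F n).
Local Notation w0 := (@w0 n).
Local Notation top_flags := (@top_flags F n).
Implicit Types (C V W X Y Z : T) (s t : seq T) (g h u : G).
Implicit Types (x y : Delta0) (z : St).

Lemma is_fpath_mid s t C V X : mid C V X ->
  is_fpath (s ++ [:: V, X, C & t]) = is_fpath (s ++ [:: V]) && is_fpath (C :: t).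
Proof.
case/andP=> c1 c2; rewrite /is_fpath; case: s => [|W s] /=.
  by rewrite c2 c1 !orbT.
by rewrite !cat_path /= c2 c1 !orbT /= andbT andbA.
Qed.

Lemma cls_not_fpath s : ~~ is_fpath s -> cls s = 0 :> PGalg.
Proof. by move=> h; rewrite /cls /walk insubN //; apply: raddf0. Qed.

(** The class map is itself a Steinberg function with values in the algebra, so the straightening of
    flags applies to classes without a second proof. *)
Lemma cls_steinberg : steinberg (@cls F n).
Proof.
move=> s t C V r.
have [|nf] := boolP (is_fpath (s ++ [:: V]) && is_fpath (C :: t)); last first.
  by rewrite big1 // => X mX; rewrite cls_not_fpath // is_fpath_mid.
case/andP=> f1 f2.
transitivity (\sum_(X | mid C V X) cls (s ++ [:: V]) * cls [:: V; X; C] * cls (C :: t)).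
  apply: eq_bigr => X mX; have [c1 c2] := andP mX.
  have f3 : is_fpath [:: V; X; C] by rewrite is_fpath3 ?c1 ?c2 ?orbT.
  rewrite clsM // last_cat /= eqxx -catA /= clsM ?last_cat /= ?eqxx -?catA //.
  have := is_fpath_mid s [::] mX; rewrite f1 /= => -> //.
rewrite -big_distrl -big_distrr /=.
have -> : \sum_(X | mid C V X) cls [:: V; X; C] = 0 :> PGalg.
  rewrite -[LHS](raddf_sum (@PGclass F n)); apply: PGclass_pg_relation.
  by case/andP: r => CV /eqP dV; apply: FS_down.
by rewrite mulr0 mul0r.
Qed.

Lemma GL_PGalg_lin g (a : int) (v w : PGalg) :
  GL_PGalg g (a *: v + w) = a *: GL_PGalg g v + GL_PGalg g w.
Proof.
rewrite -[v]PGclass_repr -[w]PGclass_repr -PGclassZ -PGclassD !GL_PGclass.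
by rewrite lift_walk_lin PGclassD PGclassZ.
Qed.

Lemma GL_PGalg0 g : GL_PGalg g 0 = 0 :> PGalg.
Proof. by have := GL_PGalg_lin g (-1) 0 0; rewrite scaler0 addr0 scaleN1r addNr. Qed.

Lemma GL_PGalgZ g (a : int) (v : PGalg) : GL_PGalg g (a *: v) = a *: GL_PGalg g v.
Proof. by have := GL_PGalg_lin g a v 0; rewrite GL_PGalg0 !addr0. Qed.

Lemma GL_PGalgM g (v w : PGalg) : GL_PGalg g (v * w) = GL_PGalg g v * GL_PGalg g w.
Proof.
rewrite -[v]PGclass_repr -[w]PGclass_repr [_ * _]PGclassM !GL_PGclass lift_walk_GLM.
by rewrite -PGclassM.
Qed.

Lemma GL_cls g s : is_fpath s -> GL_PGalg g (cls s) = cls (map (GL_subspace g) s).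
Proof. by move=> h; rewrite GL_PGclass lift_walkE. Qed.

Lemma GL_flag_span g (v : PGalg) : flag_span v -> flag_span (GL_PGalg g v).
Proof.
elim/flag_span_ind => [|s ds].
  split=> [|a v' w hv hw]; first by rewrite GL_PGalg0; apply: flag_span0.
  by rewrite GL_PGalg_lin; exact: ((flag_span_sub F n).2 a _ _ hv hw).
by rewrite GL_cls ?down_flag_fpath //; apply: flag_span_cls; rewrite GL_down_flag.
Qed.

Lemma Phi_GL g (v : PGalg) t : flag_span v ->
  Phi (GL_PGalg g v) (map (GL_subspace g) t) = Phi v t.
Proof.
move=> hv; have [dt|nt] := boolP (down_flag t); last first.
  by rewrite !Phi_flag_fun ?GL_down_flag.
have := congr1 (@GL_PGalg F n g) (cls_rev_mul dt hv).
rewrite GL_PGalgM GL_PGalgZ !GL_cls ?is_fpath1 ?is_fpath_rev ?down_flag_fpath // map_rev.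
rewrite cls_rev_mul ?GL_down_flag //; last exact: GL_flag_span.
move=> /(congr1 (fun w => Phi w [:: 0%VS])).
by rewrite /= GL_subspace0 !PhiZ Phi_zero !mulr1.
Qed.

Lemma dval_opS (s : PGalg) x : dval (op (inl s : PGop) x) = s * dval x.
Proof.
rewrite /dval /= val_insubd_submod //; first exact: Delta0_ideal_sub.
by apply/Delta0_idealP; apply: flag_span_mul; apply: dvalP.
Qed.

Lemma dval_opG g x : dval (op (inr g : PGop) x) = GL_PGalg g (dval x).
Proof.
rewrite /dval /= val_insubd_submod //; first exact: Delta0_ideal_sub.
by apply/Delta0_idealP; apply: GL_flag_span; apply: dvalP.
Qed.

Lemma stval_opG (R : comNzRingType) g (y : Defs.St F n R) h :
  stval (op g y) h = stval y (g^-1 * h)%g.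
Proof.
rewrite /stval /= insubdK ?ffunE //.
apply/asboolP/StP; have [phi st e] := stvalP y.
exists (fun t => phi (map (GL_subspace g^-1%g) t)); first exact: steinberg_GL.
by move=> h'; rewrite ffunE -/(stval y) e movedM.
Qed.

Definition topD x := cls [:: fullv] * dval x = dval x.

Lemma cls_top s : is_fpath s -> cls [:: fullv] * cls s =
  if head 0%VS s == fullv then cls s else 0 :> PGalg.
Proof.
by move=> hs; rewrite clsM // eq_sym /=; case: eqP => // e; case: s hs e => //= V s _ ->.
Qed.

Lemma Phi_top_head (v : PGalg) t : cls [:: fullv] * v = v -> head 0%VS t != fullv -> Phi v t = 0.
Proof.
move=> <- nt; rewrite Phi_mul actS_cls //; last 2 first.
- exact: Phi_steinberg.
- exact: Phi_flag_fun.
exact: act_head.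
Qed.

Lemma topD0 : topD 0. Proof. exact: mulr0. Qed.

Lemma topDB x y : topD x -> topD y -> topD (x - y).
Proof. by rewrite /topD dvalB mulrBr => -> ->. Qed.

Lemma topD_opG g x : topD x -> topD (op (inr g : PGop) x).
Proof.
rewrite /topD dval_opG => h; rewrite -{2}h GL_PGalgM GL_cls //=.
by rewrite GL_subspacef.
Qed.

Lemma top_decomp (v : PGalg) : flag_span v -> cls [:: fullv] * v = v ->
  exists c : G -> int, v = \sum_(u : G | upper_unitri (GLval u)) c u *: cls (moved (u * pgl w0)%g).
Proof.
pose N (v : PGalg) := exists c : G -> int,
  v = \sum_(u : G | upper_unitri (GLval u)) c u *: cls (moved (u * pgl w0)%g).
have N0 : N 0 by exists (fun=> 0); rewrite big1 // => u _; rewrite scale0r.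
have NL a (v1 v2 : PGalg) : N v1 -> N v2 -> N (a *: v1 + v2).
  move=> [c ->] [c' ->]; exists (fun u => a * c u + c' u).
  by rewrite scaler_sumr -big_split /=; apply: eq_bigr => u _; rewrite scalerDl scalerA.
have Ntop t : t \in top_flags -> N (cls t).
  rewrite mem_top_flags => /andP[dt /eqP ht].
  apply: (opposite_ind N0 _ cls_steinberg (@std_up_frame F n) _ dt ht).
    by move=> v1 v2 h1 h2; rewrite addrC -scaleN1r; apply: NL.
  move=> s ds hs os; have [|u hu <-] := opposite_unitri (t := s) _ os.
    by rewrite mem_top_flags ds hs eqxx.
  exists (fun g => (g == u)%:R); rewrite (bigD1 u) //= eqxx scale1r big1 ?addr0 //.
  by move=> g /andP[_ /negbTE ->]; rewrite scale0r.
move=> hv <-; elim/flag_span_ind: v / hv => [|s ds].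
  split=> [|a v1 v2 h1 h2]; first by rewrite mulr0.
  by rewrite mulrDr PGalg_mulZr; apply: NL.
rewrite cls_top ?down_flag_fpath //; case: ifP => // hs; apply: Ntop.
by rewrite mem_top_flags ds hs.
Qed.

Definition pr x z : int := pairing (dval x) (stf z).

Lemma pr_linl (a : int) x y z : pr (a *: x + y) z = a * pr x z + pr y z.
Proof.
by rewrite /pr dval_lin pairing_linl //; [apply: stf_steinberg | apply: stf_flag_fun].
Qed.

Lemma unip_moved u u' : upper_unitri (GLval u) -> upper_unitri (GLval u') ->
  stf (unip int u') (moved (u * pgl w0)%g) = (-1) ^+ w0 * (u == u')%:R.
Proof.
by move=> hu hu'; rewrite stf_moved stval_mkSt; apply: ebar_unitri.
Qed.

(** The coefficients on the opposite flags are read off by pairing with the translates of Gow's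
    element, by the duality [ebar_unitri]. In particular they are unique. *)
Lemma top_coords x : topD x -> exists c : G -> int,
  dval x = \sum_(u : G | upper_unitri (GLval u)) c u *: cls (moved (u * pgl w0)%g) /\
  forall u, upper_unitri (GLval u) -> c u = (-1) ^+ w0 * pr x (unip int u).
Proof.
move=> tx; have [c e] := top_decomp (dvalP x) tx; exists c; split=> // u hu.
have st := stf_steinberg (unip int u); have ff := stf_flag_fun (unip int u).
rewrite /pr e.
have -> : pairing (\sum_(u0 : G | upper_unitri (GLval u0)) c u0 *: cls (moved (u0 * pgl w0)%g))
   (stf (unip int u)) =
   \sum_(u0 : G | upper_unitri (GLval u0)) c u0 * stf (unip int u) (moved (u0 * pgl w0)%g).
  have D v1 v2 : pairing (v1 + v2) (stf (unip int u)) =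
      pairing v1 (stf (unip int u)) + pairing v2 (stf (unip int u)).
    by rewrite -[v1]scale1r pairing_linl // mul1r scale1r.
  rewrite (big_morph (fun v => pairing v (stf (unip int u))) D (pairing0 st ff)).
  apply: eq_bigr => u0 _; rewrite -[_ *: _]addr0 pairing_linl // pairing0 // addr0.
  by rewrite pairing_cls // moved_flag.
rewrite (bigD1 u) //= big1 ?addr0 => [|u0 /andP[h0 ne]].
  by rewrite unip_moved // eqxx mulr1 mulrCA -signr_addb addbb mulr1.
by rewrite unip_moved // (negbTE ne) !mulr0.
Qed.

(** The coordinates of [x] are, up to sign, among its pairings, so they can be divided one by
    one. *)
Lemma perfect_pairing x (m : nat) : topD x -> (forall z, (m%:Z %| pr x z)%Z) ->
  exists2 x', topD x' & x = x' *+ m.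
Proof.
move=> tx h; have [c [e hc]] := top_coords tx.
pose v : PGalg := \sum_(u : G | upper_unitri (GLval u))
  (c u %/ m%:Z)%Z *: cls (moved (u * pgl w0)%g).
have sv : flag_span v.
  rewrite /v; elim/big_ind: _ => [|v1 v2 h1 h2|u _]; first exact: flag_span0.
    by rewrite -[v1]scale1r; apply: (flag_span_sub F n).2.
  by apply: flag_spanZ; apply: flag_span_cls; apply: moved_flag.
exists (mkD sv).
  rewrite /topD dval_mkD /v big_distrr /=; apply: eq_bigr => u _.
  by rewrite PGalg_mulZr cls_top ?down_flag_fpath ?moved_flag // moved_head eqxx.
apply: dval_inj; rewrite -scaler_nat -[_ *: _]addr0 dval_lin dval_mkD.
rewrite (_ : dval 0 = 0) // addr0 e /v scaler_sumr; apply: eq_bigr => u hu.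
by rewrite scalerA mulrC natz divzK // hc // dvdz_mull.
Qed.

Lemma pairing_nondeg x : topD x -> (forall z, pr x z = 0) -> x = 0.
Proof.
move=> tx h; have [c [e hc]] := top_coords tx; apply: dval_inj; rewrite e big1 // => u hu.
by rewrite hc // h mulr0 scale0r.
Qed.

Definition Pnum : nat := qfact F n.+1.

Lemma iota_subproof z : flag_span (\sum_(t <- top_flags) stf z t *: cls t).
Proof.
rewrite big_seq; elim/big_ind: _ => [|v1 v2 h1 h2|t]; first exact: flag_span0.
  by rewrite -[v1]scale1r; apply: (flag_span_sub F n).2.
rewrite mem_top_flags => /andP[dt _].
by apply: flag_spanZ; apply: flag_span_cls.
Qed.

Definition toSt x : St := mkSt (Phi_steinberg (dval x)).
Definition toD z : Delta0 := mkD (iota_subproof z).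

Lemma stf_toSt x t : t \in top_flags -> stf (toSt x) t = Phi (dval x) t.
Proof. exact: stf_mkSt. Qed.

Lemma toSt_moved x g : stval (toSt x) g = Phi (dval x) (moved g).
Proof. exact: stval_mkSt. Qed.

Lemma topD_toD z : topD (toD z).
Proof.
rewrite /topD dval_mkD big_distrr /= big_seq [RHS]big_seq; apply: eq_bigr => t.
rewrite mem_top_flags => /andP[dt ht].
by rewrite PGalg_mulZr cls_top ?down_flag_fpath // ht.
Qed.

Lemma pairing_toD z phi : steinberg phi -> flag_fun phi ->
  pairing (dval (toD z)) phi = \sum_(t <- top_flags) stf z t * phi t.
Proof.
move=> st ff; rewrite dval_mkD big_seq [RHS]big_seq.
have D v1 v2 : pairing (v1 + v2) phi = pairing v1 phi + pairing v2 phi.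
  by rewrite -[v1]scale1r pairing_linl // mul1r scale1r.
rewrite (big_morph (fun v => pairing v phi) D (pairing0 st ff)).
apply: eq_bigr => t; rewrite mem_top_flags => /andP[dt _].
by rewrite -[_ *: _]addr0 pairing_linl // pairing0 // addr0 pairing_cls.
Qed.

Lemma Phi_toD z t : Phi (dval (toD z)) t = stf z t *+ Pnum.
Proof.
have [tt|nt] := boolP (t \in top_flags); last first.
  rewrite /stf (negbTE nt) mul0rn; move: nt; rewrite mem_top_flags negb_and => /orP[nd|nh].
    exact: Phi_flag_fun.
  exact: Phi_top_head (topD_toD z) nh.
have /andP[dt /eqP ht] : down_flag t && (head 0%VS t == fullv) by rewrite -mem_top_flags.
have := sum_flags_Phi (stf_steinberg z) dt; rewrite /= ht dim_fullv => <-.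
rewrite dval_mkD (big_morph (fun v => Phi v t) (fun v w => PhiD v w t) (Phi0 t)).
by apply: eq_bigr => s _; rewrite PhiZ.
Qed.

Lemma toSt_toD z : toSt (toD z) = z *+ Pnum.
Proof.
apply: stf_ext => t tt; rewrite stf_toSt // Phi_toD -scaler_nat -[_ *: _]addr0 stf_lin stf0.
by rewrite addr0 mulr_natl.
Qed.

(** Tested against every [z]: [toSt] and [toD] are adjoint by the symmetry of the form, which moves
    the composite onto [z], where [Phi_toD] computes it. *)
Lemma toD_toSt x : topD x -> toD (toSt x) = x *+ Pnum.
Proof.
move=> tx; apply/eqP; rewrite -subr_eq0; apply/eqP; apply: pairing_nondeg => [|z].
  apply: topDB; first exact: topD_toD.
  rewrite /topD -scaler_nat -[_ *: _]addr0 dval_lin (_ : dval 0 = 0) // addr0.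
  by rewrite PGalg_mulZr tx.
have stP w := @Phi_steinberg F n w; have ffP w := @Phi_flag_fun F n w.
rewrite addrC -scaler_nat -scaleNr pr_linl; apply/eqP; rewrite mulNr addrC subr_eq0; apply/eqP.
rewrite {1}/pr pairing_toD; [|exact: stf_steinberg|exact: stf_flag_fun].
have -> : \sum_(t <- top_flags) stf (toSt x) t * stf z t = pairing (dval (toD z)) (Phi (dval x)).
  rewrite pairing_toD // big_seq [RHS]big_seq; apply: eq_bigr => t tt.
  by rewrite stf_toSt // mulrC.
rewrite pairing_sym; [|exact: dvalP|exact: dvalP].
have -> : Phi (dval (toD z)) = fun t => Pnum%:R * stf z t + 0.
  by apply: funext => t; rewrite Phi_toD mulr_natl addr0.
rewrite (pairing_linr Pnum%:R (dval x) (stf z) (fun=> 0)).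
rewrite (_ : pairing _ (fun=> 0) = 0) ?addr0 //.
by rewrite /pairing /actS actA_0r.
Qed.

Lemma toStB : zmod_morphism toSt.
Proof.
move=> x y; apply: stf_ext => t tt; rewrite stf_toSt // dvalB addrC -scaleN1r Phi_lin.
by rewrite -[_ - toSt y]addrC -scaleN1r stf_lin !stf_toSt.
Qed.

Lemma toDB : zmod_morphism toD.
Proof.
move=> y z; apply: dval_inj; rewrite dvalB !dval_mkD -sumrB; apply: eq_bigr => t _.
by rewrite -scalerBl -[y - z]addrC -scaleN1r stf_lin mulN1r addrC.
Qed.

Lemma toSt_opG g x : toSt (op (inr g : PGop) x) = op g (toSt x).
Proof.
apply/stval_inj/ffunP => h; rewrite toSt_moved dval_opG stval_opG toSt_moved.
by rewrite -{1}[h](mulKVg g) movedM Phi_GL //; apply: dvalP.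
Qed.

End Lattices.

(** * Reduction to the field k *)

Section Reduction.
Local Open Scope classical_set_scope.
Variables (F : finFieldType) (n : nat) (k : fieldType) (l : nat).
Hypothesis char_k : l \in [pchar k].
Local Notation T := {vspace 'cV[F]_n.+1}.
Local Notation G := {'GL_n.+1[F]}.
Local Notation PGalg := (PGalg F n).
Local Notation PGop := (PGop F n).
Local Notation PGopk := (PGopk F n k).
Local Notation Delta0 := (Delta0 F n).
Local Notation Delta0k := (Delta0k F n k).
Local Notation St := (St F n int).
Local Notation Stk := (Defs.St F n k).
Local Notation moved := (@moved F n).
Local Notation top_flags := (@top_flags F n).
Implicit Types (t : seq T) (s : PGalg) (g h : G) (x y : Delta0) (z : St) (X Y : Delta0k).

Lemma char_prime : prime l. Proof. by case/andP: char_k. Qed.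

Lemma opSB (s : PGalg) : zmod_morphism (fun x => op (inl s : PGop) x).
Proof. by move=> x y; apply: dval_inj; rewrite dvalB !dval_opS dvalB mulrBr. Qed.

Lemma opGB g : zmod_morphism (fun x => op (inr g : PGop) x).
Proof.
move=> x y; apply: dval_inj; rewrite dvalB !dval_opG dvalB addrC -scaleN1r GL_PGalg_lin.
by rewrite scaleN1r addrC.
Qed.

Lemma tens_comp (f : Delta0 -> Delta0) : zmod_morphism f -> zmod_morphism (fun x => tens1 k (f x)).
Proof. by move=> fB x y; rewrite fB tens1B. Qed.

(** The inner of the two nested lifts in [Delta0k]; its additivity in [s] ([kactBl]) lets the outer
    lift be computed. *)
Definition kact (s : PGalg) (X : Delta0k) : Delta0k :=
  extscal_lift (fun x => tens1 k (op (inl s : PGop) x)) X.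

Lemma kact_lin s a X Y : kact s (a *: X + Y) = a *: kact s X + kact s Y.
Proof. exact: (extscal_lift_linear (tens_comp (opSB s))). Qed.

Lemma kact_tens s x : kact s (tens1 k x) = tens1 k (op (inl s : PGop) x).
Proof. exact: (extscal_lift_tens1 (tens_comp (opSB s))). Qed.

Lemma Delta0k_ind (P : Delta0k -> Prop) : submodule P -> (forall x, P (tens1 k x)) -> forall X, P X.
Proof.
move=> [P0 PD] h X; have [L ->] := extscal_gen X.
elim: L => [|p L IH]; first by rewrite big_nil.
by rewrite big_cons; apply: PD.
Qed.

Lemma kact0 s : kact s 0 = 0.
Proof. by have := kact_lin s (-1) 0 0; rewrite scaler0 addr0 scaleN1r addNr. Qed.

Lemma kactBl X : zmod_morphism (fun s => kact s X).
Proof.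
move=> s s'; elim/Delta0k_ind: X => [|x].
  split=> [|a X Y hX hY]; first by rewrite !kact0 subr0.
  by rewrite !kact_lin hX hY scalerBr opprD addrACA.
rewrite !kact_tens -tens1B; congr (tens1 k _); apply: dval_inj.
by rewrite dvalB !dval_opS mulrBl.
Qed.

Lemma op_inl_tens (a : k) s X : op (inl (a *: tens1 k s) : PGopk) X = a *: kact s X.
Proof.
rewrite -[a *: tens1 k s]addr0 /= (extscal_lift_linear (kactBl X)).
by rewrite (extscal_lift_tens1 (kactBl X)) (extscal_lift0 (kactBl X)) addr0.
Qed.

Lemma op_inl_tens1 s X : op (inl (tens1 k s) : PGopk) X = kact s X.
Proof. exact: (extscal_lift_tens1 (kactBl X)). Qed.

Lemma op_inl_sum (L : seq (k * PGalg)) X :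
  op (inl (\sum_(p <- L) p.1 *: tens1 k p.2) : PGopk) X = \sum_(p <- L) p.1 *: kact p.2 X.
Proof. exact: (extscal_lift_sum (kactBl X)). Qed.

Lemma op_inr_lin g a X Y : op (inr g : PGopk) (a *: X + Y) =
  a *: op (inr g : PGopk) X + op (inr g : PGopk) Y.
Proof. exact: (extscal_lift_linear (tens_comp (opGB g))). Qed.

Lemma op_inr0 g : op (inr g : PGopk) (0 : Delta0k) = 0.
Proof. by have := op_inr_lin g (-1) 0 0; rewrite scaler0 addr0 scaleN1r addNr. Qed.

Lemma op_inr_tens g x : op (inr g : PGopk) (tens1 k x : Delta0k) = tens1 k (op (inr g : PGop) x).
Proof. exact: (extscal_lift_tens1 (tens_comp (opGB g))). Qed.

Lemma op_lin (o : PGopk) a X Y : op o (a *: X + Y) = a *: op o X + op o Y :> Delta0k.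
Proof.
case: o => [t|g]; last exact: op_inr_lin.
have [L ->] := extscal_gen t; rewrite !op_inl_sum scaler_sumr -big_split /=.
by apply: eq_bigr => p _; rewrite kact_lin scalerDr !scalerA mulrC.
Qed.

Lemma op_zmod (o : PGopk) : zmod_morphism (op o : Delta0k -> Delta0k).
Proof. by move=> X Y; rewrite addrC -scaleN1r op_lin scaleN1r addrC. Qed.

Lemma dvd_expz (i : nat) (a : int) : (l%:Z ^+ i %| a)%Z = ((l ^ i)%N%:Z %| a)%Z.
Proof. by rewrite -[(l ^ i)%N%:Z]natz natrX natz. Qed.

Definition divD i x := forall t, ((l ^ i)%N%:Z %| Phi (dval x) t)%Z.

Lemma Delta0_filtrationE i x : Delta0_filtration l i x <-> divD i x.
Proof.
split=> [h t|h v].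
  have [dt|/(@Phi_flag_fun F n (dval x)) ->] := boolP (down_flag t); last exact: dvdz0.
  have := h (mkD (flag_span_cls dt)); rewrite Delta0_formE dval_mkD dvd_expz.
  by rewrite pairing_cls //; [apply: Phi_steinberg | apply: Phi_flag_fun].
rewrite dvd_expz Delta0_formE.
have -> : Phi (dval x) = fun t => (l ^ i)%N%:Z * (Phi (dval x) t %/ (l ^ i)%N%:Z)%Z + 0.
  by apply: funext => t; rewrite addr0 mulrC divzK.
rewrite (pairing_linr (l ^ i)%N%:Z (dval v) (fun t => (Phi (dval x) t %/ (l ^ i)%N%:Z)%Z) (fun=> 0)).
by rewrite (_ : pairing _ (fun=> 0) = 0) ?addr0 ?dvdz_mulr // /pairing /actS actA_0r.
Qed.

Local Notation filt := (@Delta0k_filtration F n k l).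

Lemma filt_sub i : submodule (filt i). Proof. exact: submodule_span. Qed.

Lemma filt_tens i x : divD i x -> filt i (tens1 k x).
Proof. by move=> h; apply: Defs.sub_span; exists x => //; apply/Delta0_filtrationE. Qed.

Lemma filt_ind i (P : Delta0k -> Prop) : submodule P ->
  (forall x, divD i x -> P (tens1 k x)) -> forall X, filt i X -> P X.
Proof. by move=> sP h X hX; apply: (hX P) => // _ [x /Delta0_filtrationE dx <-]; apply: h. Qed.

Lemma filt0 X : filt 0 X.
Proof.
elim/Delta0k_ind: X => [|x]; first exact: filt_sub.
by apply: filt_tens => t; rewrite expn0 dvd1z.
Qed.

Lemma divD_opS i s x : divD i x -> divD i (op (inl s : PGop) x).
Proof.
move=> h t; rewrite dval_opS Phi_mul.
have -> : Phi (dval x) = fun t => (l ^ i)%N%:Z * (Phi (dval x) t %/ (l ^ i)%N%:Z)%Z + 0.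
  by apply: funext => u; rewrite addr0 mulrC divzK.
rewrite (actS_linr (l ^ i)%N%:Z s (fun t => (Phi (dval x) t %/ (l ^ i)%N%:Z)%Z) (fun=> 0)).
by rewrite /actS actA_0r addr0 dvdz_mulr.
Qed.

Lemma divD_opG i g x : divD i x -> divD i (op (inr g : PGop) x).
Proof.
move=> h t; rewrite dval_opG; have := GL_mapK g^-1%g t; rewrite invgK => <-.
by rewrite Phi_GL //; apply: dvalP.
Qed.

Lemma kact_filt i s X : filt i X -> filt i (kact s X).
Proof.
elim/filt_ind => [|x dx]; last by rewrite kact_tens; exact: filt_tens (divD_opS _ dx).
have [f0 fD] := filt_sub i.
by split=> [|a Y Z hY hZ]; rewrite ?kact0 // kact_lin; apply: fD.
Qed.

Lemma filt_stable i : op_stable (filt i).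
Proof.
have [f0 fD] := filt_sub i; split=> [|o X hX]; first exact: filt_sub.
case: o => [t|g].
  have [L ->] := extscal_gen t; rewrite op_inl_sum.
  elim: L => [|p L IH]; first by rewrite big_nil.
  by rewrite big_cons; apply: fD => //; apply: kact_filt.
elim/filt_ind: X / hX => [|x dx]; last by rewrite op_inr_tens; exact: filt_tens (divD_opG _ dx).
split=> [|a Y Z hY hZ]; last by rewrite op_inr_lin; apply: fD.
by rewrite op_inr0.
Qed.

Definition Phik t X : k := extscal_lift (fun x => (Phi (dval x) t)%:~R : k^o) X.

Lemma PhikB t : zmod_morphism (fun x => (Phi (dval x) t)%:~R : k^o).
Proof.
move=> x y; rewrite dvalB addrC -scaleN1r Phi_lin mulN1r addrC.
by rewrite rmorphB.
Qed.

Lemma Phik_lin t a X Y : Phik t (a *: X + Y) = a * Phik t X + Phik t Y.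
Proof. exact: (extscal_lift_linear (PhikB t)). Qed.

Lemma Phik_tens t x : Phik t (tens1 k x) = (Phi (dval x) t)%:~R.
Proof. exact: (extscal_lift_tens1 (PhikB t)). Qed.

Lemma Phik0 t : Phik t 0 = 0.
Proof. by have := Phik_lin t (-1) 0 0; rewrite scaler0 addr0 mulN1r addNr. Qed.

(** Says that the first step of the filtration is the radical of the form reduced to [k]. *)
Lemma filt1E X : filt 1 X <-> forall t, down_flag t -> Phik t X = 0.
Proof.
split=> [hX t _|h].
  elim/filt_ind: X / hX => [|x dx].
    by split=> [|a Y Z hY hZ]; rewrite ?Phik0 // Phik_lin hY hZ mulr0 addr0.
  by rewrite Phik_tens; apply/eqP; rewrite (intr_eq0_char char_k) -(expn1 l).
have [m [a [x [ia eX]]]] := extscal_indep char_k X.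
(* With coefficients independent over the prime field, the vanishing of [Phik t X] forces [l] to
   divide each value separately. *)
have hx (s : 'I_m) : divD 1 (x s).
  move=> t; rewrite expn1.
  have [dt|/(@Phi_flag_fun F n (dval (x s))) ->] := boolP (down_flag t); last exact: dvdz0.
  apply: (ia (fun i => Phi (dval (x i)) t)).
  have := h t dt; rewrite eX /Phik (extscal_lift_sum (PhikB t)) => e.
  by rewrite -[RHS]e; apply: eq_bigr => s' _; rewrite mulrC.
have [f0 fD] := filt_sub 1.
rewrite eX; elim/big_ind: _ => // [u v hu hv|s _].
  by rewrite -[u]scale1r; apply: fD.
by rewrite -[_ *: _]addr0; apply: fD => //; apply: filt_tens.
Qed.

Lemma zero_flag : down_flag [:: 0%VS : T]. Proof. by rewrite down_flag1. Qed.

Definition vac0 : Delta0 := mkD (flag_span_cls zero_flag).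

Lemma kact_rev t X : down_flag t -> kact (cls (rev t)) X = Phik t X *: tens1 k vac0.
Proof.
move=> dt; elim/Delta0k_ind: X => [|x].
  split=> [|a Y Z hY hZ]; first by rewrite kact0 Phik0 scale0r.
  by rewrite kact_lin Phik_lin hY hZ scalerDl scalerA.
rewrite kact_tens Phik_tens scaler_int.
have := @morph_sumz _ _ _ unit [:: tt] (fun=> vac0) (fun=> Phi (dval x) t) (@tens1B k Delta0).
rewrite !big_seq1 => <-; congr (tens1 k _); apply: dval_inj.
rewrite dval_opS cls_rev_mul //; last exact: dvalP.
by rewrite -scaler_int intz.
Qed.

Lemma flag_span_mul_vac (v : PGalg) : flag_span v -> v * cls [:: 0%VS] = v.
Proof.
elim/flag_span_ind => [|s ds].
  by split=> [|a u w hu hw]; rewrite ?mul0r // mulrDl PGalg_mulZl hu hw.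
rewrite clsM ?down_flag_fpath //= ?zero_flag //.
by case/and3P: ds => _ _ ->; rewrite cats0.
Qed.

Lemma kact_vac x : kact (dval x) (tens1 k vac0) = tens1 k x.
Proof.
rewrite kact_tens; congr (tens1 k _); apply: dval_inj.
by rewrite dval_opS dval_mkD flag_span_mul_vac //; apply: dvalP.
Qed.

Definition lclass i : Delta0k -> Delta0k_layer F n k l i := @sqclass k PGopk Delta0k (filt i) (filt i.+1).

Lemma lclass_surj i (Z : Delta0k_layer F n k l i) : exists2 X, filt i X & Z = lclass i X.
Proof. exact: (sqclass_surj (filt_stable i)). Qed.

Lemma lclass_lin i a X Y : filt i X -> filt i Y ->
  lclass i (a *: X + Y) = a *: lclass i X + lclass i Y.
Proof. exact: (sqclass_lin _ (filt_stable i)). Qed.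

Lemma lclass_eq0 i X : filt i X -> lclass i X = 0 <-> filt i.+1 X.
Proof. exact: (sqclass_eq0 (filt_stable i) (filt_stable i.+1)). Qed.

Lemma lclass_op i o X : filt i X -> op o (lclass i X) = lclass i (op o X).
Proof. exact: (sqclass_op (filt_stable i) (filt_stable i.+1) op_zmod). Qed.

(** A non-zero class is detected by some flag [t]; the path [rev t] sends it to a non-zero multiple
    of the class of [({0})], and that class generates the module. *)
Lemma simple_L0 : simple_rep (as_PGmod (L0k F n k l)).
Proof.
split.
  exists (lclass 0 (tens1 k vac0)); apply/eqP => /(lclass_eq0 (filt0 _)).
  move=> /filt1E/(_ [:: 0%VS] zero_flag); rewrite Phik_tens dval_mkD Phi_zero => /eqP.
  by rewrite oner_eq0.
move=> N [[N0 ND] No].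
have [[Z [nZ Zn0]]|h] := pselect (exists Z, N Z /\ Z <> 0); [right|left]; last first.
  apply/seteqP; split=> [Z nZ|_ -> //]; apply: contrapT => Zn0; apply: h; by exists Z.
apply/seteqP; split=> // Y _.
have [X _ eX] := lclass_surj Z.
have [t dt ht] : exists2 t, down_flag t & Phik t X <> 0.
  apply: contrapT => h; apply: Zn0; rewrite eX; apply/(lclass_eq0 (filt0 X)).
  apply/filt1E => t dt; apply: contrapT => ht; apply: h; by exists t.
have nv : N (lclass 0 (tens1 k vac0)).
  have := No ((Phik t X)^-1 *: tens1 k (cls (rev t))) _ nZ.
  rewrite /= eX [X in N X](lclass_op (inl _) (filt0 X)) op_inl_tens kact_rev //.
  by rewrite scalerA mulVf ?scale1r //; apply/eqP.
have [X' _ ->] := lclass_surj Y.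
have [L eL] := extscal_gen X'.
have := No (\sum_(p <- [seq (p.1, dval p.2) | p <- L]) p.1 *: tens1 k p.2) _ nv.
rewrite [X in N X](lclass_op (inl _) (filt0 _)) op_inl_sum big_map eL.
by rewrite (eq_bigr (fun p => p.1 *: tens1 k p.2)) // => p _; rewrite kact_vac.
Qed.

End Reduction.

(** * The isomorphism of layers *)

Section LayerIso.
Local Open Scope classical_set_scope.
Variables (F : finFieldType) (n : nat) (k : fieldType) (l : nat).
Hypothesis char_k : l \in [pchar k].
Local Notation T := {vspace 'cV[F]_n.+1}.
Local Notation G := {'GL_n.+1[F]}.
Local Notation PGalg := (PGalg F n).
Local Notation PGop := (PGop F n).
Local Notation PGopk := (PGopk F n k).
Local Notation Delta0 := (Delta0 F n).
Local Notation Delta0k := (Delta0k F n k).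
Local Notation St := (St F n int).
Local Notation Stk := (Defs.St F n k).
Local Notation moved := (@moved F n).
Local Notation top_flags := (@top_flags F n).
Local Notation topD := (@topD F n).
Local Notation toSt := (@toSt F n).
Local Notation toD := (@toD F n).
Local Notation kappa := (logn l (nb_full_flags F n)).
Local Notation filt := (@Delta0k_filtration F n k l).
Local Notation gfilt := (@gow_filtration F n k l).
Local Notation anySt := (fun _ : St => True).
Local Notation P := (Pnum F n).
Implicit Types (t : seq T) (s : PGalg) (g h : G) (x y : Delta0) (z : St) (X Y : Delta0k).

(** The part of the number of flags prime to [l]; it is a unit in [k] and can be divided out after
    reduction. *)
Definition cofactor_num : nat := s2val (pfactor_coprime (char_prime char_k) (qfact_gt0 F n.+1)).
Local Notation c := cofactor_num.

Lemma Pnum_fact : P = (l ^ kappa * c)%N.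
Proof.
rewrite nb_full_flagsE /cofactor_num; case: pfactor_coprime => m /= _ e.
by rewrite /Pnum {1}e mulnC.
Qed.

Lemma cofactor_neq0 : c%:R != 0 :> k.
Proof.
rewrite -(dvdn_pcharf char_k) -prime_coprime ?(char_prime char_k) //.
by rewrite /cofactor_num; case: pfactor_coprime.
Qed.

Lemma opStB (R : comNzRingType) g : zmod_morphism (op g : Defs.St F n R -> Defs.St F n R).
Proof.
move=> a b; apply/stval_inj/ffunP => h; rewrite stval_opG.
by rewrite addrC -scaleN1r stval_lin [op g a - _]addrC -scaleN1r stval_lin !stval_opG.
Qed.

Lemma morph_mulrn (A B : zmodType) (f : A -> B) a (m : nat) : zmod_morphism f -> f (a *+ m) = f a *+ m.
Proof.
by move=> fB; have := @morph_sumz _ _ _ unit [:: tt] (fun=> a) (fun=> m%:Z) fB;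
   rewrite !big_seq1 -!pmulrn.
Qed.

Lemma stf_mulrn z m t : stf (z *+ m) t = stf z t *+ m.
Proof.
by rewrite -scaler_nat -[_ *: _]addr0 stf_lin stf0 addr0 mulr_natl.
Qed.

Lemma torsSt z m : (0 < m)%N -> z *+ m = 0 -> z = 0.
Proof.
move=> m0 e; apply: stf_ext => t _; have := congr1 (fun z => stf z t) e.
rewrite /= stf_mulrn !stf0 => /eqP; rewrite Num.Theory.mulrn_eq0 => /orP[|/eqP //].
by rewrite (gtn_eqF m0).
Qed.

Lemma pr0 z : pr (0 : Delta0) z = 0.
Proof. by have := pr_linl (-1) 0 0 z; rewrite scaler0 addr0 mulN1r addNr. Qed.

Lemma pr_mulrn x z m : pr (x *+ m) z = pr x z *+ m.
Proof.
by rewrite -scaler_nat -[_ *: _]addr0 pr_linl pr0 addr0 mulr_natl.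
Qed.

Lemma torsD x m : topD x -> (0 < m)%N -> x *+ m = 0 -> x = 0.
Proof.
move=> tx m0 e; apply: pairing_nondeg => // z; have := congr1 (fun x => pr x z) e.
rewrite /= pr_mulrn pr0 => /eqP.
by rewrite Num.Theory.mulrn_eq0 (gtn_eqF m0) => /eqP.
Qed.

Lemma topD_mulrn x m : topD x -> topD (x *+ m).
Proof.
move=> tx; elim: m => [|m IH]; first exact: topD0.
rewrite mulrSr -[x in _ + x]opprK; apply: topDB => //.
by rewrite -sub0r; apply: topDB => //; apply: topD0.
Qed.

Lemma toSt_toDE z : toSt (toD z) = z *+ (l ^ kappa * c).
Proof. by rewrite toSt_toD Pnum_fact. Qed.

Lemma toD_toStE x : topD x -> toD (toSt x) = x *+ (l ^ kappa * c).
Proof. by move=> tx; rewrite toD_toSt // Pnum_fact. Qed.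

(** Deduced from the equivariance of [toSt]: it kills the difference, so the number of flags does
    too, and [topD] has no torsion. *)
Lemma toD_opG g z : toD (op g z) = op (inr g : PGop) (toD z).
Proof.
apply/eqP; rewrite -subr_eq0; apply/eqP.
apply: (@torsD _ (Pnum F n)); [|exact: qfact_gt0|].
  by apply: topDB; [apply: topD_toD | apply/topD_opG/topD_toD].
rewrite -toD_toSt; last by apply: topDB; [apply: topD_toD | apply/topD_opG/topD_toD].
rewrite toStB toSt_opG !toSt_toD (morph_mulrn _ _ (opStB (R := int) g)) subrr.
by have e := @toDB F n 0 0; rewrite subr0 subrr in e.
Qed.

Lemma red_steinberg z : steinberg (fun t => (stf z t)%:~R : k).
Proof.
move=> s t C V r; rewrite -[RHS](rmorph0 (intmul (1 : k))) -(stf_steinberg z s t r).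
by rewrite rmorph_sum.
Qed.

Definition red z : Stk := mkSt (red_steinberg z).

Lemma red_val z g : stval (red z) g = (stval z g)%:~R.
Proof. by rewrite stval_mkSt stf_moved. Qed.

Lemma redB : zmod_morphism red.
Proof.
move=> a b; apply/stval_inj/ffunP => g; rewrite red_val addrC -scaleN1r stval_lin mulN1r.
by rewrite [red a - _]addrC -scaleN1r stval_lin mulN1r !red_val rmorphD rmorphN.
Qed.

Lemma red_opG g z : red (op g z) = op g (red z).
Proof. by apply/stval_inj/ffunP => h; rewrite red_val !stval_opG red_val. Qed.

(** Pairing with [z] gives a relation between integers with independent coefficients, so [l] divides
    every [pr (x i) z], and [perfect_pairing] divides [x i] inside [topD]. *)
Lemma flatD m (a : 'I_m -> k) (x : 'I_m -> Delta0) : indep l a ->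
  (forall i, topD (x i)) -> \sum_i a i *: tens1 k (x i) = 0 ->
  forall i, exists2 x', topD x' & x i = x' *+ l.
Proof.
move=> ia tx e i; apply: perfect_pairing => // z.
apply: (ia (fun i => pr (x i) z)).
have prB : zmod_morphism (fun x => (pr x z)%:~R : k^o).
  by move=> x1 x2; rewrite addrC -scaleN1r pr_linl mulN1r addrC rmorphB.
have := congr1 (extscal_lift (fun x => (pr x z)%:~R : k^o)) e.
rewrite (extscal_lift_sum prB) (extscal_lift0 prB) => e'; rewrite -[RHS]e'.
by apply: eq_bigr => j _; rewrite mulrC.
Qed.

Lemma div_steinberg z (d : nat) : (forall t, (d%:Z %| stf z t)%Z) -> (0 < d)%N ->
  steinberg (fun t => (stf z t %/ d%:Z)%Z).
Proof.
move=> h d0 s t C V r; apply: (@mulIf _ (d%:Z)); first by lia.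
rewrite mul0r big_distrl /= -[RHS](stf_steinberg z s t r); apply: eq_bigr => X _.
by rewrite divzK.
Qed.

Lemma St_div z (d : nat) : (0 < d)%N -> (forall t, t \in top_flags -> (d%:Z %| stf z t)%Z) ->
  exists z', z = z' *+ d.
Proof.
move=> d0 h; have h' t : (d%:Z %| stf z t)%Z.
  have [/h //|nt] := boolP (t \in top_flags); by rewrite /stf (negbTE nt) dvdz0.
exists (mkSt (div_steinberg h' d0)); apply: stf_ext => t tt.
by rewrite stf_mulrn stf_mkSt // -mulr_natr natz divzK.
Qed.

Lemma flatSt m (a : 'I_m -> k) (z : 'I_m -> St) : indep l a ->
  (forall i : 'I_m, True) -> \sum_i a i *: red (z i) = 0 ->
  forall i, exists2 z', True & z i = z' *+ l.
Proof.
move=> ia _ e i; have [|t /moved_transitive[g <-]|z' ->] := @St_div (z i) l; last by exists z'.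
- by apply: prime_gt0; apply: (char_prime char_k).
apply: (ia (fun i => stf (z i) (moved g))).
have := congr1 (fun w : Stk => stval w g) e.
have val0 : stval (0 : Stk) g = 0 by rewrite /stval /= ffunE.
rewrite val0 => e'; rewrite -[RHS]e'.
have D (u v : Stk) : stval (u + v) g = stval u g + stval v g.
  by rewrite -[u]scale1r stval_lin mul1r scale1r.
rewrite (big_morph (fun w : Stk => stval w g) D val0); apply: eq_bigr => j _.
by rewrite -[_ *: _]addr0 stval_lin val0 addr0 red_val stf_moved mulrC.
Qed.

Local Notation layD := (layer l topD anySt toSt).
Local Notation layS := (layer l anySt topD toD).

Lemma layDE i x : layD i x <-> topD x /\ divD l i x.
Proof.
have l0 : (0 < l ^ i)%N by rewrite expn_gt0 prime_gt0 ?(char_prime char_k).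
split=> [[tx [y _ e]]|[tx h]]; split=> //.
  move=> t; have [tt|nt] := boolP (t \in top_flags).
    have := congr1 (fun z => stf z t) e; rewrite /= stf_toSt // stf_mulrn => ->.
    by rewrite -mulr_natr natz dvdz_mull.
  rewrite mem_top_flags negb_and in nt; case/orP: nt => nt.
    by rewrite Phi_flag_fun // dvdz0.
  by rewrite (Phi_top_head tx nt) dvdz0.
have [t tt|z ->] := @St_div (toSt x) _ l0; first by rewrite stf_toSt.
by exists z.
Qed.

(** Gow's form is [pr (toD z) w], so perfectness turns divisibility against all [w] into
    divisibility of [toD z]. *)
Lemma laySE j z : layS j z <-> forall w, (l%:Z ^+ j %| gow_form z w)%Z.
Proof.
have E w : gow_form z w = pr (toD z) w.
  rewrite gow_formE /pr pairing_toD //; [exact: stf_steinberg | exact: stf_flag_fun].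
split=> [[_ [x _ e]] w|h].
  by rewrite E e pr_mulrn dvd_expz -mulr_natr natz dvdz_mull.
split=> //; apply: perfect_pairing; first exact: topD_toD.
by move=> w; rewrite -E -dvd_expz.
Qed.

Lemma gfiltE j : gfilt j = lin_span [set red z | z in [set z | layS j z]].
Proof.
rewrite /gow_filtration; congr lin_span; apply/seteqP; split=> w.
  move=> [z /laySE hz e]; exists z => //; apply/stval_inj/ffunP => g.
  by rewrite red_val [RHS](congr1 (fun v : {ffun G -> k^o} => v g) e) ffunE.
move=> [z hz <-]; exists z; first exact/laySE.
by apply/ffunP => g; rewrite -[LHS]/(stval (red z) g) red_val ffunE.
Qed.

Lemma layS_opG j g z : layS j z -> layS j (op g z).
Proof.
move=> [_ [x tx e]]; split=> //; exists (op (inr g : PGop) x); first exact: topD_opG.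
by rewrite toD_opG e (morph_mulrn _ _ (@opGB F n g)).
Qed.

Lemma op_Stk_lin g (a : k) (u v : Stk) : op g (a *: u + v) = a *: op g u + op g v.
Proof. by apply/stval_inj/ffunP => h; rewrite stval_opG !stval_lin !stval_opG. Qed.

Lemma op_Stk0 g : op g (0 : Stk) = 0.
Proof. by have := op_Stk_lin g (-1) 0 0; rewrite scaler0 addr0 scaleN1r addNr. Qed.

Lemma gfilt_stable j : op_stable (gfilt j).
Proof.
rewrite gfiltE; have [S0 SD] := submodule_span [set red z | z in [set z | layS j z]].
split=> [|g w hw]; first exact: submodule_span.
apply: (hw [set w | lin_span [set red z | z in [set z | layS j z]] (op g w)]).
  by split=> [|a u v hu hv]; rewrite /mkset ?op_Stk0 // op_Stk_lin; apply: SD.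
move=> _ [z hz <-]; rewrite /mkset -red_opG; apply: Defs.sub_span.
by exists (op g z) => //; apply: layS_opG.
Qed.

Definition gclass j : Stk -> subquorep (gfilt j) (gfilt j.+1) := @sqclass k G Stk (gfilt j) (gfilt j.+1).

Lemma op_Stk_zmod g : zmod_morphism (op g : Stk -> Stk). Proof. exact: opStB. Qed.

Lemma pair_toD i x z : (i <= kappa)%N -> topD x -> toSt x = z *+ l ^ i ->
  toD z = (x *+ c) *+ l ^ (kappa - i).
Proof.
move=> ik tx e; apply/eqP; rewrite -subr_eq0; apply/eqP.
apply: (@torsD _ (l ^ i)).
- by apply: topDB; [apply: topD_toD | do 2!apply: topD_mulrn].
- by rewrite expn_gt0 prime_gt0 ?(char_prime char_k).
rewrite mulrnBl -(morph_mulrn _ _ (@toDB F n)) -e toD_toStE //.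
apply/eqP; rewrite subr_eq0 -!mulrnA; apply/eqP; congr (_ *+ _).
by rewrite -expnD subnK // mulnC.
Qed.

Lemma pair_toSt j x z : (j <= kappa)%N -> toD z = x *+ l ^ j ->
  toSt x = (z *+ c) *+ l ^ (kappa - j).
Proof.
move=> jk e; apply/eqP; rewrite -subr_eq0; apply/eqP.
apply: (@torsSt _ (l ^ j)); first by rewrite expn_gt0 prime_gt0 ?(char_prime char_k).
rewrite mulrnBl -(morph_mulrn _ _ (@toStB F n)) -e toSt_toDE.
apply/eqP; rewrite subr_eq0 -!mulrnA; apply/eqP; congr (_ *+ _).
by rewrite -expnD subnK // mulnC.
Qed.

Lemma tens_mulrn x m : tens1 k (x *+ m) = m%:R *: tens1 k x.
Proof. by rewrite (morph_mulrn _ _ (@tens1B k Delta0)) scaler_nat. Qed.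

Lemma red_mulrn z m : red (z *+ m) = m%:R *: red z.
Proof. by rewrite (morph_mulrn _ _ redB) scaler_nat. Qed.

Local Notation E0 := (cls [:: fullv : T]).
Local Notation Lay i := (Delta0k_layer F n k l i).
Local Notation Wt i := (@weight_space F n k fullv (Lay i)).

Lemma E0_idem : E0 * E0 = E0 :> PGalg.
Proof. by rewrite cls_top // eqxx. Qed.

Lemma kact_GL g X : op (inr g : PGopk) (kact E0 X) = kact E0 (op (inr g : PGopk) X).
Proof.
elim/Delta0k_ind: X => [|x].
  split=> [|a X Y hX hY]; first by rewrite kact0 op_inr0 kact0.
  by rewrite kact_lin !op_inr_lin kact_lin hX hY.
rewrite kact_tens !op_inr_tens kact_tens; congr (tens1 k _); apply: dval_inj.
by rewrite dval_opG !dval_opS dval_opG GL_PGalgM GL_cls //= GL_subspacef.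
Qed.

Lemma weight_spaceE i (Z : Lay i) : Wt i Z <-> exists2 X, filt i X & Z = lclass l i (kact E0 X).
Proof.
have opE X : filt i X -> op (inl (tens1 k E0) : PGopk) (lclass l i X) = lclass l i (kact E0 X).
  by move=> hX; rewrite lclass_op // op_inl_tens1.
split=> [[Z' _ <-]|[X hX ->]].
  have [X hX ->] := lclass_surj Z'; exists X => //; exact: opE.
by exists (lclass l i X) => //; apply: opE.
Qed.

Lemma Wt_stable i : @op_stable k G (as_GLmod (Lay i)) (Wt i).
Proof.
split; first split.
- apply/weight_spaceE; exists 0; first exact: (filt_sub F n k l i).1.
  by rewrite kact0; apply/esym/(lclass_eq0 (filt_sub F n k l i).1); apply: (filt_sub F n k l i.+1).1.
- move=> a Z Z' /weight_spaceE[X hX ->] /weight_spaceE[Y hY ->]; apply/weight_spaceE.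
  exists (a *: X + Y); first exact: (filt_sub F n k l i).2.
  by rewrite kact_lin lclass_lin //; apply: kact_filt.
move=> g Z /weight_spaceE[X hX ->]; apply/weight_spaceE.
exists (op (inr g : PGopk) X); first exact: (filt_stable F n k l i).2.
rewrite -kact_GL; apply: (lclass_op (inr g)); exact: kact_filt.
Qed.

Lemma sum_tens_filt i (L : seq (k * Delta0)) : (forall p, p \in L -> divD l i p.2) ->
  filt i (\sum_(p <- L) p.1 *: tens1 k p.2).
Proof.
have [f0 fD] := filt_sub F n k l i.
elim: L => [|p L IH] h; first by rewrite big_nil.
rewrite big_cons; apply: fD; first by apply: filt_tens; apply: h; rewrite inE eqxx.
by apply: IH => p' hp; apply: h; rewrite inE hp orbT.
Qed.

Lemma kact_sum s (L : seq (k * Delta0)) : kact s (\sum_(p <- L) p.1 *: tens1 k p.2) =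
  \sum_(p <- L) p.1 *: tens1 k (op (inl s : PGop) p.2).
Proof.
elim: L => [|p L IH]; first by rewrite !big_nil kact0.
by rewrite !big_cons kact_lin kact_tens IH.
Qed.

Lemma op_E0_top x : topD x -> op (inl E0 : PGop) x = x.
Proof. by move=> tx; apply: dval_inj; rewrite dval_opS. Qed.

Lemma topD_op_E0 x : topD (op (inl E0 : PGop) x).
Proof. by rewrite /topD dval_opS mulrA E0_idem. Qed.

Lemma filt_seq i X : filt i X -> exists2 L : seq (k * Delta0),
  forall p, p \in L -> divD l i p.2 & X = \sum_(p <- L) p.1 *: tens1 k p.2.
Proof.
move=> h; have [L hL e] := (lin_span_seq (Delta0_filtration l i) (@tens1 k Delta0) X).1 h.
by exists L => // p /hL /Delta0_filtrationE.
Qed.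

Lemma kact_E0_filt i X : filt i X ->
  lin_span [set tens1 k x | x in [set x | layD i x]] (kact E0 X).
Proof.
move=> /filt_seq[L hL ->]; rewrite kact_sum.
apply/(lin_span_seq (fun x => layD i x) (@tens1 k Delta0)).
exists [seq (p.1, op (inl E0 : PGop) p.2) | p <- L]; last by rewrite big_map.
move=> _ /mapP[p /hL hp ->]; apply/layDE; split; first exact: topD_op_E0.
exact: divD_opS.
Qed.

(** Multiplication by the idempotent of the full space preserves each filtration step, so a weight
    vector of the layer lifts to integral vectors of top weight in the same step. *)
Lemma weight_space_seq i (Z : Lay i) : Wt i Z <-> exists2 L : seq (k * Delta0),
  forall p, p \in L -> layD i p.2 & Z = lclass l i (\sum_(p <- L) p.1 *: tens1 k p.2).
Proof.
split=> [/weight_spaceE[X hX ->]|[L hL ->]].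
  have [L hL e] := (lin_span_seq (fun x => layD i x) (@tens1 k Delta0) _).1 (kact_E0_filt hX).
  by exists L => //; rewrite e.
have hd p : p \in L -> divD l i p.2 by move=> /hL /layDE[].
apply/weight_spaceE; exists (\sum_(p <- L) p.1 *: tens1 k p.2); first exact: sum_tens_filt.
congr lclass; rewrite kact_sum big_seq [RHS]big_seq; apply: eq_bigr => p /hL /layDE[tp _].
by rewrite op_E0_top.
Qed.

Definition tval i (v : top_weight_space (Lay i)) : Lay i := val (v : submod (Wt i)).

Lemma tvalP i (v : top_weight_space (Lay i)) : Wt i (tval v).
Proof. exact: (submod_valP _ (Wt_stable i).1). Qed.

Lemma tval_inj i : injective (@tval i). Proof. exact: val_inj. Qed.

Lemma mk_tval i (Z : Lay i) : Wt i Z -> exists v : top_weight_space (Lay i), tval v = Z.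
Proof.
move=> hZ; exists (insubd (0 : submod (Wt i)) Z); exact: (val_insubd_submod (Wt_stable i).1 hZ).
Qed.

Lemma tval_lin i (a : k) (u v : top_weight_space (Lay i)) : tval (a *: u + v) = a *: tval u + tval v.
Proof. by []. Qed.

Lemma tval_op i g (v : top_weight_space (Lay i)) : tval (op g v) = op (inr g : PGopk) (tval v).
Proof. exact: (@subrep_opE k G (as_GLmod (Lay i)) _ g v (Wt_stable i)). Qed.

Section Layer.
Variable i : nat.
Hypothesis ik : (i <= kappa)%N.
Local Notation j := (kappa - i)%N.
Implicit Types L : seq (k * (Delta0 * St)).

Definition lattice_pairs L := forall p, p \in L ->
  [/\ topD p.2.1, True & toSt p.2.1 = p.2.2 *+ l ^ i].

Definition tsum L : Delta0k := \sum_(p <- L) p.1 *: tens1 k p.2.1.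
Definition rsum L : Stk := \sum_(p <- L) p.1 *: red p.2.2.

(** The list [L] is not determined by [v]; [tsum_rsum] makes the relation a function and [rsum_tsum]
    makes it injective. *)
Definition layer_rel (v : top_weight_space (Lay i)) (w : subquorep (gfilt j) (gfilt j.+1)) :=
  exists2 L, lattice_pairs L & tval v = lclass l i (tsum L) /\ w = gclass j (rsum L).

Lemma tsum_filt L : lattice_pairs L -> filt i (tsum L).
Proof.
move=> hL; rewrite /tsum -(big_map (fun p => (p.1, p.2.1)) predT (fun p => p.1 *: tens1 k p.2)).
apply: sum_tens_filt => _ /mapP[p /hL[tp _ e] ->].
have /layDE[] // : layD i p.2.1 by split=> //; exists p.2.2.
Qed.

Lemma rsum_gfilt L : lattice_pairs L -> gfilt j (rsum L).
Proof.
move=> hL; rewrite gfiltE; apply/(lin_span_seq (fun z => layS j z) red).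
exists [seq (p.1, p.2.2) | p <- L]; last by rewrite big_map.
move=> _ /mapP[p /hL[tp _ e] ->]; split=> //.
by exists (p.2.1 *+ c); [apply: topD_mulrn | apply: pair_toD].
Qed.

Lemma gclass_lin m a u v : gfilt m u -> gfilt m v -> gclass m (a *: u + v) = a *: gclass m u + gclass m v.
Proof. exact: (sqclass_lin _ (gfilt_stable m)). Qed.

Lemma gclass_eq0 m u : gfilt m u -> gclass m u = 0 <-> gfilt m.+1 u.
Proof. exact: (sqclass_eq0 (gfilt_stable m) (gfilt_stable m.+1)). Qed.

Lemma gclass_op m g u : gfilt m u -> op g (gclass m u) = gclass m (op g u).
Proof. exact: (sqclass_op (gfilt_stable m) (gfilt_stable m.+1) op_Stk_zmod). Qed.

Lemma any_closed : forall x y : St, True -> True -> True. Proof. by []. Qed.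

Lemma tsum_rsum L : lattice_pairs L -> filt i.+1 (tsum L) -> gfilt j.+1 (rsum L).
Proof.
move=> hL /kact_E0_filt; rewrite /tsum.
rewrite -(big_map (fun p => (p.1, p.2.1)) predT (fun p => p.1 *: tens1 k p.2)) kact_sum big_map.
rewrite big_seq (eq_bigr (fun p => p.1 *: tens1 k p.2.1)) => [|p /hL[tp _ _]]; last first.
  by rewrite op_E0_top.
rewrite -big_seq gfiltE => h.
exact: (layer_half char_k (@tens1B k Delta0) redB (@toStB F n) (@toDB F n) (topD0 F n)
  (@topDB F n) (fun z _ => topD_toD z) I any_closed toD_toStE torsD flatD ik hL h).
Qed.

Lemma rsum_tsum L : lattice_pairs L -> gfilt j.+1 (rsum L) -> filt i.+1 (tsum L).
Proof.
move=> hL; rewrite gfiltE => h.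
(* In the reverse direction the pairs are [(z, c x)], since [toD z = l^(kappa-i) c x]; the unit [c]
   is inverted at the end. *)
pose L' := [seq (p.1, (p.2.2, p.2.1 *+ c)) | p <- L].
have hL' p : p \in L' -> [/\ True, topD p.2.2 & toD p.2.1 = p.2.2 *+ l ^ j].
  move=> /mapP[p' /hL[tp _ e] ->]; split=> //; first exact: topD_mulrn.
  exact: pair_toD.
have h' : lin_span [set red z | z in [set z | layS j.+1 z]] (\sum_(p <- L') p.1 *: red p.2.1).
  by rewrite big_map.
have : lin_span [set tens1 k x | x in [set x | layD (kappa - j).+1 x]]
    (\sum_(p <- L') p.1 *: tens1 k p.2.2).
  exact: (layer_half char_k redB (@tens1B k Delta0) (@toDB F n) (@toStB F n) I any_closed
    (fun _ _ => I) (topD0 F n) (@topDB F n) (fun z _ => toSt_toDE z) (fun z m _ => @torsSt z m)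
    flatSt (leq_subr i kappa) hL' h').
rewrite subKn // big_map => H.
have {}H : filt i.+1 (\sum_(p <- L) p.1 *: tens1 k (p.2.1 *+ c)).
  by apply: (H (filt i.+1)) (filt_sub F n k l i.+1) _ => _ [x /layDE[_ dx] <-]; apply: filt_tens.
have -> : tsum L = c%:R^-1 *: \sum_(p <- L) p.1 *: tens1 k (p.2.1 *+ c).
  rewrite scaler_sumr; apply: eq_bigr => p _.
  by rewrite tens_mulrn !scalerA mulrAC mulVf ?mul1r // cofactor_neq0.
by rewrite -[_ *: _]addr0; apply: (filt_sub F n k l i.+1).2 H (filt_sub F n k l i.+1).1.
Qed.

Lemma layer_iso : rep_iso (top_weight_space (Lay i)) (gow_layer F n k l j%:Z).
Proof.
apply: (rep_iso_rel (X := top_weight_space (Lay i)) (Y := subquorep (gfilt j) (gfilt j.+1))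
  (r := layer_rel)).
- move=> a v w v' w' [L hL [ev ew]] [L' hL' [ev' ew']].
  exists ([seq (a * p.1, p.2) | p <- L] ++ L').
    by move=> p; rewrite mem_cat => /orP[/mapP[p' /hL ? ->]|/hL'].
  have et : tsum ([seq (a * p.1, p.2) | p <- L] ++ L') = a *: tsum L + tsum L'.
    rewrite /tsum big_cat big_map scaler_sumr; congr (_ + _).
    by apply: eq_bigr => p _; rewrite scalerA.
  have er : rsum ([seq (a * p.1, p.2) | p <- L] ++ L') = a *: rsum L + rsum L'.
    rewrite /rsum big_cat big_map scaler_sumr; congr (_ + _).
    by apply: eq_bigr => p _; rewrite scalerA.
  rewrite et er tval_lin lclass_lin ?gclass_lin; try exact: tsum_filt; try exact: rsum_gfilt.
  by rewrite ev ev' ew ew'.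
- move=> v; have /weight_space_seq[L hL ev] := tvalP v.
  have /boolp.choice[y hy] (p : k * Delta0) : exists y : St, p \in L -> toSt p.2 = y *+ l ^ i.
    by have [/hL[_ [y _ e]]|_] := boolP (p \in L); [exists y | exists 0].
  pose L' := [seq (p.1, (p.2, y p)) | p <- L].
  exists (gclass j (rsum L')); exists L'.
    by move=> _ /mapP[p pL ->]; split=> //; [case: (hL p pL) | apply: hy].
  by rewrite /tsum big_map.
- move=> w; have [u hu ->] := sqclass_surj (gfilt_stable j) w.
  move: hu; rewrite {1}gfiltE => /(lin_span_seq (fun z => layS j z) red)[L hL eu].
  have /boolp.choice[x hx] (p : k * St) : exists x : Delta0, p \in L -> topD x /\ toD p.2 = x *+ l ^ j.
    by have [/hL[_ [x tx e]]|_] := boolP (p \in L); [exists x | exists 0].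
  (* From [toD z = l^j x] one obtains only [toSt x = l^i c z]; the pair is [(x, c z)] and its scalar
     is divided by [c]. *)
  pose L' := [seq (p.1 / c%:R, (x p, p.2 *+ c)) | p <- L].
  have hL' : lattice_pairs L'.
    move=> _ /mapP[p pL ->]; have [tx e] := hx p pL; split=> //=.
    by rewrite (pair_toSt _ e) ?leq_subr // subKn.
  have [v ev] : exists v : top_weight_space (Lay i), tval v = lclass l i (tsum L').
    apply: mk_tval; apply/weight_space_seq; exists [seq (p.1, p.2.1) | p <- L'].
      move=> _ /mapP[p /hL'[tp _ e] ->]; split=> //; by exists p.2.2.
    by rewrite /tsum [in RHS]big_map.
  exists v; exists L' => //; split=> //; congr gclass.
  rewrite eu /rsum big_map; apply: eq_bigr => p _.
  by rewrite red_mulrn scalerA /= mulrVK // unitfE cofactor_neq0.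
- move=> v [L hL [ev /esym/(gclass_eq0 (rsum_gfilt hL)) h]]; apply: tval_inj; rewrite ev.
  by apply/(lclass_eq0 (tsum_filt hL)); apply: rsum_tsum.
- move=> w [L hL [/esym/(lclass_eq0 (tsum_filt hL)) h ->]].
  by apply/(gclass_eq0 (rsum_gfilt hL)); apply: tsum_rsum.
move=> g v w [L hL [ev ew]].
exists [seq (p.1, (op (inr g : PGop) p.2.1, op g p.2.2)) | p <- L].
  move=> _ /mapP[p /hL[tp _ e] ->]; split=> //=; first exact: topD_opG.
  by rewrite toSt_opG e (morph_mulrn _ _ (@opStB int g)).
rewrite tval_op ev ew lclass_op ?gclass_op; [|exact: rsum_gfilt|exact: tsum_filt].
split; congr (_ _).
  rewrite /tsum big_map; elim: (L) => [|p L0 IH].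
    by rewrite !big_nil op_inr0.
  by rewrite !big_cons op_inr_lin IH op_inr_tens.
rewrite /rsum big_map; elim: (L) => [|p L0 IH]; first by rewrite !big_nil op_Stk0.
by rewrite !big_cons op_Stk_lin IH red_opG.
Qed.

End Layer.

End LayerIso.

(** * The socle *)

Section Socle.
Local Open Scope classical_set_scope.
Variables (F : finFieldType) (n : nat) (k : fieldType) (l : nat).
Hypothesis char_k : l \in [pchar k].
Local Notation T := {vspace 'cV[F]_n.+1}.
Local Notation G := {'GL_n.+1[F]}.
Local Notation PGop := (PGop F n).
Local Notation Delta0 := (Delta0 F n).
Local Notation Delta0k := (Delta0k F n k).
Local Notation St := (St F n int).
Local Notation Stk := (Defs.St F n k).
Local Notation moved := (@moved F n).
Local Notation pgl := (@pgl F n).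
Local Notation w0 := (@w0 n).
Local Notation top_flags := (@top_flags F n).
Local Notation topD := (@topD F n).
Local Notation toSt := (@toSt F n).
Local Notation toD := (@toD F n).
Local Notation kappa := (logn l (nb_full_flags F n)).
Local Notation gfilt := (@gow_filtration F n k l).
Local Notation c := (cofactor_num F n char_k).
Local Notation red := (@red F n k).
Local Notation anySt := (fun _ : St => True).
Local Notation layS := (layer l anySt topD toD).
Local Notation Lay i := (Delta0k_layer F n k l i).
Implicit Types (g h u : G) (x : Delta0) (z : St) (w : Stk).

Lemma pchar_mulrn (V : lmodType k) (v : V) : l%:R *: v = 0.
Proof. by rewrite (pcharf0 char_k) scale0r. Qed.

Lemma cofactor_scale_eq0 (V : lmodType k) (v : V) : c%:R *: v = 0 -> v = 0.
Proof.
move=> e; rewrite -[v](scalerK (cofactor_neq0 F n char_k)) e; exact: scaler0.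
Qed.

(** From [toSt x = l^i y] follows [c x = l^(i-kappa) toD y]; the right side vanishes over [k], where
    [c] is a unit. *)
Lemma top_layer_vanish i : (kappa < i)%N -> forall v : top_weight_space (Lay i), v = 0.
Proof.
move=> ki v; apply: tval_inj.
have /(weight_space_seq char_k)[L hL ->] := tvalP v.
rewrite (_ : \sum_(p <- L) _ = 0).
  by apply/(lclass_eq0 (filt_sub F n k l i).1); apply: (filt_sub F n k l i.+1).1.
rewrite big_seq big1 // => p /hL[tp [y _ e]].
suff -> : tens1 k p.2 = 0 by rewrite scaler0.
apply: cofactor_scale_eq0; rewrite -tens_mulrn.
have l0 : (0 < l)%N := prime_gt0 (char_prime char_k).
have -> : p.2 *+ c = toD y *+ (l ^ (i - kappa)).
  apply/eqP; rewrite -subr_eq0; apply/eqP; apply: (@torsD _ _ _ (l ^ kappa)).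
  - by apply: topDB; apply: topD_mulrn => //; apply: topD_toD.
  - by rewrite expn_gt0 l0.
  rewrite mulrnBl -!mulrnA -expnD subnK; last exact: ltnW.
  by rewrite mulnC -(toD_toStE char_k tp) e (morph_mulrn _ _ (@toDB F n)) subrr.
have [d ->] : exists d, (i - kappa = d.+1)%N by exists (i - kappa).-1; lia.
by rewrite tens_mulrn expnS natrM -scalerA pchar_mulrn.
Qed.

Lemma high_layer_iso i : (kappa < i)%N ->
  rep_iso (top_weight_space (Lay i)) (@subrep k G Stk [set 0]).
Proof.
move=> ki.
have s0 : submodule ([set 0] : set Stk).
  by split=> // a x y -> ->; rewrite scaler0 addr0.
have triv (w : @subrep k G Stk [set 0]) : w = 0.
  apply: val_inj; exact: (submod_valP (w : submod ([set 0] : set Stk)) s0).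
apply: (rep_iso_rel (r := fun _ _ => True)) => //.
- by move=> v; exists 0.
- by move=> w; exists 0.
by move=> v _; apply: top_layer_vanish.
Qed.

(* Spans the line of U-fixed vectors of St^k. *)
Definition socle_gen : Stk :=
  red (toSt (mkD (flag_span_cls (@std_flag F n)))).

Lemma socle_gen_val h : stval socle_gen h = (Phi (cls (std F n)) (moved h))%:~R.
Proof. by rewrite red_val toSt_moved dval_mkD. Qed.

Lemma socle_gen_w0 : stval socle_gen (pgl w0) = (-1) ^+ tri n.+1.
Proof.
have h1 : upper_unitri (GLval (1%g : G)).
  apply/andP; split; first by apply/moved_std_upper/moved1.
  by apply/forallP => i; rewrite GL_1E mxE eqxx.
rewrite socle_gen_val; have := unitri_opposite h1; rewrite mul1g => o.
have := opposite_Phi (@std_up_frame F n) (moved_flag _) (moved_head _) o.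
rewrite (_ : [seq _ | X <- rev (std_up F n)] = std F n); last first.
  by rewrite -[RHS]map_id; apply: eq_map => V; apply: capfv.
by move=> ->; rewrite rmorphXn rmorphN rmorph1 dim_fullv.
Qed.

Lemma socle_gen_unitri u h : upper_unitri (GLval u) ->
  stval socle_gen (u * h)%g = stval socle_gen h.
Proof.
move=> /andP[/moved_std_upper hu _]; rewrite !socle_gen_val movedM.
rewrite -[in RHS](Phi_GL u _ (flag_span_cls (@std_flag F n))).
by rewrite GL_cls ?down_flag_fpath ?std_flag // -/(moved u) hu.
Qed.

Lemma stval_sum (I : Type) (r : seq I) (P : pred I) (f : I -> Stk) h :
  stval (\sum_(i <- r | P i) f i) h = \sum_(i <- r | P i) stval (f i) h.
Proof.
have val0 : stval (0 : Stk) h = 0 by rewrite /stval /= ffunE.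
have D (u v : Stk) : stval (u + v) h = stval u h + stval v h.
  by rewrite -[u]scale1r stval_lin mul1r scale1r.
exact: (big_morph (fun w : Stk => stval w h) D val0).
Qed.

Lemma stval_scale a w h : stval (a *: w) h = a * stval w h.
Proof.
have val0 : stval (0 : Stk) h = 0 by rewrite /stval /= ffunE.
by rewrite -[_ *: _]addr0 stval_lin val0 addr0.
Qed.

Lemma op_sum (N : set Stk) (I : Type) (r : seq I) (P : pred I) (f : I -> Stk) :
  submodule N -> (forall i, P i -> N (f i)) -> N (\sum_(i <- r | P i) f i).
Proof.
move=> [N0 ND] h; elim/big_ind: _ => // u v hu hv.
by rewrite -[u]scale1r; apply: ND.
Qed.

(* Summing over U a vector of N not vanishing at the standard flag gives a
   nonzero U-fixed vector of N, necessarily a multiple of socle_gen. *)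
Lemma socle_gen_in (N : set Stk) w : op_stable N -> N w -> w != 0 -> N socle_gen.
Proof.
move=> [sN oN] Nw w0'.
have [g hg] : exists g, stval w g != 0.
  apply: contrapT => h; case/eqP: w0'; apply/stval_inj/ffunP => g.
  rewrite [RHS]ffunE; apply/eqP; apply: contra_notT h => hg; by exists g.
pose w1 := op g^-1%g w; have Nw1 : N w1 by apply: oN.
have w1E : stf w1 (std F n) != 0.
  by rewrite -(moved1 F n) stf_moved stval_opG invgK mulg1.
pose w2 := \sum_(u : G | upper_unitri (GLval u)) op u w1.
have Nw2 : N w2 by apply: op_sum => // u _; apply: oN.
have unitriV u : upper_unitri (GLval u) -> upper_unitri (GLval u^-1%g).
  have h1 : upper_unitri (GLval (1%g : G)).
    apply/andP; split; first by apply/moved_std_upper/moved1.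
    by apply/forallP => i; rewrite GL_1E mxE eqxx.
  by move=> hu; rewrite -[u^-1%g]mulg1; apply: unitriV_mul.
have w2u u h : upper_unitri (GLval u) -> stval w2 (u * h)%g = stval w2 h.
  move=> hu; rewrite !stval_sum (reindex_inj (mulgI u)) /=; apply: eq_big => v.
    apply/idP/idP => hv; first by rewrite -(mulKg u v); apply: unitriV_mul.
    by rewrite -[u]invgK; apply: unitriV_mul => //; apply: unitriV.
  by move=> _; rewrite !stval_opG invMg -mulgA mulKg.
have w2w0 : stval w2 (pgl w0) != 0.
  rewrite stval_sum (reindex_inj invg_inj).
  rewrite (eq_big (fun u : G => upper_unitri (GLval u)) (fun u => stf w1 (moved (u * pgl w0)%g))).
  - rewrite (sum_unitri (stf_steinberg w1)); apply: contra w1E => /eqP e.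
    apply/eqP; have : stf w1 (std F n) *~ (-1) ^+ tri n.+1 *~ (-1) ^+ tri n.+1 = 0.
      by rewrite e mul0rz.
    by rewrite -mulrzA -expr2 sqrr_sign mulr1z.
  - by move=> u; apply/idP/idP => hu; [rewrite -[u]invgK; apply: (unitriV _ hu) | apply: (unitriV _ hu)].
  by move=> u _; rewrite stval_opG invgK stf_moved.
(* Both vectors are [U]-invariant, hence constant on the opposite flags, which determine a Steinberg
   function. *)
suff -> : socle_gen = (stval socle_gen (pgl w0) / stval w2 (pgl w0)) *: w2.
  by rewrite -[_ *: _]addr0; apply: sN.2 Nw2 sN.1.
apply: stf_ext => t tt; apply: (steinberg_unitri_ext _ _ _ tt) => [||u hu]; try exact: stf_steinberg.
by rewrite !stf_moved stval_scale socle_gen_unitri // w2u // divfK.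
Qed.

(** If [toD z = l^kappa x] then [toSt x = c z], so this step is spanned by images of [topD], that is
    of the opposite flags; these are GL-translates of the standard flag. *)
Lemma gfilt_kappa_gen w : gfilt kappa w ->
  forall N : set Stk, op_stable N -> N socle_gen -> N w.
Proof.
rewrite gfiltE => /(lin_span_seq (fun z => layS kappa z) red)[L hL ->] N [sN oN] Ng.
have Ntop x : topD x -> N (red (toSt x)).
  move=> /top_coords[b [e _]].
  have -> : red (toSt x) = \sum_(u : G | upper_unitri (GLval u))
      (b u)%:~R *: op (u * pgl w0)%g socle_gen.
    apply/stval_inj/ffunP => h; rewrite stval_sum red_val toSt_moved e.
    rewrite (big_morph (fun v => Phi v (moved h)) (fun v v' => PhiD v v' _) (Phi0 _)).
    rewrite rmorph_sum; apply: eq_bigr => u _.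
    rewrite PhiZ rmorphM stval_scale stval_opG socle_gen_val; congr (_ * _%:~R).
    have -> : moved h = map (GL_subspace (u * pgl w0)%g) (moved ((u * pgl w0)^-1 * h)%g).
      by rewrite -movedM mulKVg.
    rewrite -(Phi_GL (u * pgl w0)%g _ (flag_span_cls (@std_flag F n))).
    by rewrite GL_cls ?down_flag_fpath ?std_flag.
  apply: op_sum => // u _; rewrite -[_ *: _]addr0; apply: sN.2 (oN _ _ Ng) sN.1.
rewrite big_seq; apply: op_sum => // p /hL[_ [x tx e]].
rewrite -[_ *: _]addr0; apply: sN.2 _ sN.1.
have := pair_toSt char_k (leqnn _) e; rewrite subnn expn0 mulr1n => e'.
have -> : red p.2 = c%:R^-1 *: red (toSt x).
  by rewrite e' red_mulrn scalerA mulVf ?scale1r // cofactor_neq0.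
by rewrite -[_ *: _]addr0; apply: sN.2 (Ntop _ tx) sN.1.
Qed.

(** From [toD z = l^(kappa+1) x] follows [c z = l toSt x], which reduces to 0. The layer [kappa] is
    thus a submodule, not only a subquotient. *)
Lemma gfilt_above : gfilt kappa.+1 = [set 0].
Proof.
apply/seteqP; split=> w; last by move=> ->; case: (gfilt_stable F n k l kappa.+1) => -[].
rewrite gfiltE => /(lin_span_seq (fun z => layS kappa.+1 z) red)[L hL ->].
rewrite big_seq big1 // => p /hL[_ [x tx e]]; suff -> : red p.2 = 0 by rewrite scaler0.
apply: (cofactor_scale_eq0); rewrite -red_mulrn.
have l0 : (0 < l)%N := prime_gt0 (char_prime char_k).
have -> : p.2 *+ c = toSt x *+ l.
  apply/eqP; rewrite -subr_eq0; apply/eqP; apply: (@torsSt _ _ _ (l ^ kappa)).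
    by rewrite expn_gt0 l0.
  rewrite mulrnBl -!mulrnA -expnS mulnC -(toSt_toDE char_k) e.
  by rewrite (morph_mulrn _ _ (@toStB F n)) subrr.
by rewrite red_mulrn pchar_mulrn.
Qed.

Lemma socle_gen_layer : gfilt kappa socle_gen.
Proof.
rewrite gfiltE; apply: Defs.sub_span.
exists (toSt (mkD (flag_span_cls (@std_flag F n)))) => //; split=> //.
set x := mkD _; have tx : topD x.
  by rewrite /topD dval_mkD cls_top ?down_flag_fpath ?std_flag // std_head eqxx.
exists (x *+ c); first exact: topD_mulrn.
by rewrite (toD_toStE char_k tx) -mulrnA mulnC.
Qed.

Lemma socle_gen_neq0 : socle_gen != 0.
Proof.
apply/eqP => e; have := socle_gen_w0; rewrite e => /eqP.
by rewrite /stval /= ffunE eq_sym signr_eq0.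
Qed.

Lemma gfilt_simple : simple_rep (@subrep k G Stk (gfilt kappa)).
Proof.
have st := gfilt_stable F n k l kappa.
split.
  exists (insubd (0 : submod (gfilt kappa)) socle_gen).
  apply/eqP => /(congr1 val) /=; rewrite (val_insubd_submod st.1 socle_gen_layer).
  by apply/eqP/socle_gen_neq0.
move=> N sN.
have [[v [Nv v0]]|h] := pselect (exists v, N v /\ v <> 0); [right|left]; last first.
  apply/seteqP; split=> [v Nv|v ->]; last by case: sN => -[].
  by apply: contrapT => v0; apply: h; exists v.
(* [N] is carried to a stable subset of the ambient module, where [socle_gen_in] applies. *)
pose N' : set Stk := [set w | exists2 v, N v & val (v : submod (gfilt kappa)) = w].
have sN' : op_stable N'.
  split; first split.
  - by exists 0; first exact: sN.1.1.
  - by move=> a _ _ [v1 h1 <-] [v2 h2 <-]; exists (a *: v1 + v2) => //; apply: sN.1.2.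
  by move=> g _ [v1 h1 <-]; exists (op g v1); [apply: sN.2 | apply: subrep_opE].
have gN' : N' socle_gen.
  apply: (socle_gen_in sN' (w := val (v : submod (gfilt kappa)))); first by exists v.
  by apply/eqP => e; apply: v0; apply: val_inj.
apply/seteqP; split=> // v1 _.
have [v2 h2 /val_inj <- //] : N' (val (v1 : submod (gfilt kappa))).
by apply: (gfilt_kappa_gen _ sN' gN'); apply: submod_valP st.1.
Qed.

Lemma socleE : lin_span [set x : Stk | exists N, [/\ op_stable N, simple_rep (subrep N) & N x]]
  = gfilt kappa.
Proof.
have st := gfilt_stable F n k l kappa.
apply/seteqP; split=> w; last first.
  by move=> hw; apply: Defs.sub_span; exists (gfilt kappa); split=> //; apply: gfilt_simple.
apply; first exact: st.1.
move=> x [N [sN [[v v0] simN] Nx]].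
have gN : N socle_gen.
  apply: (socle_gen_in sN (submod_valP (v : submod N) sN.1)).
  by apply: contra v0 => /eqP e; apply/eqP/val_inj.
(* The part of the simple [N] inside step [kappa] contains [socle_gen], so it is not zero and must
   be all of [N]. *)
pose I : set (subrep N) := [set u : subrep N | gfilt kappa (val (u : submod N))].
have sI : op_stable I.
  split; first split.
  - exact: st.1.1.
  - by move=> a u1 u2 h1 h2; apply: st.1.2.
  move=> g u h1; rewrite /I /mkset subrep_opE //; exact: st.2.
have [I0|IT] := simN I sI.
  have : I (insubd (0 : submod N) socle_gen).
    by rewrite /I /mkset val_insubd_submod //; [exact: socle_gen_layer | exact: sN.1].
  rewrite I0 => /(congr1 val); rewrite val_insubd_submod //; last exact: sN.1.
  by move=> e; case/eqP: socle_gen_neq0.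
have : I (insubd (0 : submod N) x) by rewrite IT.
by rewrite /I /mkset val_insubd_submod //; exact: sN.1.
Qed.

Lemma socle_iso : rep_iso (gow_layer F n k l kappa%:Z) (socle_rep (Defs.St F n k)).
Proof.
have st := gfilt_stable F n k l kappa.
set S := [set x : Stk | exists N, [/\ op_stable N, simple_rep (subrep N) & N x]].
have memS (v : submod S) : gfilt kappa (val v).
  rewrite -socleE; exact/asboolP/(valP v).
have inS w : gfilt kappa w -> exists v : submod S, val v = w.
  by move=> hw; exists (insubd (0 : submod S) w); rewrite insubdK //; apply/asboolP; rewrite socleE.
apply: (rep_iso_rel (X := subquorep (gfilt kappa) (gfilt kappa.+1)) (Y := subrep S)
  (r := fun y v => y = gclass l kappa (val (v : submod S)))).
- by move=> a y v y' v' -> ->; exact/esym/(gclass_lin a (memS v) (memS v')).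
- move=> z; have [w hw ->] := sqclass_surj st z.
  by have [v e] := inS w hw; exists v; rewrite e.
- by move=> v; exists (gclass l kappa (val (v : submod S))).
- by move=> z ->; apply/(gclass_eq0 st.1.1); rewrite gfilt_above.
- move=> v /esym/(gclass_eq0 (memS v)); rewrite gfilt_above => e.
  exact: val_inj.
move=> g z v ->; rewrite gclass_op //; congr gclass.
rewrite /= insubdK //; apply/asboolP; rewrite socleE; apply: st.2; exact: memS.
Qed.

End Socle.

Theorem corollary4p8 (F : finFieldType) (n : nat) (k : fieldType) (l : nat)
    (char_k : l \in [pchar k]%R) :
  let kappa := logn l (nb_full_flags F n) in
  (forall i : nat,
     rep_iso (top_weight_space (Delta0k_layer F n k l i))
             (gow_layer F n k l (kappa%:Z - i%:Z)%R)) /\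
  (simple_rep (as_PGmod (L0k F n k l)) /\
   rep_iso (top_weight_space (L0k F n k l)) (socle_rep (St F n k))).
Proof.
move=> kappa; split=> [i|].
  have [ik|ki] := leqP i kappa; first by rewrite subzn //; apply: layer_iso.
  (* For [i > kappa] the index is negative and the target is zero by convention. *)
  have [m ->] : exists m, kappa%:Z - i%:Z = Negz m by exists (i - kappa).-1; rewrite NegzE; lia.
  exact: (high_layer_iso char_k ki).
split; first exact: simple_L0.
have := layer_iso char_k (leq0n kappa); rewrite subn0 => h.
exact: rep_iso_trans h (socle_iso F n char_k).
Qed.
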